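(* Let $\{B^H(t),t\in[0,1]\}$ be a $d$-dimensional fractional Brownian motion with Hurst index $H\in(0,1)$, let $f\in C^H(\mathbf{I})$, and let $F\subseteq\mathbb{R}^d$ and $E\subset\mathbf{I}$ be compact sets, where $E\subset(\mathbf{I},|\cdot|)$ is $\beta$-Ahlfors-David regular for some $\beta\in(0,1]$. Then there is a positive constant $\mathtt{c}_2$, depending on $E$, $F$, $H$, $\mathrm{K}_f$ and $\beta$, such that $$\mathtt{c}_2^{-1}\,\mathcal{C}^{d-\beta/H}(F)\le\mathbb{P}\{(B^H+f)(E)\cap F\ne\emptyset\}\le\mathtt{c}_2\,\mathcal{H}^{d-\beta/H}(F).$$
   Context: $\mathbf{I}=[a,b]$ with fixed $0<a<b\le 1$. A real fractional Brownian motion $B_0^H$ is a centered Gaussian process with continuous paths and covariance $\frac12(|t|^{2H}+|s|^{2H}-|t-s|^{2H})$; $B^H$ has $d$ independent copies of $B_0^H$ as components and is defined on a complete probability space $(\Omega,\mathcal{F},\mathbb{P})$. $C^H(\mathbf{I})$ is the space of $H$-Hölder functions $f:\mathbf{I}\to\mathbb{R}^d$, with norm $\|f\|_H=\sup_{s\in\mathbf{I}}\|f(s)\|+\sup_{s\ne t}\|f(t)-f(s)\|/|t-s|^H$; $\mathrm{K}_f$ denotes $\|f\|_H$. A set $G$ in a metric space $(\mathscr{X},\rho)$ is $\gamma$-Ahlfors-David regular ($\gamma>0$) if there exist a finite positive Borel measure $\mu$ supported on $G$ and a constant $\mathfrak{c}_\gamma>0$ with $\mathfrak{c}_\gamma^{-1}r^\gamma\le\mu(B_\rho(a,r))\le\mathfrak{c}_\gamma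 r^\gamma$ for all $a\in G$, $0<r\le1$ (open balls). For $\alpha>0$, $\mathcal{H}^\alpha$ is the Euclidean Hausdorff measure $\mathcal{H}^\alpha(G)=\lim_{\delta\to0}\inf\{\sum_n(2r_n)^\alpha: G\subseteq\bigcup_n B(r_n),\ r_n\le\delta\}$ (open balls $B(r_n)$ of radius $r_n$); by convention $\mathcal{H}^\alpha=1$ for $\alpha\le0$. For $\alpha\in\mathbb{R}$, $\mathcal{C}^\alpha(G)=\big[\inf_{\mu\in\mathcal{P}(G)}\iint\varphi_\alpha(\|u-v\|)\mu(du)\mu(dv)\big]^{-1}$, with $\mathcal{P}(G)$ the probability measures carried by $G$, $\varphi_\alpha(r)=r^{-\alpha}$ if $\alpha>0$, $\varphi_0(r)=\log\left(\frac{e}{r\wedge1}\right)$, $\varphi_\alpha(r)=1$ if $\alpha<0$ ($\varphi_\alpha(0)=\infty$ for $\alpha\ge0$, $1/\infty=0$, $\inf\emptyset=\infty$). *)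

(* Defs.v *)
From mathcomp Require Export all_boot all_order all_algebra.
From mathcomp Require Export all_classical all_reals all_analysis.

Set Implicit Arguments.
Unset Strict Implicit.
Unset Printing Implicit Defensive.

Export Order.TTheory GRing.Theory Num.Theory.
Export numFieldNormedType.Exports.

Local Open Scope classical_set_scope.
Local Open Scope ring_scope.

(* The library's norm and [ball] on ['rV[R]_d] are those of the sup norm, so
   the Euclidean versions are defined here; the topology is the same. *)
Definition enorm (R : realType) (d : nat) (x : 'rV[R]_d) : R :=
  Num.sqrt (\sum_(i < d) x ord0 i ^+ 2).

Definition eball (R : realType) (d : nat) (x : 'rV[R]_d) (r : R) :
    set 'rV[R]_d :=
  [set y | enorm (y - x) < r].

(* [R^d] with its Borel sigma-algebra. *)
Definition borelRV (R : realType) (d : nat) :=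
  g_sigma_algebraType (@open 'rV[R]_d).

Definition holder_space (R : realType) (d : nat) (a b H : R)
    (f : R -> 'rV[R]_d) : Prop :=
  exists M : R, forall s t : R, `[a, b]%classic s -> `[a, b]%classic t ->
    enorm (f t - f s) <= M * `|t - s| `^ H.

Definition holder_norm (R : realType) (d : nat) (a b H : R)
    (f : R -> 'rV[R]_d) : \bar R :=
  (ereal_sup [set (enorm (f s))%:E | s in `[a, b]%classic]
   + ereal_sup [set (enorm (f p.2 - f p.1) / `|p.2 - p.1| `^ H)%:E | p in
       [set p : R * R |
         [/\ `[a, b]%classic p.1, `[a, b]%classic p.2 & p.1 != p.2]]])%E.

(* Ahlfors-David regularity in the real line; [ball x r] is the open interval
   of centre [x] and radius [r]. As [mu] does not charge the complement of [G],
   it does not matter whether balls are taken in the line or in an interval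
   that contains [G]. "Positive" is read as "nonzero", so [G] is nonempty. *)
Definition ad_regular (R : realType) (gamma : R) (G : set R) : Prop :=
  0 < gamma /\
  exists mu : {measure set R -> \bar R},
    [/\ (0 < mu setT)%E, (mu setT < +oo)%E, mu (~` G) = 0%E &
      exists2 c : R, 0 < c &
        forall x r : R, G x -> 0 < r <= 1 ->
          ((c^-1 * r `^ gamma)%:E <= mu (ball x r))%E /\
          (mu (ball x r) <= (c * r `^ gamma)%:E)%E].

(* A radius 0 gives an empty ball, so finite covers are included. *)
Definition hausdorff_delta (R : realType) (d : nat) (alpha : R)
    (G : set 'rV[R]_d) (delta : R) : \bar R :=
  ereal_inf [set (\sum_(0 <= n <oo) ((2 * p.2 n) `^ alpha)%:E)%E | p in
    [set p : (nat -> 'rV[R]_d) * (nat -> R) |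
      (forall n, 0 <= p.2 n <= delta) /\
      G `<=` \bigcup_n eball (p.1 n) (p.2 n)]].

Definition hausdorff_measure (R : realType) (d : nat) (alpha : R)
    (G : set 'rV[R]_d) : \bar R :=
  if alpha <= 0 then 1%E
  else lim (hausdorff_delta alpha G delta @[delta --> 0^'+]).

Definition riesz_kernel (R : realType) (alpha r : R) : \bar R :=
  if alpha < 0 then 1%E
  else if r == 0 then +oo%E
  else if alpha == 0 then (ln (expR 1 / Num.min r 1))%:E
  else (r `^ (- alpha))%:E.

Definition energy (R : realType) (d : nat) (alpha : R)
    (mu : probability (borelRV R d) R) : \bar R :=
  (\int[mu]_u \int[mu]_v
     riesz_kernel alpha (enorm ((u : 'rV[R]_d) - (v : 'rV[R]_d))))%E.

Definition capacity (R : realType) (d : nat) (alpha : R)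
    (G : set 'rV[R]_d) : \bar R :=
  ((ereal_inf [set energy alpha mu | mu in
      [set mu : probability (borelRV R d) R | mu G = 1%E]])^-1)%E.

(* Normal law, where standard deviation 0 stands for a point mass ([normal_prob]
   is the uniform law on [0, 1] in that case). *)
Definition gaussian_law (R : realType) (m s : R) (A : set R) : \bar R :=
  if s == 0 then \d_m A else normal_prob m s A.

Definition is_gaussian (disp : measure_display) (T : measurableType disp)
    (R : realType) (P : probability T R) (Y : T -> R) : Prop :=
  measurable_fun setT Y /\
  exists m s : R, forall A : set R, measurable A ->
    P (Y @^-1` A) = gaussian_law m s A.

Definition gaussian_process (disp : measure_display) (T : measurableType disp)
    (R : realType) (P : probability T R) (D : set R)
    (X : R -> {RV P >-> R}) : Prop :=
  forall (n : nat) (t c : 'I_n -> R), (forall k, D (t k)) ->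
    is_gaussian P (fun w => \sum_(k < n) c k * X (t k) w).

(* The processes below are indexed by [R], but only their values at times in
   [D] are constrained. *)
Definition is_fbm (disp : measure_display) (T : measurableType disp)
    (R : realType) (P : probability T R) (D : set R) (H : R)
    (X : R -> {RV P >-> R}) : Prop :=
  [/\ gaussian_process D X,
      (forall t, D t -> ('E_P[X t] = 0)%E),
      (forall s t, D s -> D t ->
         covariance P (X s) (X t) =
         (2^-1 * (`|t| `^ (2 * H) + `|s| `^ (2 * H)
                  - `|t - s| `^ (2 * H)))%:E) &
      (forall w : T, {within D, continuous (fun t => X t w)})].

Definition process_sigma (disp : measure_display) (T : measurableType disp)
    (R : realType) (P : probability T R) (D : set R)
    (X : R -> {RV P >-> R}) : set (set T) :=
  <<s \bigcup_(t in D) preimage_set_system setT (X t) measurable >>.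

(* Choosing [A i = setT] gives the product rule for subfamilies. *)
Definition independent_processes (disp : measure_display)
    (T : measurableType disp) (R : realType) (P : probability T R) (D : set R)
    (d : nat) (B : 'I_d -> R -> {RV P >-> R}) : Prop :=
  forall A : 'I_d -> set T, (forall i, process_sigma D (B i) (A i)) ->
    P (\bigcap_(i in [set: 'I_d]) A i) = (\prod_(i < d) P (A i))%E.

Definition is_fbm_dim (disp : measure_display) (T : measurableType disp)
    (R : realType) (P : probability T R) (D : set R) (H : R)
    (d : nat) (B : 'I_d -> R -> {RV P >-> R}) : Prop :=
  (forall i, is_fbm D H (B i)) /\ independent_processes D B.

Definition hits (disp : measure_display) (T : measurableType disp)
    (R : realType) (P : probability T R) (d : nat)
    (B : 'I_d -> R -> {RV P >-> R}) (f : R -> 'rV[R]_d)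
    (E : set R) (F : set 'rV[R]_d) : set T :=
  [set w | ([set (\row_(i < d) B i t w) + f t | t in E] `&` F) !=set0].

(* Main.v *)
(** Lower bound. The two-point estimate
      P(B_s + f(s) within e of x, B_t + f(t) within e of y)
        <= C e^(2d) / max(e, |x - y|, |t - s|^H)^d
    comes from strong local nondeterminism: conditionally on one component of
    B_s, the same component of B_t is Gaussian with standard deviation of order
    |t - s|^H. Put weights mu on small cells of F and equal weights on an
    e^(1/H)-net of E. By regularity of E, summing the estimate over the net
    turns max(e, r, |t - s|^H)^-d into the Riesz kernel of order d - beta / H,
    so the weighted number of occurring hits has second moment at most
    C e^(2d) times the energy of mu, while its mean is at least c e^d. The
    second moment method, then compactness as e tends to 0, give the bound.

    Upper bound. E is covered by at most C r^(-beta/H) intervals [u, v] of length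
    of order r^(1/H). On such an interval write each component as
    X_t = rho_t X_u + Z_t, with Z uncorrelated with X_u, and chain Z over the
    dyadic points. Up to events of rapidly decreasing probability Z is of order r,
    and each of these events is independent of X_u, so X comes within C r of a
    given level with probability at most C r. Hence a ball of radius r is hit
    over E with probability at most C r^d r^(-beta/H); sum over a cover of F.

    The independence of uncorrelated U and V enters only through the factorization
    of expectations of Gaussian bumps of U and V. This follows from the laws of the
    combinations x U + y V, because a bump is a Gaussian mixture of cosines. *)

Require Import Defs.
From mathcomp Require Import all_boot all_order all_algebra.
From mathcomp Require Import all_classical all_reals all_analysis.
From mathcomp Require Import measurable_realfun ring lra.
From HB Require Import structures.

Set Implicit Arguments.
Unset Strict Implicit.
Unset Printing Implicit Defensive.

Import Order.TTheory GRing.Theory Num.Theory.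
Import numFieldNormedType.Exports.

Local Open Scope classical_set_scope.
Local Open Scope ring_scope.

(** * Integration against normal laws *)

(** Only expectations of bumps factor, so every event has to be dominated by a function built from
    bumps. A window [|U - c| <= e] lies under a multiple of a bump. A tail [|V| > lam] lies under a
    multiple of (1 - bump)^N, which expands into bumps because a power of a bump is a narrower bump.
    Its expectation decays like lam^(-2N), so the tails are polynomial, of a degree that can be
    chosen. Chaining takes N with H N >= 2, so that each of the 2^k increments of level k fails with
    probability of order 4^-k.

    The drift f moves the target, and the regression coefficient of X_t on X_s is not 1. Both errors
    are of order |t - s|^H, the scale of the estimates themselves, and only enlarge constants.

    In the two-point estimate the power d of |x - y| comes from a single coordinate, the one in
    which x and y are farthest apart: its Gaussian factor beats every power.

    The constant must precede the probability space and the drift, so all estimates carry explicit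
    constants in d, a, H, K, a bound M for F and the net constant of E. *)

Section density.
Context d (T : measurableType d) (R : realType).
Variables (mu : {sigma_finite_measure set T -> \bar R})
  (nu : {finite_measure set T -> \bar R}) (p : T -> R).
Hypothesis p0 : forall x, 0 <= p x.
Hypothesis mp : measurable_fun setT p.
Hypothesis nup : forall A, measurable A -> nu A = (\int[mu]_(x in A) (p x)%:E)%E.

(** By [nup] the function [p] agrees almost everywhere with the Radon-Nikodym derivative of [nu],
    for which change of variables is available. *)
Lemma ge0_integral_density (h : T -> \bar R) : measurable_fun setT h ->
  (forall x, 0 <= h x)%E ->
  (\int[nu]_x h x = \int[mu]_x (h x * (p x)%:E))%E.
Proof.
move=> mh h0; have mpE : measurable_fun setT (fun x => (p x)%:E) by exact/measurable_EFinP.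
have numu : nu `<< mu.
  apply/null_content_dominatesP => A mA muA; rewrite nup//.
  by apply: null_set_integral => //; exact: measurable_funTS.
rewrite -(Radon_Nikodym_SigmaFinite.change_of_variables numu)//.
have mf := measurable_int _ (Radon_Nikodym_SigmaFinite.f_integrable numu).
apply: ae_eq_integral => //; [exact: emeasurable_funM|exact: emeasurable_funM|].
apply: ae_eqe_mul2l; apply: integral_ae_eq => //.
  exact: Radon_Nikodym_SigmaFinite.f_integrable.
by move=> A _ mA; rewrite -Radon_Nikodym_SigmaFinite.f_integral// nup.
Qed.

Lemma integral_density (h : T -> R) : measurable_fun setT h ->
  (\int[nu]_x (h x)%:E = \int[mu]_x (h x * p x)%:E)%E.
Proof.
move=> mh; have mhE : measurable_fun setT (EFin \o h) by exact/measurable_EFinP.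
rewrite (integralE nu) (integralE mu); congr (_ - _)%E.
- rewrite ge0_integral_density//; last exact: measurable_funepos.
  apply: eq_integral => x _; rewrite !funeposE maxeMl ?lee_fin//.
  by rewrite mul0e EFinM.
- rewrite ge0_integral_density//; last exact: measurable_funeneg.
  apply: eq_integral => x _; rewrite !funenegE maxeMl ?lee_fin//.
  by rewrite mul0e EFinM mulNe.
Qed.

Lemma integrable_density (h : T -> R) : measurable_fun setT h ->
  nu.-integrable setT (EFin \o h) <->
  mu.-integrable setT (EFin \o (fun x => h x * p x)).
Proof.
move=> mh.
have E : (\int[nu]_x `|(h x)%:E| = \int[mu]_x `|(h x * p x)%:E|)%E.
  rewrite ge0_integral_density//.
  - by apply: eq_integral => x _; rewrite EFinM abseM (gee0_abs (x := (p x)%:E))// lee_fin.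
  - by apply: measurableT_comp => //; exact/measurable_EFinP.
split=> /integrableP[_ H]; apply/integrableP; split => //=.
- by apply/measurable_EFinP/measurable_funM.
- by rewrite -E.
- exact/measurable_EFinP.
- by rewrite E.
Qed.

End density.

Section integral_derivative.
Context {R : realType}.
Notation mu := (@lebesgue_measure R).

(** The fundamental theorem of calculus on growing symmetric intervals, passed to the limit by
    dominated convergence with [|f|] as dominating function. *)
Lemma integral_derive_eq0 (F f : R -> R) :
  (forall x, is_derive x (1:R) F (f x)) -> continuous f ->
  mu.-integrable setT (EFin \o f) ->
  F x @[x --> +oo] --> 0 -> F x @[x --> -oo] --> 0 ->
  \int[mu]_x f x = 0.
Proof.
move=> dF cf fi Fy FNy.
have cF : continuous F.
  move=> x; apply/differentiable_continuous/derivable1_diffP.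
  exact: (@ex_derive _ _ _ _ _ _ _ (dF x)).
(* [n.+1] keeps the interval nondegenerate, as the fundamental theorem requires. *)
pose g (n : nat) := fun x => ((f \_ `[- n.+1%:R, n.+1%:R]) x)%:E : \bar R.
have := @dominated_convergence _ _ _ mu setT measurableT g (EFin \o f)
  (fun x => `|(f x)%:E|%E).
case.
- move=> n; apply/measurable_EFinP/(measurable_restrictT _ _).1 => //.
  by apply: measurable_funTS; exact: continuous_measurable_fun.
- by apply/measurable_EFinP; exact: continuous_measurable_fun.
- apply: aeW => x _; apply: cvg_near_cst.
  near=> n; rewrite /g patchE mem_set//= in_itv/=.
  rewrite -ler_norml; apply: (@le_trans _ _ n%:R); last by rewrite ler_nat.
  by near: n; exact: nbhs_infty_ger.
- exact: integrable_abse.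
- apply: aeW => x n _; rewrite /g patchE; case: ifP => // _.
  by rewrite abse0.
move=> _ _.
have gE n : (\int[mu]_x g n x)%E = (F n.+1%:R - F (- n.+1%:R))%:E.
  rewrite (_ : (\int[mu]_x g n x)%E =
     (\int[mu]_(x in `[(- n.+1%:R)%R, n.+1%:R%R]) (f x)%:E)%E); last first.
    by rewrite [RHS]integral_mkcond; apply: eq_integral => x _; rewrite /g restrict_EFin.
  rewrite (@continuous_FTC2 _ _ F) ?EFinB//.
  - by rewrite ltrNl (@lt_le_trans _ _ 0)// ltrNl oppr0.
  - exact: continuous_subspaceT.
  - split.
    + by move=> x _; exact: (@ex_derive _ _ _ _ _ _ _ (dF x)).
    + exact/cvg_at_right_filter/cF.
    + exact/cvg_at_left_filter/cF.
  - by move=> x _; rewrite derive1E; exact: (@derive_val _ _ _ _ _ _ _ (dF x)).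
under eq_fun do rewrite gE.
have F0 : (F n.+1%:R - F (- n.+1%:R)) @[n --> \oo] --> (0 : R).
  rewrite -(subr0 0); apply: cvgB.
  - apply: (cvg_comp (fun n : nat => n.+1%:R : R) F _ Fy).
    by rewrite (cvg_shiftS (fun n => n%:R : R)); exact: cvgr_idn.
  - apply: (cvg_comp (fun n : nat => - n.+1%:R : R) F _ FNy).
    apply/cvgNrNy.
    by rewrite (cvg_shiftS (fun n => n%:R : R)); exact: cvgr_idn.
move=> h; rewrite /Rintegral.
have : (F n.+1%:R - F (- n.+1%:R))%:E @[n --> \oo] --> (0 : \bar R)%E.
  by apply/cvg_EFin; [exact: nearW|exact: F0].
by move/(cvg_unique (@ereal_hausdorff R) h) => /= ->.
Unshelve. all: by end_near. Qed.

End integral_derivative.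

Section normal_law.
Context {R : realType}.
Notation mu := (@lebesgue_measure R).
Variables (m s : R).
Hypothesis s0 : s != 0.
Notation p := (normal_pdf m s).
Notation N := (normal_prob m s).

Let pE x : p x = normal_peak s * expR (- (x - m) ^+ 2 / (s ^+ 2 *+ 2)).
Proof. by rewrite normal_pdfE. Qed.

Lemma normal_density A : measurable A ->
  N A = (\int[mu]_(x in A) (p x)%:E)%E.
Proof. by []. Qed.

Lemma normal_integral_density (h : R -> R) : measurable_fun setT h ->
  \int[N]_x h x = \int[mu]_x (h x * p x).
Proof.
move=> mh; congr fine.
exact: (@integral_density _ _ R mu N p (normal_pdf_ge0 m s) (measurable_normal_pdf m s)
  normal_density).
Qed.

Lemma normal_integrable_density (h : R -> R) : measurable_fun setT h ->
  N.-integrable setT (EFin \o h) <->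
  mu.-integrable setT (EFin \o (fun x => h x * p x)).
Proof.
move=> mh.
exact: (@integrable_density _ _ R mu N p (normal_pdf_ge0 m s) (measurable_normal_pdf m s)
  normal_density).
Qed.

(** With [z = (x - m)^2 / (4 s^2)] the density is a multiple of [expR (- z) * expR (- z)]. One
    factor absorbs the quadratic weight through [1 + z <= expR z]; the other is, up to a constant,
    the density with standard deviation [Num.sqrt 2 * s]. *)
Lemma normal_pdf_quad x : (1 + (x - m) ^+ 2) * p x <=
  (1 + 4 * s ^+ 2) * Num.sqrt 2 * normal_pdf m (Num.sqrt 2 * s) x.
Proof.
have s20 : 0 < s ^+ 2 by rewrite exprn_even_gt0.
have r20 : (Num.sqrt 2 * s : R) != 0 by rewrite mulf_neq0// sqrtr_eq0 -ltNge.
rewrite pE (normal_pdfE _ r20) /normal_fun.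
set z := (x - m) ^+ 2 / (4 * s ^+ 2).
have z0 : 0 <= z by rewrite divr_ge0 ?sqr_ge0// mulr_ge0// ltW.
have -> : - (x - m) ^+ 2 / (s ^+ 2 *+ 2) = - z + - z.
  by rewrite /z; field; rewrite ?s0.
have -> : - (x - m) ^+ 2 / ((Num.sqrt 2 * s) ^+ 2 *+ 2) = - z.
  rewrite /z exprMn sqr_sqrtr//; by field; rewrite ?s0.
have -> : normal_peak (Num.sqrt 2 * s) = (Num.sqrt 2)^-1 * normal_peak s.
  rewrite /normal_peak exprMn sqr_sqrtr// -invfM -sqrtrM//; congr (_^-1).
  by congr Num.sqrt; ring.
rewrite expRD.
have -> : (1 + 4 * s ^+ 2) * Num.sqrt 2 * ((Num.sqrt 2)^-1 * normal_peak s * expR (- z))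
  = normal_peak s * expR (- z) * (1 + 4 * s ^+ 2).
  have : Num.sqrt 2 != 0 :> R by rewrite sqrtr_eq0 -ltNge.
  by move=> ?; field.
rewrite [leLHS](_ : _ = normal_peak s * expR (- z) * ((1 + (x - m) ^+ 2) * expR (- z)));
  last ring.
apply: ler_wpM2l; first by rewrite mulr_ge0// ?normal_peak_ge0 ?expR_ge0.
rewrite expRN ler_pdivrMr ?expR_gt0//.
apply: (@le_trans _ _ ((1 + 4 * s ^+ 2) * (1 + z))); last first.
  by apply: ler_wpM2l; [rewrite addr_ge0// mulr_ge0// ltW|rewrite expR_ge1Dx].
have -> : (x - m) ^+ 2 = 4 * s ^+ 2 * z by rewrite /z; field; rewrite ?s0.
nra.
Qed.

(** Makes the boundary terms vanish in the integration by parts below, where [g] grows at most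
    linearly. *)
Lemma normal_pdf_lin_le : exists2 C, 0 <= C & forall x, (1 + `|x - m|) * p x <= C / (1 + `|x
  - m|).
Proof.
exists (2 * ((1 + 4 * s ^+ 2) * Num.sqrt 2 * normal_peak (Num.sqrt 2 * s))).
  have c0 : 0 <= 1 + 4 * s ^+ 2 by nra.
  by rewrite mulr_ge0// mulr_ge0 ?normal_peak_ge0// mulr_ge0// sqrtr_ge0.
move=> x; rewrite ler_pdivlMr; last by rewrite ltr_pwDl.
have r20 : (Num.sqrt 2 * s : R) != 0 by rewrite mulf_neq0// sqrtr_eq0 -ltNge.
apply: (@le_trans _ _ (2 * ((1 + (x - m) ^+ 2) * p x))); last first.
  rewrite ler_wpM2l//; apply: (le_trans (normal_pdf_quad x)).
  rewrite ler_wpM2l ?normal_pdf_ub//.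
  have c0 : 0 <= 1 + 4 * s ^+ 2 by nra.
  by rewrite mulr_ge0// sqrtr_ge0.
rewrite -(real_normK (num_real (x - m))) mulrAC [leRHS]mulrA.
apply: ler_wpM2r; first exact: normal_pdf_ge0.
have := sqr_ge0 (1 - `|x - m|); nra.
Qed.

Lemma normal_integrable_quad (h : R -> R) A : measurable_fun setT h ->
  (forall x, `|h x| <= A * (1 + (x - m) ^+ 2)) -> N.-integrable setT (EFin \o h).
Proof.
move=> mh hA.
apply/(normal_integrable_density mh).
have A0 : 0 <= A.
  have := hA m; rewrite subrr expr0n/= addr0 mulr1; exact: le_trans.
have := @le_integrable _ _ _ mu setT measurableT (EFin \o (fun x => h x * p x))
  (fun x => (A * ((1 + 4 * s ^+ 2) * Num.sqrt 2))%:E *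
   (normal_pdf m (Num.sqrt 2 * s) x)%:E)%E.
apply.
- apply/measurable_EFinP/measurable_funM => //; exact: measurable_normal_pdf.
- move=> x _; rewrite -EFinM lee_fin /= normrM (ger0_norm (normal_pdf_ge0 _ _ _)).
  apply: (@le_trans _ _ (A * ((1 + (x - m) ^+ 2) * p x))).
    by rewrite mulrA ler_wpM2r ?normal_pdf_ge0.
  apply: (le_trans _ (ler_norm _)).
  by rewrite -[leRHS]mulrA ler_wpM2l// normal_pdf_quad.
- apply: integrableZl => //; exact: integrable_normal_pdf.
Qed.

(** Stein's identity: the derivative of [g * p] is [g' * p - (x - m) / s^2 * g * p], and its
    integral over the line vanishes. Mean, variance and cosine transform of the normal law all
    follow from it. *)
Lemma normal_stein (g g' : R -> R) (A : R) :
  (forall x, is_derive x (1 : R) g (g' x)) -> continuous g' ->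
  (forall x, `|g x| <= A * (1 + `|x - m|)) -> (forall x, `|g' x| <= A) ->
  \int[N]_x ((x - m) * g x) = s ^+ 2 * \int[N]_x g' x.
Proof.
move=> dg cg' gA g'A.
have s20 : 0 < s ^+ 2 by rewrite exprn_even_gt0.
have A0 : 0 <= A by exact: le_trans (g'A 0).
have cg : continuous g.
  move=> x; apply/differentiable_continuous/derivable1_diffP.
  exact: (@ex_derive _ _ _ _ _ _ _ (dg x)).
have mg : measurable_fun setT g by exact: continuous_measurable_fun.
have mg' : measurable_fun setT g' by exact: continuous_measurable_fun.
have mxg : measurable_fun setT (fun x : R => (x - m) * g x).
  by apply: measurable_funM => //; apply: measurable_funB.
have i1 : N.-integrable setT (EFin \o (fun x => (x - m) * g x)).
  apply: (normal_integrable_quad (A := 2 * A)) => // x.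
  rewrite normrM; apply: (@le_trans _ _ (`|x - m| * (A * (1 + `|x - m|)))).
    by rewrite ler_wpM2l.
  rewrite -(real_normK (num_real (x - m))).
  have := sqr_ge0 (1 - `|x - m|); nra.
have i2 : N.-integrable setT (EFin \o g').
  apply: (normal_integrable_quad (A := A)) => // x.
  by apply: (le_trans (g'A x)); rewrite ler_peMr// lerDl sqr_ge0.
have dp x : is_derive x (1 : R) p (- ((x - m) / s ^+ 2 * p x)).
  rewrite normal_pdfE//.
  apply: is_derive_eq.
  rewrite /normal_fun /GRing.scale /=.
  by field; rewrite ?s0.
have cp : continuous p by exact: continuous_normal_pdf.
pose f x := g' x * p x - (x - m) / s ^+ 2 * g x * p x.
suff : \int[mu]_x f x = 0.
  move=> f0.
  have e1 : \int[N]_x g' x = \int[mu]_x (g' x * p x).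
    exact: normal_integral_density.
  have e2 : \int[N]_x ((x - m) * g x) = \int[mu]_x ((x - m) * g x * p x).
    exact: normal_integral_density.
  have /(normal_integrable_density mg') j2 := i2.
  have /(normal_integrable_density mxg) j1 := i1.
  rewrite e1 e2; apply/eqP; rewrite -subr_eq0 -RintegralZl//.
  rewrite -RintegralB//=; last first.
    have := @integrableZl _ _ _ mu setT measurableT (s^+2) _ j2.
    by apply: eq_integrable => // x _; rewrite /= EFinM.
  rewrite [X in X == 0](_ : _ = (- s ^+ 2) * \int[mu]_x f x); last first.
    rewrite -RintegralZl//.
      apply: eq_Rintegral => x _; rewrite /f; by field; rewrite ?s0.
    rewrite /f.
    have := @integrableB _ _ _ mu setT measurableT _ _ j2 (@integrableZl _ _ _ mu setT
      measurableT (s^-2) _ j1).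
    apply: eq_integrable => // x _; rewrite /=; congr (_%:E).
    by rewrite /f; field; rewrite ?s0.
  by rewrite f0 mulr0.
have [C C0 pC] := normal_pdf_lin_le.
have Fb x : `|g x * p x| <= (A * C) / (1 + `|x - m|).
  rewrite normrM (ger0_norm (normal_pdf_ge0 _ _ _)) -mulrA.
  apply: (@le_trans _ _ (A * ((1 + `|x - m|) * p x))).
    by rewrite mulrA ler_wpM2r ?normal_pdf_ge0.
  by rewrite ler_wpM2l.
have F0 e : 0 < e -> forall x, A * C / e + 1 <= `|x - m| -> `|g x * p x| <= e.
  move=> e0 x xm; apply: (le_trans (Fb x)); rewrite ler_pdivrMr ?ltr_pwDl//.
  have h : A * C / e <= 1 + `|x - m| by lra.
  by move: h; rewrite ler_pdivrMr// (mulrC e).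
apply: (@integral_derive_eq0 _ (fun x => g x * p x)).
- move=> x; apply: is_derive_eq.
  rewrite /f /GRing.scale /=; by field; rewrite ?s0.
- move=> x; apply: cvgB; first by apply: cvgM; [exact: cg'|exact: cp].
  apply: cvgM; last exact: cp.
  apply: cvgM; last exact: cg.
  by apply: cvgMl; apply: cvgB; [exact: cvg_id|exact: cvg_cst].
- have /(normal_integrable_density mg') j2 := i2.
  have /(normal_integrable_density mxg) j1 := i1.
  have := @integrableB _ _ _ mu setT measurableT _ _ j2 (@integrableZl _ _ _ mu setT
    measurableT (s^-2) _ j1).
  apply: eq_integrable => // x _; rewrite /=; congr (_%:E).
  by rewrite /f; field; rewrite ?s0.
- apply/cvgrPdist_le => e e0; near=> x; rewrite sub0r normrN; apply: (F0 _ e0).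
  rewrite (le_trans _ (ler_norm _))// lerBrDr; near: x; by apply: nbhs_pinfty_ge;
    exact: num_real.
- apply/cvgrPdist_le => e e0; near=> x; rewrite sub0r normrN; apply: (F0 _ e0).
  rewrite distrC (le_trans _ (ler_norm _))// lerBrDl -lerBrDr; near: x.
  by apply: nbhs_ninfty_le; exact: num_real.
Unshelve. all: by end_near. Qed.

End normal_law.

Section normal_moments.
Context {R : realType}.
Notation mu := (@lebesgue_measure R).
Variables (m s : R).
Hypothesis s0 : s != 0.
Notation p := (normal_pdf m s).
Notation N := (normal_prob m s).

Lemma normal_integral_cst r : \int[N]_x r = r.
Proof.
rewrite (@Rintegral_cst _ _ _ N setT measurableT r) [X in fine X](_ : _ = 1%E) ?mulr1//.
exact: probability_setT.
Qed.

Lemma normal_mean : \int[N]_x (x - m) = 0.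
Proof.
have dg (x : R) : is_derive x (1:R) (cst 1 : R -> R) (cst 0 x) by exact: is_derive_cst.
have := @normal_stein _ m s s0 (cst 1) (cst 0) 1 dg.
rewrite /= (_ : \int[N]_x 0 = 0) ?mulr0; last first.
  exact: normal_integral_cst.
move=> <-//.
- by apply: eq_Rintegral => x _; rewrite mulr1.
- by move=> x; exact: cst_continuous.
- by move=> x; rewrite normr1 mul1r lerDl.
- by move=> x; rewrite normr0.
Qed.

Lemma normal_variance : \int[N]_x ((x - m) ^+ 2) = s ^+ 2.
Proof.
have dg (x : R) : is_derive x (1:R) (fun x => x - m) (cst 1 x).
  by apply: is_derive_eq; rewrite oppr0 addr0.
have := @normal_stein _ m s s0 (fun x => x - m) (cst 1) 1 dg.
rewrite /= (_ : \int[N]_x 1 = 1) ?mulr1; last first.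
  exact: normal_integral_cst.
move=> <-//.
- by move=> x; exact: cst_continuous.
- by move=> x; rewrite mul1r lerDr.
- by move=> x; rewrite normr1.
Qed.

(** Differentiation under the integral and Stein's identity for the sine show that the left side, as
    a function [a] of the frequency, solves [a' = - s^2 t a]. Hence [a t * expR ((s t)^2 / 2)] is
    constant, and its value is read off at frequency 0. *)
Lemma normal_cos th phi :
  \int[N]_x cos (th * (x - m) - phi) = cos phi * expR (- (s * th) ^+ 2 / 2).
Proof.
pose a t := \int[N]_x cos (t * (x - m) - phi).
have mc t : measurable_fun setT (fun x : R => cos (t * (x - m) - phi)).
  apply: continuous_measurable_fun => x; apply: (@continuous_comp _ _ _ (fun x : R => t * (x
    - m) - phi) cos); last exact: continuous_cos.
  by apply: cvgB; [apply: cvgMr; apply: cvgB; [exact: cvg_id|exact: cvg_cst]|exact: cvg_cst].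
have ic t : N.-integrable setT (EFin \o (fun x : R => cos (t * (x - m) - phi))).
  apply: (@normal_integrable_quad _ m s s0 _ 1) => // x.
  by rewrite mul1r (@le_trans _ _ 1) ?cos_max// lerDl sqr_ge0.
have dc t x : is_derive t (1:R) (fun t => cos (t * (x - m) - phi)) (- ((x - m) * sin (t * (x
  - m) - phi))).
  apply: is_derive_eq; rewrite /GRing.scale /=; ring.
have da t : is_derive t (1:R) a (- (s ^+ 2 * t * a t)).
  have mabs : measurable_fun setT (fun x : R => `|x - m|).
    by apply: measurableT_comp => //; exact: measurable_funB.
  have iG : N.-integrable setT (EFin \o (fun x : R => `|x - m|)).
    apply: (@normal_integrable_quad _ m s s0 _ 1) => // x.
    rewrite normr_id mul1r -(real_normK (num_real (x - m))).
    have := sqr_ge0 (1 - `|x - m|); nra.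
  have ita : `]t - 1, t + 1[%classic t by rewrite /= in_itv/= ltrBlDr ltrDl ltr01.
  pose f := fun (t x : R) => cos (t * (x - m) - phi).
  have d1f u x : partial1of2 f u x = - ((x - m) * sin (u * (x - m) - phi)).
    by rewrite partial1of2E; exact: (@derive_val _ _ _ _ _ _ _ (dc u x)).
  have hG u x : `]t - 1, t + 1[%classic u -> setT x -> `|partial1of2 f u x| <= `|x - m|.
    move=> _ _; rewrite d1f normrN normrM ler_piMr// ler_norml; apply/andP; split.
      exact: sin_geN1.
    exact: sin_le1.
  have hd u x : `]t - 1, t + 1[%classic u -> setT x -> derivable (f ^~ x) u 1.
    by move=> _ _; exact: (@ex_derive _ _ _ _ _ _ _ (dc u x)).
  have hD := @derivable_under_integral R _ _ N f setT measurableT t (t - 1) (t + 1) ita (fun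
    u _ => ic u) hd _ (fun x => normr_ge0 (x - m)) iG hG.
  have hE := @differentiation_under_integral R _ _ N f setT measurableT t (t - 1) (t + 1) ita
    (fun u _ => ic u) hd _ (fun x => normr_ge0 (x - m)) iG hG.
  apply: DeriveDef => //; rewrite -derive1E hE.
  have dg (x : R) : is_derive x (1:R) (fun x => sin (t * (x - m) - phi)) (t * cos (t * (x -
    m) - phi)).
    by apply: is_derive_eq; rewrite /GRing.scale /=; ring.
  have := @normal_stein _ m s s0 (fun x => sin (t * (x - m) - phi)) (fun x => t * cos (t * (x
    - m) - phi)) (1 + `|t|) dg.
  rewrite RintegralZl// -/(a t) mulrA => <-.
  - rewrite -[RHS]mulN1r -RintegralZl//.
      by apply: eq_Rintegral => x _; rewrite d1f mulN1r.
    apply: (@normal_integrable_quad _ m s s0 _ 1) => //.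
      apply: measurable_funM; first exact: measurable_funB.
      apply: continuous_measurable_fun => x; apply: (@continuous_comp _ _ _ (fun x : R => t *
        (x - m) - phi) sin); last exact: continuous_sin.
      by apply: cvgB; [apply: cvgMr; apply: cvgB; [exact: cvg_id|exact: cvg_cst]|exact:
        cvg_cst].
    move=> x; have := hG t x ita I; rewrite d1f normrN mul1r => /le_trans; apply.
    rewrite -(real_normK (num_real (x - m))).
    have := sqr_ge0 (1 - `|x - m|); nra.
  - move=> x; apply: cvgMr; apply: (@continuous_comp _ _ _ (fun x : R => t * (x - m) - phi)
    cos); last exact: continuous_cos.
    by apply: cvgB; [apply: cvgMr; apply: cvgB; [exact: cvg_id|exact: cvg_cst]|exact: cvg_cst].
  - move=> x; apply: (@le_trans _ _ 1).
      by rewrite ler_norml sin_geN1 sin_le1.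
    have := normr_ge0 t; have := normr_ge0 (x - m); nra.
  - move=> x; rewrite normrM; apply: (@le_trans _ _ `|t|); last by rewrite lerDr.
    by rewrite ler_piMr// cos_max.
pose b t := a t * expR ((s * t) ^+ 2 / 2).
have db t : is_derive t (1:R) b 0.
  by apply: is_derive_eq; rewrite /GRing.scale /=; field.
have := is_derive_0_is_cst th 0 db; rewrite /b mulr0 expr0n/= mul0r expR0 mulr1.
have -> : a 0 = cos phi.
  rewrite /a; under eq_Rintegral do rewrite mul0r sub0r cosN.
  exact: normal_integral_cst.
by rewrite -/(a th) => <-; rewrite -mulrA -expRD mulNr subrr expR0 mulr1.
Qed.

(** Completing the square: bump times density is a multiple of the normal density with mean
    [(m e^2 + c s^2) / S^2] and standard deviation [s e / S], where [S^2 = s^2 + e^2]. *)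
Lemma normal_bump c e : e != 0 ->
  \int[N]_x normal_fun c e x =
  `|e| / Num.sqrt (s ^+ 2 + e ^+ 2) * expR (- (c - m) ^+ 2 / (2 * (s ^+ 2 + e ^+ 2))).
Proof.
move=> e0; rewrite normal_integral_density//; last exact: measurable_normal_fun.
have s2 : 0 < s ^+ 2 by rewrite exprn_even_gt0.
have e2 : 0 < e ^+ 2 by rewrite exprn_even_gt0.
set S := Num.sqrt _.
have S2 : S ^+ 2 = s ^+ 2 + e ^+ 2 by rewrite sqr_sqrtr// ltW// addr_gt0.
have S0 : 0 < S by rewrite sqrtr_gt0 addr_gt0.
have Sn0 : S != 0 by rewrite gt_eqF.
have se0 : s * e / S != 0 by rewrite !mulf_neq0// invr_neq0.
rewrite -S2.
transitivity (\int[mu]_x (`|e| / S * expR (- (c - m) ^+ 2 / (2 * S ^+ 2)) *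
    normal_pdf ((m * e ^+ 2 + c * s ^+ 2) / S ^+ 2) (s * e / S) x)); last first.
  rewrite RintegralZl//; last exact: integrable_normal_pdf.
  by rewrite [X in _ * X](_ : _ = 1) ?mulr1// /Rintegral integral_normal_pdf.
apply: eq_Rintegral => x _; rewrite !normal_pdfE// /normal_fun.
have -> : normal_peak (s * e / S) = S / `|e| * normal_peak s.
  rewrite /normal_peak.
  rewrite (_ : (s * e / S) ^+ 2 * pi *+ 2 = (`|e| / S) ^+ 2 * (s ^+ 2 * pi *+ 2)); last first.
    by rewrite !exprMn real_normK ?num_real//; ring.
  rewrite sqrtrM ?sqr_ge0// sqrtr_sqr ger0_norm; last by rewrite divr_ge0// ltW.
  by rewrite invfM invf_div.
rewrite mulrCA.
rewrite [RHS](_ : _ = normal_peak s * (expR (- (c - m) ^+ 2 / (2 * S ^+ 2)) *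
  expR (- (x - (m * e ^+ 2 + c * s ^+ 2) / S ^+ 2) ^+ 2 / ((s * e / S) ^+ 2 *+ 2))));
    last first.
  have ne0 : `|e| != 0 by rewrite normr_eq0.
  move: (expR _) (expR _) (normal_peak s) => A B Q.
  by field; rewrite ?ne0 ?Sn0.
congr (_ * _); rewrite -!expRD; congr expR.
have -> : (s * e / S) ^+ 2 = s ^+ 2 * e ^+ 2 / (S ^+ 2) by rewrite !exprMn exprVn.
rewrite S2; field.
by rewrite s0 e0 -?S2 ?expf_neq0//.
Qed.

(** The integrand cancels half of the exponent of the density and leaves [Num.sqrt 2] times the
    density with doubled variance. This one exponential moment later bounds all the even moments
    that the tail estimate uses. *)
Lemma normal_expsq : \int[N]_x expR ((x - m) ^+ 2 / (4 * s ^+ 2)) = Num.sqrt 2.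
Proof.
have s2 : 0 < s ^+ 2 by rewrite exprn_even_gt0.
have r2 : Num.sqrt 2 != 0 :> R by rewrite sqrtr_eq0 -ltNge.
have r20 : (Num.sqrt 2 * s : R) != 0 by rewrite mulf_neq0.
rewrite normal_integral_density//; last first.
  apply: measurableT_comp => //; apply: measurable_funM => //.
  by apply: measurable_funX; apply: measurable_funB.
transitivity (\int[mu]_x (Num.sqrt 2 * normal_pdf m (Num.sqrt 2 * s) x)); last first.
  rewrite RintegralZl//; last exact: integrable_normal_pdf.
  by rewrite [X in _ * X](_ : _ = 1) ?mulr1// /Rintegral integral_normal_pdf.
apply: eq_Rintegral => x _; rewrite !normal_pdfE// /normal_fun.
have -> : normal_peak (Num.sqrt 2 * s) = (Num.sqrt 2)^-1 * normal_peak s.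
  rewrite /normal_peak exprMn sqr_sqrtr// -invfM -sqrtrM//; congr (_^-1).
  by congr Num.sqrt; ring.
rewrite exprMn sqr_sqrtr// [RHS](_ : _ = normal_peak s * expR (- (x - m) ^+ 2 / (2 * s ^+ 2
  *+ 2))); last first.
  by field; rewrite r2.
rewrite mulrCA -expRD; congr (_ * expR _); field; by rewrite s0.
Qed.

End normal_moments.

Section bounded_integral.
Context d (T : measurableType d) (R : realType) (P : probability T R).

Lemma bounded_integrable (h : T -> R) (C : R) : measurable_fun setT h ->
  (forall x, `|h x| <= C) -> P.-integrable setT (EFin \o h).
Proof.
move=> mh hC; apply: measurable_bounded_integrable => //.
  exact: (le_lt_trans (probability_le1 P measurableT) (ltry 1)).
exists C; split; first exact: num_real.
by move=> M CM x _ /=; rewrite (le_trans (hC x))// ltW.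
Qed.

Lemma eintegral_cst1 (r : \bar R) : (\int[P]_x r = r)%E.
Proof.
rewrite integral_cst// [X in (_ * X)%E](_ : _ = 1%E) ?mule1//.
exact: probability_setT.
Qed.

Lemma Rintegral_cst1 (r : R) : \int[P]_x r = r.
Proof.
rewrite (@Rintegral_cst _ _ _ P setT measurableT r) [X in fine X](_ : _ = 1%E) ?mulr1//.
exact: probability_setT.
Qed.

Lemma Rintegral_indic (A : set T) : measurable A -> (\int[P]_x \1_A x)%:E = P A.
Proof.
move=> mA; rewrite /Rintegral integral_indic// setIT fineK//.
exact: fin_num_measure.
Qed.

End bounded_integral.

Lemma bounded_Fubini d1 d2 (T1 : measurableType d1) (T2 : measurableType d2)
    (R : realType) (P1 : probability T1 R) (P2 : probability T2 R)
    (F : T1 * T2 -> R) (C : R) : measurable_fun setT F -> (forall z, `|F z| <= C) ->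
  \int[P1]_x \int[P2]_y F (x, y) = \int[P2]_y \int[P1]_x F (x, y).
Proof.
move=> mF FC.
have mFE : measurable_fun setT (EFin \o F) by exact/measurable_EFinP.
have iF : (P1 \x P2)%E.-integrable setT (EFin \o F).
  apply/integrable12ltyP => //.
  apply: (@le_lt_trans _ _ (\int[P1]_x \int[P2]_y C%:E)%E); last first.
    by rewrite !eintegral_cst1 ltry.
  apply: ge0_le_integral => //.
  - by move=> x _; apply: integral_ge0.
  - apply: (@measurable_fun_fubini_tonelli_F _ _ T1 T2 R P2 (fun z => `|(F z)%:E|%E)) => //.
    exact: measurableT_comp.
  - move=> x _; apply: ge0_le_integral => //.
    + by apply: measurableT_comp => //; exact: measurableT_comp.
    + by move=> y _; rewrite lee_fin.
have m1 x : measurable_fun setT (fun y => F (x, y)) by exact: measurableT_comp.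
have m2 y : measurable_fun setT (fun x => F (x, y)) by exact: measurableT_comp.
congr fine.
transitivity (\int[P1]_x \int[P2]_y (F (x, y))%:E)%E.
  apply: eq_integral => x _; rewrite /Rintegral fineK//.
  by apply: integrable_fin_num => //; exact: (@bounded_integrable _ _ _ _ _ C).
transitivity (\int[P2]_y \int[P1]_x (F (x, y))%:E)%E.
  exact: (@Fubini _ _ _ _ _ P1 P2 _ iF).
apply: eq_integral => y _; rewrite /Rintegral fineK//.
by apply: integrable_fin_num => //; exact: (@bounded_integrable _ _ _ _ _ C).
Qed.

(** [is_gaussian] hides its parameters; the covariance computations have to name them. *)
Definition has_law d (T : measurableType d) (R : realType)
    (P : probability T R) (Y : T -> R) (m s : R) :=
  measurable_fun setT Y /\
  forall A : set R, measurable A -> P (Y @^-1` A) = gaussian_law m s A.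

Section gaussian_variable.
Context d (T : measurableType d) (R : realType) (P : probability T R).
Variables (Y : T -> R) (m s : R).
Hypothesis hY : has_law P Y m s.
Let mY := hY.1.

Lemma law_integral0 (h : R -> \bar R) : measurable_fun setT h ->
  (forall x, 0 <= h x)%E ->
  (\int[P]_w h (Y w) = if s == 0%R then h m else \int[normal_prob m s]_x h x)%E.
Proof.
move=> mh h0.
pose mYm := isMeasurableFun.Build d _ T (measurableTypeR R) Y mY.
pose Z : {mfun T >-> measurableTypeR R} := HB.pack Y mYm.
transitivity (\int[distribution P Z]_x h x)%E.
  by rewrite (@ge0_integral_distribution _ _ _ _ _ P Z h mh h0).
case: ifPn => s0.
  rewrite (@eq_measure_integral _ (measurableTypeR R) R setT (dirac (m : measurableTypeR R))
    (distribution P Z)); last first.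
    by move=> A mA _; have := hY.2 _ mA; rewrite /gaussian_law s0.
  by rewrite integral_dirac// diracT mul1e.
apply: (@eq_measure_integral _ (measurableTypeR R) R setT (normal_prob m s) (distribution P
  Z)) => A mA _.
by have := hY.2 _ mA; rewrite /gaussian_law (negbTE s0).
Qed.

Lemma law_integral (h : R -> R) : measurable_fun setT h ->
  \int[P]_w h (Y w) = if s == 0 then h m else \int[normal_prob m s]_x h x.
Proof.
move=> mh; have mhE : measurable_fun setT (EFin \o h) by exact/measurable_EFinP.
rewrite /Rintegral; transitivity (fine (if s == 0%R then (h m)%:E else \int[normal_prob m
  s]_x (h x)%:E)%E); last by case: ifP.
congr fine; rewrite (integralE P).
have := law_integral0 (measurable_funepos mhE) (funepos_ge0 _).
have := law_integral0 (measurable_funeneg mhE) (funeneg_ge0 _).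
rewrite (_ : (fun w => (EFin \o h)^\+ (Y w))%E = (fun w => (h (Y w))%:E)^\+%E); last first.
  by apply/funext => w; rewrite !funeposE.
rewrite (_ : (fun w => (EFin \o h)^\- (Y w))%E = (fun w => (h (Y w))%:E)^\-%E); last first.
  by apply/funext => w; rewrite !funenegE.
move=> -> ->; case: ifPn => s0; last by rewrite [RHS]integralE.
by rewrite -[RHS]/((EFin \o h) m) [in RHS](funeposneg (EFin \o h)).
Qed.

Lemma law_cos th phi :
  \int[P]_w cos (th * (Y w - m) - phi) = cos phi * expR (- (s * th) ^+ 2 / 2).
Proof.
rewrite (@law_integral (fun x => cos (th * (x - m) - phi))); last first.
  apply: continuous_measurable_fun => x; apply: (@continuous_comp _ _ _ (fun x : R => th * (x
    - m) - phi) cos); last exact: continuous_cos.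
  by apply: cvgB; [apply: cvgMr; apply: cvgB; [exact: cvg_id|exact: cvg_cst]|exact: cvg_cst].
case: ifPn => [/eqP ->|s0]; last exact: normal_cos.
by rewrite subrr mulr0 sub0r cosN mul0r expr0n/= oppr0 mul0r expR0 mulr1.
Qed.

Lemma law_bump c e : e != 0 ->
  \int[P]_w normal_fun c e (Y w) =
  `|e| / Num.sqrt (s ^+ 2 + e ^+ 2) * expR (- (c - m) ^+ 2 / (2 * (s ^+ 2 + e ^+ 2))).
Proof.
move=> e0; rewrite law_integral; last exact: measurable_normal_fun.
case: ifPn => [/eqP ->|s0]; last exact: normal_bump.
rewrite expr0n/= add0r sqrtr_sqr divff ?normr_eq0// mul1r /normal_fun.
congr expR; field; by rewrite e0.
Qed.

Lemma law_integrable_quad (h : R -> R) (A : R) : measurable_fun setT h ->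
  (forall x, `|h x| <= A * (1 + (x - m) ^+ 2)) -> P.-integrable setT (EFin \o (h \o Y)).
Proof.
move=> mh hA; apply/integrableP; split.
  by apply/measurable_EFinP; exact: measurableT_comp.
rewrite /= (@law_integral0 (fun x => `|(h x)%:E|%E))//; last first.
  by apply: measurableT_comp => //; exact/measurable_EFinP.
case: ifPn => s0; first by rewrite ltry.
by have /integrableP[_] := normal_integrable_quad s0 mh hA.
Qed.

Lemma law_integrable : P.-integrable setT (EFin \o Y).
Proof.
apply: (@law_integrable_quad id (2 + `|m|)) => // x.
have -> : x = (x - m) + m by rewrite subrK.
rewrite addrK; apply: (le_trans (ler_normD _ _)).
rewrite -(real_normK (num_real (x - m))).
have := sqr_ge0 (1 - `|x - m|); have := normr_ge0 m; have := normr_ge0 (x - m); nra.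
Qed.

Lemma law_mean : \int[P]_w Y w = m.
Proof.
rewrite (@law_integral id)//; case: ifPn => // s0.
apply/eqP; rewrite -subr_eq0; have := normal_mean m s0.
rewrite RintegralB//.
- by rewrite normal_integral_cst => ->.
- apply: (@normal_integrable_quad _ m s s0 id (2 + `|m|)) => // x.
  have -> : x = (x - m) + m by rewrite subrK.
  rewrite addrK; apply: (le_trans (ler_normD _ _)).
  rewrite -(real_normK (num_real (x - m))).
  have := sqr_ge0 (1 - `|x - m|); have := normr_ge0 m; have := normr_ge0 (x - m); nra.
- apply: (@normal_integrable_quad _ m s s0 (cst m) `|m|) => // x.
  by rewrite /= ler_peMr// lerDl sqr_ge0.
Qed.

Lemma law_variance : \int[P]_w ((Y w - m) ^+ 2) = s ^+ 2.
Proof.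
rewrite (@law_integral (fun x => (x - m) ^+ 2)); last first.
  by apply: measurable_funX; apply: measurable_funB.
case: ifPn => [/eqP ->|s0]; last exact: normal_variance.
by rewrite subrr !expr0n.
Qed.

Lemma law_expsq : s != 0 ->
  \int[P]_w expR ((Y w - m) ^+ 2 / (4 * s ^+ 2)) = Num.sqrt 2.
Proof.
move=> s0; rewrite (@law_integral (fun x => expR ((x - m) ^+ 2 / (4 * s ^+ 2)))).
  by rewrite (negbTE s0) normal_expsq.
apply: measurableT_comp => //; apply: measurable_funM => //.
by apply: measurable_funX; apply: measurable_funB.
Qed.

Lemma law_integrable_expsq : s != 0 ->
  P.-integrable setT (EFin \o (fun w => expR ((Y w - m) ^+ 2 / (4 * s ^+ 2)))).
Proof.
move=> s0; apply/integrableP; split.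
  apply/measurable_EFinP; apply: measurableT_comp => //; apply: measurable_funM => //.
  by apply: measurable_funX; apply: measurable_funB.
have := law_expsq s0; rewrite /Rintegral => H.
rewrite [ltLHS](_ : _ = \int[P]_w (expR ((Y w - m) ^+ 2 / (4 * s ^+ 2)))%:E)%E; last first.
  by apply: eq_integral => w _ /=; rewrite ger0_norm ?expR_ge0.
(* An infinite integral has [fine] equal to 0, which contradicts the value [Num.sqrt 2] found in
   [law_expsq]. *)
rewrite ltNge leye_eq; apply/negP => /eqP E; move: H; rewrite E /= => /esym/eqP.
by rewrite sqrtr_eq0 leNgt ltr0n.
Qed.

End gaussian_variable.

(** * Uncorrelated pairs of Gaussian variables *)

(* [U] and [V] are jointly Gaussian, centred and uncorrelated, with standard
   deviations [u] and [v]; their signs play no role. *)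
Definition gauss_pair d (T : measurableType d) (R : realType)
    (P : probability T R) (U V : T -> R) (u v : R) :=
  [/\ measurable_fun setT U, measurable_fun setT V &
    forall x y : R, exists2 s, s ^+ 2 = x ^+ 2 * u ^+ 2 + y ^+ 2 * v ^+ 2 &
      has_law P (fun w => x * U w + y * V w) 0 s].

Lemma measurable_cos_aff (R : realType) (g c : R) :
  measurable_fun setT (fun x : R => cos (g * (x - c))).
Proof.
apply: continuous_measurable_fun => x.
apply: (@continuous_comp _ _ _ (fun x : R => g * (x - c)) cos); last exact: continuous_cos.
by apply: cvgMr; apply: cvgB; [exact: cvg_id|exact: cvg_cst].
Qed.

Lemma measurable_cos_lin (R : realType) (r : R) :
  measurable_fun setT (fun g : R => cos (g * r)).
Proof.
have := @measurable_cos_aff R r 0; apply: eq_measurable_fun => x _.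
by rewrite subr0 mulrC.
Qed.

Lemma normal_fun_le1 (R : realType) (c e x : R) : normal_fun c e x <= 1.
Proof.
rewrite /normal_fun -expR0 ler_expR mulNr oppr_le0 divr_ge0 ?sqr_ge0//.
by rewrite mulrn_wge0// sqr_ge0.
Qed.

Lemma normal_fun_ge (R : realType) (c e x : R) : 0 < e -> `|x - c| <= e ->
  expR (- 2^-1) <= normal_fun c e x.
Proof.
move=> e0 xc; rewrite /normal_fun ler_expR mulNr lerN2 -mulr_natr invfM mulrA.
rewrite -[leRHS]mul1r ler_wpM2r ?invr_ge0//.
rewrite ler_pdivrMr ?exprn_gt0// mul1r -(real_normK (num_real (x - c))).
by rewrite lerXn2r ?nnegrE// ltW.
Qed.

(** The cosine transform of the centred normal law with standard deviation [e^-1], read from right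
    to left. *)
Lemma normal_fun_cosE (R : realType) (c e x : R) : e != 0 ->
  normal_fun c e x = \int[normal_prob 0 e^-1]_g cos (g * (x - c)).
Proof.
move=> e0; have := @normal_cos R 0 e^-1 (invr_neq0 e0) (x - c) 0.
rewrite cos0 mul1r [X in _ = X -> _](_ : _ = normal_fun c e x); last first.
  by rewrite /normal_fun; congr expR; field; rewrite e0.
by move=> <-; apply: eq_Rintegral => g _; rewrite !subr0 mulrC.
Qed.

Section gaussian_pair.
Context d (T : measurableType d) (R : realType) (P : probability T R).
Variables (U V : T -> R) (u v : R).
Hypothesis hUV : gauss_pair P U V u v.
Let mU : measurable_fun setT U. Proof. by case: hUV. Qed.
Let mV : measurable_fun setT V. Proof. by case: hUV. Qed.

Lemma gauss_pair_law1 : exists2 s, s ^+ 2 = u ^+ 2 & has_law P U 0 s.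
Proof.
case: hUV => _ _ /(_ 1 0)[s sE hs]; exists s.
  by rewrite sE expr1n expr0n/= mul1r mul0r addr0.
suff <- : (fun w => 1 * U w + 0 * V w) = U by [].
by apply/funext => w; rewrite mul1r mul0r addr0.
Qed.

Lemma gauss_pair_law2 : exists2 s, s ^+ 2 = v ^+ 2 & has_law P V 0 s.
Proof.
case: hUV => _ _ /(_ 0 1)[s sE hs]; exists s.
  by rewrite sE expr1n expr0n/= mul1r mul0r add0r.
suff <- : (fun w => 0 * U w + 1 * V w) = V by [].
by apply/funext => w; rewrite mul1r mul0r add0r.
Qed.

(** The expectation of [cos (g * (Y - c))] for a centred Gaussian [Y] with standard deviation
    [a]. *)
Let ch (a g c : R) := cos (g * c) * expR (- (a * g) ^+ 2 / 2).

Let ch_le1 a c g : `|ch a g c| <= 1.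
Proof.
rewrite /ch normrM -[leRHS]mul1r ler_pM ?cos_max//.
rewrite ger0_norm ?expR_ge0// -expR0 ler_expR mulNr oppr_le0 divr_ge0 ?sqr_ge0//.
Qed.

Let mch a c : measurable_fun setT (fun g : R => ch a g c).
Proof.
apply: measurable_funM.
  exact: measurable_cos_lin.
apply: measurableT_comp => //; apply: measurable_funM => //.
by apply: measurableT_comp => //; apply: measurable_funX; exact: measurable_funM.
Qed.

Let int_cosY x y phi :
  P.-integrable setT (EFin \o (fun w => cos ((x * U w + y * V w) - phi))) /\
  \int[P]_w cos ((x * U w + y * V w) - phi) =
    cos phi * (expR (- (u * x) ^+ 2 / 2) * expR (- (v * y) ^+ 2 / 2)).
Proof.
split.
  apply: (@bounded_integrable _ _ _ _ _ 1); last by move=> w; rewrite cos_max.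
  have := @measurable_cos_aff R 1 phi.
  have mxy : measurable_fun setT (fun w => x * U w + y * V w).
    by apply: measurable_funD; exact: measurable_funM.
  move=> /measurableT_comp/(_ mxy); apply: eq_measurable_fun => w _ /=.
  by rewrite mul1r.
case: hUV => _ _ /(_ x y)[s sE hs].
have := law_cos hs 1 phi.
under eq_Rintegral do rewrite mul1r subr0.
by move=> ->; rewrite -expRD; congr (_ * expR _); rewrite mulr1 sE; field.
Qed.

(** A product of cosines is the half sum of the cosines of the sum and the difference. Since [U] and
    [V] are uncorrelated, [g U + g' V] and [g U - g' V] have the same variance, and the two terms
    recombine into a product. *)
Lemma gauss_pair_cos2 g c g' c' :
  \int[P]_w (cos (g * (U w - c)) * cos (g' * (V w - c'))) =
  ch u g c * ch v g' c'.
Proof.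
have [i1 e1] := int_cosY g g' (g * c + g' * c').
have [i2 e2] := int_cosY g (- g') (g * c - g' * c').
transitivity (\int[P]_w (2^-1 * (cos ((g * U w + g' * V w) - (g * c + g' * c'))
   + cos ((g * U w + - g' * V w) - (g * c - g' * c'))))).
  apply: eq_Rintegral => w _.
  rewrite [X in cos X + _](_ : _ = g * (U w - c) + g' * (V w - c')); last ring.
  rewrite [X in _ + cos X](_ : _ = g * (U w - c) - g' * (V w - c')); last ring.
  by rewrite cosD cosB; field.
rewrite RintegralZl//; last first.
  have := integrableD measurableT i1 i2; exact: eq_integrable.
by rewrite RintegralD// e1 e2 cosD cosB mulrN sqrrN /ch; field.
Qed.

(** Independence of [h V] from [U], tested against cosines of [U] only. The class contains constants
    and bumps and is closed under differences, which is enough to reach (1 - bump)^N. *)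
Definition factors (h : R -> R) :=
  [/\ measurable_fun setT h, exists C : R, forall x, `|h x| <= C &
   forall g c, \int[P]_w (cos (g * (U w - c)) * h (V w)) = ch u g c * \int[P]_w h (V w)].

Let mcU g c : measurable_fun setT (fun w => cos (g * (U w - c))).
Proof. exact: (measurableT_comp (measurable_cos_aff g c) mU). Qed.

Let ibounded (h : R -> R) g c : measurable_fun setT h ->
  (exists C : R, forall x, `|h x| <= C) ->
  P.-integrable setT (EFin \o (fun w => cos (g * (U w - c)) * h (V w))).
Proof.
move=> mh [C hC]; apply: (@bounded_integrable _ _ _ _ _ C).
  apply: measurable_funM; first exact: mcU.
  exact: measurableT_comp.
by move=> w; rewrite normrM (le_trans _ (hC (V w)))// ler_piMl// cos_max.
Qed.

Let iboundedV (h : R -> R) : measurable_fun setT h ->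
  (exists C : R, forall x, `|h x| <= C) ->
  P.-integrable setT (EFin \o (fun w => h (V w))).
Proof.
move=> mh [C hC]; apply: (@bounded_integrable _ _ _ _ _ C) => //.
exact: measurableT_comp.
Qed.

Lemma factors_cst r : factors (cst r).
Proof.
split; [exact: measurable_cst|by exists (`|r|)|] => g c.
have := gauss_pair_cos2 g c 0 0; rewrite [ch v 0 0](_ : _ = 1); last first.
  by rewrite /ch !mul0r mulr0 cos0 mul1r expr0n/= oppr0 mul0r expR0.
rewrite mulr1; under eq_Rintegral do rewrite mul0r cos0 mulr1.
rewrite Rintegral_cst1 => <-; rewrite -RintegralZr//.
by apply: (@bounded_integrable _ _ _ _ _ 1) => [|w]; [exact: mcU|exact: cos_max].
Qed.

Lemma factorsB h1 h2 : factors h1 -> factors h2 -> factors (fun x => h1 x - h2 x).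
Proof.
move=> [m1 b1 f1] [m2 b2 f2]; split.
- exact: measurable_funB.
- case: b1 => C1 hC1; case: b2 => C2 hC2; exists (C1 + C2) => x.
  by rewrite (le_trans (ler_normB _ _))// lerD.
- move=> g c; rewrite RintegralB//; [|exact: iboundedV|exact: iboundedV].
  rewrite mulrBr -f1 -f2 -RintegralB//; [|exact: ibounded|exact: ibounded].
  by apply: eq_Rintegral => w _; rewrite mulrBr.
Qed.

Let ch0 a c : ch a 0 c = 1.
Proof. by rewrite /ch mulr0 mul0r cos0 mul1r expr0n/= oppr0 mul0r expR0. Qed.

Lemma factors_bump c' e' : e' != 0 -> factors (normal_fun c' e').
Proof.
move=> e0; pose Q := normal_prob 0 e'^-1.
have H g c : \int[P]_w (cos (g * (U w - c)) * normal_fun c' e' (V w)) =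
     ch u g c * \int[Q]_g' ch v g' c'.
  transitivity (\int[P]_w \int[Q]_g' (cos (g * (U w - c)) * cos (g' * (V w - c')))).
    apply: eq_Rintegral => w _; rewrite normal_fun_cosE// -RintegralZl//.
    apply: (@bounded_integrable _ _ _ _ _ 1) => [|x]; last exact: cos_max.
    exact: measurable_cos_lin.
  rewrite (@bounded_Fubini _ _ T (measurableTypeR R) R P Q (fun z => cos (g * (U z.1 - c)) *
    cos (z.2 * (V z.1 - c'))) 1).
  - under eq_Rintegral do rewrite gauss_pair_cos2.
    rewrite RintegralZl//; exact: (@bounded_integrable _ (measurableTypeR R) R Q _ 1 (mch v
      c') (ch_le1 v c')).
  - apply: measurable_funM; first by apply: (measurableT_comp (mcU g c)).
    have mz : measurable_fun setT (fun z : T * measurableTypeR R => z.2 * (V z.1 - c') : R).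
      apply: measurable_funM => //; apply: measurable_funB => //.
      exact: (measurableT_comp mV).
    exact: (measurableT_comp (continuous_measurable_fun (@continuous_cos R)) mz).
  - by move=> z; rewrite normrM -[leRHS]mul1r ler_pM ?cos_max.
split; first exact: measurable_normal_fun.
  exists 1 => x; rewrite ger0_norm ?normal_fun_le1//; exact: expR_ge0.
move=> g c; rewrite H; congr (_ * _).
(* At frequency 0 the cosine is 1, so [H] also evaluates the expectation of the bump of [V]
   alone. *)
rewrite -[LHS]mul1r -[X in X * _](ch0 u 0) -H.
by apply: eq_Rintegral => w _; rewrite mul0r cos0 mul1r.
Qed.

(** For [N = 0] the power of a bump is a bump of width [lam / Num.sqrt k]. The induction on [N]
    writes (1 - phi)^(N+1) phi^k as the difference of (1 - phi)^N phi^k and (1 - phi)^N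
    phi^(k+1). *)
Lemma factors_pow lam N k : lam != 0 -> (0 < N + k)%N ->
  factors (fun x => (1 - normal_fun 0 lam x) ^+ N * normal_fun 0 lam x ^+ k).
Proof.
move=> l0; elim: N k => [|N IH] k.
  rewrite add0n; case: k => // k _.
  have sk : Num.sqrt k.+1%:R != 0 :> R by rewrite sqrtr_eq0 -ltNge.
  have := @factors_bump 0 (lam / Num.sqrt k.+1%:R).
  rewrite (_ : normal_fun 0 (lam / Num.sqrt k.+1%:R) =
     fun x => (1 - normal_fun 0 lam x) ^+ 0 * normal_fun 0 lam x ^+ k.+1).
    by apply; rewrite mulf_neq0// invr_neq0.
  apply/funext => x; rewrite expr0 mul1r /normal_fun -expRM_natl; congr expR.
  have k1 : k.+1%:R != 0 :> R by [].
  by rewrite exprMn exprVn sqr_sqrtr//; move: (k.+1%:R) k1 => K K0; field; rewrite l0 K0.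
rewrite addSn => _; case: (posnP (N + k)%N) => [|Nk0].
  move=> /eqP; rewrite addn_eq0 => /andP[/eqP -> /eqP ->].
  have := factorsB (factors_cst 1) (factors_bump 0 l0).
  by congr factors; apply/funext => x; rewrite expr1 expr0 mulr1.
have := factorsB (IH k Nk0) (IH k.+1 _).
rewrite addnS => /(_ isT); congr factors; apply/funext => x.
by rewrite !exprS; ring.
Qed.

Lemma factorsP h c e : e != 0 -> factors h ->
  \int[P]_w (normal_fun c e (U w) * h (V w)) =
  \int[P]_w normal_fun c e (U w) * \int[P]_w h (V w).
Proof.
move=> e0; pose Q := normal_prob 0 e^-1.
have H k : factors k -> \int[P]_w (normal_fun c e (U w) * k (V w)) =
     \int[Q]_g ch u g c * \int[P]_w k (V w).
  move=> [mk [C hC] fk].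
  transitivity (\int[P]_w \int[Q]_g (cos (g * (U w - c)) * k (V w))).
    apply: eq_Rintegral => w _; rewrite normal_fun_cosE// -RintegralZr//.
    apply: (@bounded_integrable _ _ _ _ _ 1) => [|x]; last exact: cos_max.
    exact: measurable_cos_lin.
  rewrite (@bounded_Fubini _ _ T (measurableTypeR R) R P Q (fun z => cos (z.2 * (U z.1 - c))
    * k (V z.1)) C).
  - under eq_Rintegral do rewrite fk.
    rewrite RintegralZr//; exact: (@bounded_integrable _ (measurableTypeR R) R Q _ 1 (mch u
      c) (ch_le1 u c)).
  - apply: measurable_funM; last exact: (measurableT_comp (measurableT_comp mk mV)).
    have mz : measurable_fun setT (fun z : T * measurableTypeR R => z.2 * (U z.1 - c) : R).
      apply: measurable_funM => //; apply: measurable_funB => //.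
      exact: (measurableT_comp mU).
    exact: (measurableT_comp (continuous_measurable_fun (@continuous_cos R)) mz).
  - by move=> z; rewrite normrM (le_trans _ (hC (V z.1)))// ler_piMl// cos_max.
move=> fh; rewrite H//; congr (_ * _).
(* The constant function 1 identifies the mixture integral with the expectation of the bump of
   [U]. *)
have := H _ (factors_cst 1); rewrite Rintegral_cst1 mulr1 => <-.
by apply: eq_Rintegral => w _; rewrite mulr1.
Qed.

End gaussian_pair.

(** * Box and tail bounds for uncorrelated pairs *)

Lemma prob_le_Rintegral d (T : measurableType d) (R : realType)
    (P : probability T R) (A : set T) (g : T -> R) :
  measurable A -> P.-integrable setT (EFin \o g) ->
  (forall w, 0 <= g w) -> (forall w, A w -> 1 <= g w) ->
  (P A <= (\int[P]_w g w)%:E)%E.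
Proof.
move=> mA ig g0 Ag; rewrite -Rintegral_indic// lee_fin le_Rintegral//.
  exact: integrable_indic.
move=> w _; rewrite indicE; case: (boolP (w \in A)) => [/set_mem/Ag|]//= _; exact: g0.
Qed.

(** The factor [expR 2^-1] normalises the bump of [U] to be at least 1 on its window, the power of
    [1 - expR (- 2^-1)] does the same for (1 - bump)^N beyond the threshold, and the rest bounds the
    expectation of (1 - bump)^N through the exponential moment [Num.sqrt 2]. *)
Definition tail_const (R : realType) (N : nat) : R :=
  expR 2^-1 * ((1 - expR (- 2^-1)) ^- N * ((2 * N%:R) ^+ N * Num.sqrt 2)).

Lemma tail_const_ge0 (R : realType) N : 0 <= tail_const R N.
Proof.
rewrite /tail_const !mulr_ge0 ?expR_ge0 ?sqrtr_ge0// ?exprn_ge0 ?mulr_ge0//.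
Qed.

Section gaussian_pair_bounds.
Context d (T : measurableType d) (R : realType) (P : probability T R).
Variables (U V : T -> R) (u v : R).
Hypothesis hUV : gauss_pair P U V u v.
Let mU : measurable_fun setT U. Proof. by case: hUV. Qed.
Let mV : measurable_fun setT V. Proof. by case: hUV. Qed.

Let measurable_normB (Y : T -> R) c : measurable_fun setT Y ->
  measurable_fun setT (fun w => `|Y w - c|).
Proof. by move=> mY; apply: measurableT_comp => //; exact: measurable_funB. Qed.

(** Each bump is at least [expR (- 2^-1)] on its window, so the indicator of the box is at most
    [expR 1] times the product of the bumps, whose expectation factors. The Gaussian factor of [V]
    is kept for targets that are far apart; that of [U] is bounded by 1. *)
Lemma gauss_pair_box (c e c' e' : R) : 0 < e -> 0 < e' ->
  (P [set w | `|U w - c| <= e /\ `|V w - c'| <= e']%R <=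
    (expR 1 * ((e / Num.sqrt (u ^+ 2 + e ^+ 2)) *
     (e' / Num.sqrt (v ^+ 2 + e' ^+ 2) *
        expR (- c' ^+ 2 / (2 * (v ^+ 2 + e' ^+ 2))))))%:E)%E.
Proof.
move=> e0 e'0.
have ne : e != 0 by rewrite gt_eqF.
have ne' : e' != 0 by rewrite gt_eqF.
have mA : measurable [set w | `|U w - c| <= e /\ `|V w - c'| <= e'].
  apply: measurableI.
    by have := measurable_normB c mU; move=> /(_ measurableT _ (measurable_itv `]-oo, e]));
      rewrite setTI.
  by have := measurable_normB c' mV; move=> /(_ measurableT _ (measurable_itv `]-oo, e']));
    rewrite setTI.
pose g w := expR 1 * (normal_fun c e (U w) * normal_fun c' e' (V w)).
have ib : P.-integrable setT (EFin \o (fun w => normal_fun c e (U w) * normal_fun c' e' (V w))).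
  apply: (@bounded_integrable _ _ _ _ _ 1).
    apply: measurable_funM.
      exact: (measurableT_comp (measurable_normal_fun c e) mU).
    exact: (measurableT_comp (measurable_normal_fun c' e') mV).
  move=> w; rewrite normrM -[leRHS]mul1r ler_pM//.
    by rewrite ger0_norm ?normal_fun_le1 ?normal_fun_ge0.
  by rewrite ger0_norm ?normal_fun_le1 ?normal_fun_ge0.
have ig : P.-integrable setT (EFin \o g).
  apply: (eq_integrable _ _ _ _ (integrableZl measurableT (expR 1) ib)) => //.
apply: (le_trans (prob_le_Rintegral mA ig _ _)).
- by move=> w; rewrite !mulr_ge0 ?expR_ge0 ?normal_fun_ge0.
- move=> w [hU hV]; rewrite /g.
  rewrite [leLHS](_ : 1 = expR 1 * (expR (- 2^-1) * expR (- 2^-1))); last first.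
    by rewrite -!expRD -[LHS]expR0; congr expR; field.
  by rewrite ler_wpM2l ?expR_ge0// ler_pM ?expR_ge0// normal_fun_ge.
- rewrite lee_fin RintegralZl// ler_wpM2l ?expR_ge0//.
  rewrite (factorsP hUV c ne (factors_bump hUV c' ne')).
  have [s1 s1E h1] := gauss_pair_law1 hUV.
  have [s2 s2E h2] := gauss_pair_law2 hUV.
  rewrite (law_bump h1)// (law_bump h2)// s1E s2E !subr0 !gtr0_norm//.
  rewrite ler_wpM2r//.
    by rewrite mulr_ge0 ?expR_ge0// divr_ge0 ?sqrtr_ge0// ltW.
  rewrite ler_piMr ?divr_ge0 ?sqrtr_ge0 ?(ltW e0)//.
  rewrite -expR0 ler_expR mulNr oppr_le0 divr_ge0 ?sqr_ge0// mulr_ge0//.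
  by rewrite addr_ge0 ?sqr_ge0.
Qed.

Lemma one_subr_normal_fun (lam x : R) : lam != 0 ->
  0 <= 1 - normal_fun 0 lam x <= x ^+ 2 / (2 * lam ^+ 2).
Proof.
move=> l0; rewrite subr_ge0 normal_fun_le1/= lerBlDr /normal_fun subr0.
rewrite (_ : - x ^+ 2 / (lam ^+ 2 *+ 2) = - (x ^+ 2 / (2 * lam ^+ 2))); last first.
  by field; rewrite l0.
by have := expR_ge1Dx (- (x ^+ 2 / (2 * lam ^+ 2))); lra.
Qed.

(** The indicator of the tail of [V] is replaced by a multiple of [h = (1 - bump)^N], which still
    factors against the bump of [U] and is at most [(V^2 / (2 lam^2))^N]. The power [N] thus becomes
    the rate of decay. *)
Lemma gauss_pair_tail N (c e lam : R) : (0 < N)%N -> 0 < e -> 0 < lam ->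
  (P [set w | `|U w - c| <= e /\ lam < `|V w|]%R <=
    (tail_const R N * ((e / Num.sqrt (u ^+ 2 + e ^+ 2)) *
      (v ^+ 2 / lam ^+ 2) ^+ N))%:E)%E.
Proof.
move=> N0 e0 l0.
have ne : e != 0 by rewrite gt_eqF.
have nl : lam != 0 by rewrite gt_eqF.
have mA : measurable [set w | `|U w - c| <= e /\ lam < `|V w|].
  apply: measurableI.
    by have := measurable_normB c mU; move=> /(_ measurableT _ (measurable_itv `]-oo, e]));
      rewrite setTI.
  have mn : measurable_fun setT (fun w => `|V w|) by exact: measurableT_comp.
  have := mn measurableT _ (measurable_itv `]lam, +oo[); rewrite setTI.
  by congr measurable; apply/seteqP; split => w /=; rewrite in_itv/= andbT.
pose k : R := 1 - expR (- 2^-1).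
have k0 : 0 < k.
  by rewrite /k subr_gt0 -[ltRHS]expR0 ltr_expR oppr_lt0 invr_gt0.
pose h x : R := (1 - normal_fun 0 lam x) ^+ N.
have fh : factors P U V u h.
  have := factors_pow hUV nl (k := 0) (N := N); rewrite addn0 => /(_ N0).
  by congr factors; apply/funext => x; rewrite expr0 mulr1.
have h01 x : 0 <= h x <= 1.
  have /andP[H1 _] := one_subr_normal_fun x nl.
  rewrite /h exprn_ge0//= exprn_ile1// lerBlDr lerDl normal_fun_ge0//.
have hE x : h x <= (x ^+ 2 / (2 * lam ^+ 2)) ^+ N.
  have /andP[H1 H2] := one_subr_normal_fun x nl.
  by rewrite lerXn2r ?nnegrE// (le_trans H1).
pose g w := expR 2^-1 * (k ^- N * (normal_fun c e (U w) * h (V w))).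
have mh : measurable_fun setT h by case: fh.
have ib : P.-integrable setT (EFin \o (fun w => normal_fun c e (U w) * h (V w))).
  apply: (@bounded_integrable _ _ _ _ _ 1).
    apply: measurable_funM.
      exact: (measurableT_comp (measurable_normal_fun c e) mU).
    exact: (measurableT_comp mh mV).
  move=> w; rewrite normrM -[leRHS]mul1r ler_pM//.
    by rewrite ger0_norm ?normal_fun_le1 ?normal_fun_ge0.
  by have /andP[a b] := h01 (V w); rewrite ger0_norm.
have ib2 : P.-integrable setT (EFin \o (fun w => k ^- N * (normal_fun c e (U w) * h (V w)))).
  by apply: (eq_integrable _ _ _ _ (integrableZl measurableT (k ^- N) ib)).
have ig : P.-integrable setT (EFin \o g).
  by apply: (eq_integrable _ _ _ _ (integrableZl measurableT (expR 2^-1) ib2)).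
apply: (le_trans (prob_le_Rintegral mA ig _ _)).
- move=> w; have /andP[a b] := h01 (V w).
  by rewrite !mulr_ge0 ?expR_ge0 ?normal_fun_ge0// invr_ge0 exprn_ge0// ltW.
- move=> w [hU hV]; rewrite /g.
  have hk : k ^+ N <= h (V w).
    have /andP[a b] := one_subr_normal_fun (V w) nl.
    rewrite lerXn2r ?nnegrE ?(ltW k0)// /k lerD2l lerN2 /normal_fun ler_expR subr0.
    rewrite [leLHS](_ : _ = - (2^-1 * (V w ^+ 2 / lam ^+ 2))); last by field; rewrite nl.
    rewrite lerN2 ler_peMr ?invr_ge0//.
    rewrite ler_pdivlMr ?exprn_gt0// mul1r -(real_normK (num_real (V w))).
    by rewrite lerXn2r ?nnegrE// ltW.
  rewrite [leLHS](_ : 1 = expR 2^-1 * (k ^- N * (expR (- 2^-1) * k ^+ N))); last first.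
    have kN : k ^+ N != 0 by rewrite expf_neq0// gt_eqF.
    rewrite [RHS](_ : _ = (expR 2^-1 * expR (- 2^-1)) * (k ^- N * k ^+ N)); last ring.
    by rewrite -expRD subrr expR0 mul1r mulVf.
  rewrite ler_wpM2l ?expR_ge0// ler_wpM2l ?invr_ge0 ?exprn_ge0 ?(ltW k0)//.
  by rewrite ler_pM ?expR_ge0// ?exprn_ge0 ?(ltW k0)// normal_fun_ge.
- rewrite lee_fin RintegralZl// RintegralZl//.
  set q := e / Num.sqrt (u ^+ 2 + e ^+ 2).
  rewrite /tail_const -/k -/q -(mulrA (expR _)) ler_wpM2l ?expR_ge0//.
  rewrite -(mulrA (k ^- N)) ler_wpM2l ?invr_ge0 ?exprn_ge0 ?(ltW k0)//.
  rewrite (factorsP hUV c ne fh).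
  have [s1 s1E h1] := gauss_pair_law1 hUV.
  have [s2 s2E h2] := gauss_pair_law2 hUV.
  rewrite (law_bump h1)// s1E subr0 gtr0_norm//.
  rewrite -/q; set t := expR _; set I := \int[P]_x _.
  have q0 : 0 <= q by rewrite divr_ge0 ?sqrtr_ge0// ltW.
  have t1 : t <= 1.
    rewrite /t -expR0 ler_expR mulNr oppr_le0 divr_ge0 ?sqr_ge0// mulr_ge0//.
    by rewrite addr_ge0 ?sqr_ge0.
  have I0 : 0 <= I by apply: Rintegral_ge0 => w _; case/andP: (h01 (V w)).
  suff hI : I <= (2 * N%:R * (v ^+ 2 / lam ^+ 2)) ^+ N * Num.sqrt 2.
    apply: (@le_trans _ _ (q * I)).
      by rewrite ler_wpM2r// ler_piMr.
    apply: (le_trans (ler_wpM2l q0 hI)).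
    by rewrite exprMn le_eqVlt; apply/orP; left; apply/eqP; clearbody q; ring.
  have K0 : 0 <= 2 * N%:R * (v ^+ 2 / lam ^+ 2).
    by rewrite mulr_ge0 ?divr_ge0 ?sqr_ge0// mulr_ge0.
  have [s20|s20] := eqVneq s2 0.
    (* Here [V] is a point mass at 0, and [h 0 = 0] because [N] is positive. *)
    have -> : I = 0.
      rewrite /I (@law_integral _ _ _ _ _ _ _ h2 h)// s20 eqxx /h /normal_fun.
      by rewrite subrr expr0n/= oppr0 mul0r expR0 subrr expr0n eqn0Ngt N0.
    by rewrite mulr_ge0 ?sqrtr_ge0// exprn_ge0.
  have := law_expsq h2 s20 => H.
  have := law_integrable_expsq h2 s20 => iE.
  set K := (2 * N%:R * (v ^+ 2 / lam ^+ 2)) ^+ N.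
  rewrite -H -RintegralZl// le_Rintegral//.
  + have : P.-integrable setT (EFin \o (fun w => h (V w))).
      apply: (@bounded_integrable _ _ _ _ _ 1); first exact: (measurableT_comp mh mV).
      by move=> w; have /andP[a b] := h01 (V w); rewrite ger0_norm.
    by [].
  + by apply: (eq_integrable _ _ _ _ (integrableZl measurableT K iE)).
  + move=> w _; apply: (le_trans (hE _)); rewrite subr0.
    (* Since [(z / N)^N <= expR z], the moment of order [2 N] is controlled by [law_expsq]. *)
    set z := V w ^+ 2 / (4 * s2 ^+ 2).
    have z0 : 0 <= z by rewrite divr_ge0 ?sqr_ge0// mulr_ge0// sqr_ge0.
    have -> : V w ^+ 2 / (2 * lam ^+ 2) = 2 * N%:R * (v ^+ 2 / lam ^+ 2) * (z / N%:R).
      rewrite -s2E /z; have : N%:R != 0 :> R by rewrite pnatr_eq0 -lt0n.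
      by move: (N%:R) => M M0; field; rewrite nl M0 s20.
    rewrite exprMn -/K ler_wpM2l//.
      by rewrite /K exprn_ge0.
    have -> : expR z = expR (z / N%:R) ^+ N.
      by rewrite -expRM_natl mulrC divfK// pnatr_eq0 -lt0n.
    have zN : 0 <= z / N%:R by exact: divr_ge0 z0 (ler0n _ _).
    rewrite lerXn2r ?nnegrE ?expR_ge0//.
    by apply: le_trans (expR_ge1Dx _); rewrite lerDr.
Qed.

End gaussian_pair_bounds.

(** * Covariances of fractional Brownian motion *)

Section power_distance.
Context {R : realType} (H : R).
Hypothesis H01 : 0 < H < 1.
Implicit Types s t u x y : R.

Lemma powR_one (r : R) : 1 `^ r = 1. Proof. by rewrite powR1. Qed.

(** After division by [x + y] both terms lie in [0, 1], where a number is at most its power of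
    exponent [H <= 1]. *)
Lemma powR_subadditive x y : 0 <= x -> 0 <= y -> (x + y) `^ H <= x `^ H + y `^ H.
Proof.
have /andP[H0 H1] := H01; move=> x0 y0.
have [->|xn0] := eqVneq x 0; first by rewrite add0r lerDr powR_ge0.
have [->|yn0] := eqVneq y 0; first by rewrite addr0 lerDl powR_ge0.
have xp : 0 < x by rewrite lt_neqAle eq_sym xn0.
have yp : 0 < y by rewrite lt_neqAle eq_sym yn0.
have xy : 0 < x + y by rewrite addr_gt0.
have xyn : x + y != 0 by rewrite gt_eqF.
have -> : x `^ H = (x + y) `^ H * (x / (x + y)) `^ H.
  rewrite -powRM ?divr_ge0// ?(ltW xy)//; congr (_ `^ _); field; by rewrite xyn.
have -> : y `^ H = (x + y) `^ H * (y / (x + y)) `^ H.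
  rewrite -powRM ?divr_ge0// ?(ltW xy)//; congr (_ `^ _); field; by rewrite xyn.
rewrite -mulrDr -[leLHS]mulr1 ler_wpM2l ?powR_ge0//.
have -> : 1 = x / (x + y) + y / (x + y) by rewrite -mulrDl divff.
rewrite lerD// ger1_powR ?(ltW H1)// divr_gt0//= ler_pdivrMr// mul1r.
  by rewrite lerDl.
by rewrite lerDr.
Qed.

Lemma powR_distM x y : 0 <= x -> 0 <= y -> `|x `^ H - y `^ H| <= `|x - y| `^ H.
Proof.
have /andP[H0 H1] := H01; move=> x0 y0; rewrite ler_norml lerBlDr lerNl opprB lerBlDr.
apply/andP; split.
- apply: le_trans (powR_subadditive _ _) => //.
  rewrite ge0_ler_powR ?nnegrE ?addr_ge0 ?(ltW H0)//.
  by rewrite -lerBlDr distrC ler_norm.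
- apply: le_trans (powR_subadditive _ _) => //.
  rewrite ge0_ler_powR ?nnegrE ?addr_ge0 ?(ltW H0)//.
  by rewrite -lerBlDr ler_norm.
Qed.

Lemma powR_2M x : 0 <= x -> x `^ (2 * H) = (x `^ H) ^+ 2.
Proof. by move=> x0; rewrite mulrC powRrM (powR_mulrn 2) ?powR_ge0. Qed.

Lemma powR_le1 x : 0 <= x <= 1 -> x `^ H <= 1.
Proof.
have /andP[H0 H1] := H01; move=> /andP[x0 x1]; rewrite -[leRHS](powR_one H).
by rewrite ge0_ler_powR ?nnegrE ?(ltW H0).
Qed.

Definition fbm_cov s t : R :=
  2^-1 * (`|t| `^ (2 * H) + `|s| `^ (2 * H) - `|t - s| `^ (2 * H)).

Lemma fbm_covE s t : 0 <= s -> 0 <= t ->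
  fbm_cov s t = 2^-1 * ((t `^ H) ^+ 2 + (s `^ H) ^+ 2 - (`|t - s| `^ H) ^+ 2).
Proof. by move=> s0 t0; rewrite /fbm_cov !powR_2M// (ger0_norm s0) (ger0_norm t0). Qed.

Lemma fbm_covC s t : fbm_cov s t = fbm_cov t s.
Proof. by rewrite /fbm_cov distrC (addrC (`|t| `^ _)). Qed.

Lemma fbm_covxx s : 0 <= s -> fbm_cov s s = (s `^ H) ^+ 2.
Proof.
have /andP[H0 H1] := H01; move=> s0; rewrite fbm_covE// subrr normr0 powR0 ?gt_eqF//.
by field.
Qed.

Variable a : R.
Hypothesis a01 : 0 < a < 1.

(** For [s <= t] put [q = (t - s) / t], which is at most [1 - a]. Then [t^H - s^H = t^H (1 - (1 -
    q)^H) <= t^H q = q^(1 - H) |t - s|^H]. The factor strictly below 1 keeps [D^2 - (p - q)^2]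
    comparable to [D^2] in the variance formula below. *)
Lemma powR_distM_contract s t : a <= s <= 1 -> a <= t <= 1 ->
  `|t `^ H - s `^ H| <= (1 - a) `^ (1 - H) * `|t - s| `^ H.
Proof.
have /andP[H0 H1] := H01; have /andP[a0 a1] := a01.
wlog st : s t / s <= t.
  move=> W hs ht; have [st|ts] := leP s t; first exact: W.
  by rewrite distrC (distrC t); apply: W => //; exact: ltW.
move=> /andP[as_ s1] /andP[at_ t1].
have s0 : 0 < s by rewrite (lt_le_trans a0).
have t0 : 0 < t by rewrite (lt_le_trans s0).
have tn0 : t != 0 by rewrite gt_eqF.
have [->|ts] := eqVneq t s.
  by rewrite !subrr normr0 mulr_ge0 ?powR_ge0.
have {}st : s < t by rewrite lt_neqAle eq_sym ts st.
rewrite !ger0_norm ?subr_ge0 ?(ltW st)//; last first.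
  by rewrite ge0_ler_powR ?nnegrE ?(ltW H0) ?(ltW s0) ?(ltW t0) ?(ltW st).
set q := (t - s) / t.
have q0 : 0 < q by rewrite divr_gt0// subr_gt0.
have q1 : q <= 1 - a.
  rewrite ler_pdivrMr//; nra.
have sE : s = t * (1 - q) by rewrite /q; field; rewrite tn0.
have tsE : t - s = t * q by rewrite /q; field; rewrite tn0.
clearbody q; rewrite tsE.
have q11 : q < 1 by rewrite (le_lt_trans q1)// ltrBlDr ltrDl.
rewrite [in leLHS]sE !powRM ?(ltW t0) ?(ltW q0)//; last by rewrite subr_ge0 ltW.
have h1 : 1 - q <= (1 - q) `^ H.
  by rewrite ger1_powR ?(ltW H1)// subr_gt0 q11/= lerBlDr lerDl ltW.
have h2 : q = q `^ (1 - H) * q `^ H.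
  rewrite -powRD; last by apply/implyP => _; rewrite gt_eqF.
  by rewrite subrK powRr1// ltW.
have h3 : q `^ (1 - H) <= (1 - a) `^ (1 - H).
  rewrite ge0_ler_powR ?nnegrE ?subr_ge0 ?(ltW H1) ?(ltW q0) ?(ltW a1)//.
have tp : 0 <= t `^ H by exact: powR_ge0.
rewrite mulrCA -[X in X - _]mulr1 -mulrBr ler_wpM2l//.
apply: (@le_trans _ _ q); first lra.
by rewrite {1}h2 ler_wpM2r ?powR_ge0.
Qed.

(** In the formula for the conditional variance, [1 - k^2] with the contraction factor [k] comes
    from [D^2 - (p - q)^2], the square of [a^H] from [(p + q)^2 - D^2], and 4 from [4 p^2 <= 4]. *)
Definition lnd_const : R := (1 - ((1 - a) `^ (1 - H)) ^+ 2) * (a `^ H) ^+ 2 / 4.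

Lemma lnd_const_gt0 : 0 < lnd_const.
Proof.
have /andP[H0 H1] := H01; have /andP[a0 a1] := a01.
rewrite /lnd_const divr_gt0// mulr_gt0 ?exprn_gt0 ?powR_gt0// subr_gt0.
rewrite exprn_ilt1// ?powR_ge0//.
rewrite -[ltRHS](powR_one (1 - H)) gt0_ltr_powR ?nnegrE ?subr_gt0 ?subr_ge0 ?(ltW a1)//.
by rewrite ltrBlDr ltrDl.
Qed.

(* Strong local nondeterminism: the variance of [X t] given [X s] is of order
   [|t - s|^(2H)]. With [p = s^H], [q = t^H] and [D = |t - s|^H] it equals
   [(D^2 - (p - q)^2) ((p + q)^2 - D^2) / (4 p^2)]. *)
Lemma fbm_lnd s t : a <= s <= 1 -> a <= t <= 1 ->
  lnd_const * (`|t - s| `^ H) ^+ 2 <=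
  fbm_cov t t - fbm_cov s t ^+ 2 / fbm_cov s s.
Proof.
have /andP[H0 H1] := H01; have /andP[a0 a1] := a01.
move=> hs ht; have hc := powR_distM_contract hs ht.
case/andP: hs => as_ s1; case/andP: ht => at_ t1.
have s0 : 0 < s by rewrite (lt_le_trans a0).
have t0 : 0 < t by rewrite (lt_le_trans a0).
rewrite !fbm_covxx ?fbm_covE ?(ltW s0) ?(ltW t0)//.
have kap : (1 - a) `^ (1 - H) <= 1.
  rewrite -[leRHS](powR_one (1 - H)) ge0_ler_powR ?nnegrE ?subr_ge0 ?(ltW a1) ?(ltW H1)//.
  by rewrite lerBlDr lerDl ltW.
have kap0 : 0 <= (1 - a) `^ (1 - H) by exact: powR_ge0.
rewrite /lnd_const; set k := (1 - a) `^ _ in hc kap kap0 *.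
have pa : a `^ H <= s `^ H by rewrite ge0_ler_powR ?nnegrE ?(ltW H0) ?(ltW a0) ?(ltW s0).
have qa : a `^ H <= t `^ H by rewrite ge0_ler_powR ?nnegrE ?(ltW H0) ?(ltW a0) ?(ltW t0).
have a'0 : 0 < a `^ H by rewrite powR_gt0.
have p1 : s `^ H <= 1 by rewrite powR_le1// (ltW s0).
(* The distance of two positive times is at most the larger one. Hence [D] is at most [p] or [q],
   which leaves [(p + q)^2 - D^2 >= A^2]. *)
have dmax : `|t - s| `^ H <= s `^ H \/ `|t - s| `^ H <= t `^ H.
  have [st|ts] := leP s t.
    right; rewrite ge0_ler_powR ?nnegrE ?(ltW H0) ?(ltW t0)//.
    by rewrite ger0_norm ?subr_ge0// lerBlDr lerDl ltW.
  left; rewrite ge0_ler_powR ?nnegrE ?(ltW H0) ?(ltW s0)//.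
  by rewrite distrC gtr0_norm ?subr_gt0// lerBlDr lerDl ltW.
move: hc dmax; have : 0 <= `|t - s| `^ H by exact: powR_ge0.
move: (`|t - s| `^ H) (a `^ H) (s `^ H) (t `^ H) pa qa a'0 p1 => D A p q pa qa A0 p1 D0 hc dmax.
have p0 : 0 < p by exact: lt_le_trans pa.
have q0 : 0 < q by exact: lt_le_trans qa.
have h2 : A ^+ 2 <= (p + q) ^+ 2 - D ^+ 2.
  by case: dmax => ?; nra.
have h1 : (1 - k ^+ 2) * D ^+ 2 <= D ^+ 2 - (p - q) ^+ 2.
  have : (p - q) ^+ 2 <= (k * D) ^+ 2.
    rewrite -(real_normK (num_real (p - q))) distrC.
    by rewrite lerXn2r ?nnegrE// mulr_ge0.
  rewrite exprMn; lra.
have kD : 0 <= (1 - k ^+ 2) * D ^+ 2.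
  by rewrite mulr_ge0 ?sqr_ge0// subr_ge0 exprn_ile1.
rewrite [leRHS](_ : _ = ((D ^+ 2 - (p - q) ^+ 2) * ((p + q) ^+ 2 - D ^+ 2)) / (4 * p ^+ 2));
  last first.
  by field; rewrite gt_eqF.
rewrite ler_pdivlMr ?mulr_gt0 ?exprn_gt0//.
apply: (@le_trans _ _ (((1 - k ^+ 2) * D ^+ 2) * A ^+ 2)).
  rewrite [leLHS](_ : _ = ((1 - k ^+ 2) * D ^+ 2) * A ^+ 2 * p ^+ 2); last by field.
  by rewrite ler_piMr ?(mulr_ge0 kD) ?sqr_ge0// exprn_ile1// ltW.
by rewrite ler_pM// sqr_ge0.
Qed.

(** The difference equals [((q - p)(q + p) - D^2) / (2 p^2)] with [|q - p| <= D <= 1]. A regression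
    coefficient this close to 1 may be replaced by 1 at the price of an error of order
    [|t - s|^H]. *)
Lemma fbm_regression_near1 s t : a <= s <= 1 -> a <= t <= 1 ->
  `|fbm_cov s t / fbm_cov s s - 1| <= 2 / (a `^ H) ^+ 2 * `|t - s| `^ H.
Proof.
have /andP[H0 H1] := H01; have /andP[a0 a1] := a01.
move=> /andP[as_ s1] /andP[at_ t1].
have s0 : 0 < s by rewrite (lt_le_trans a0).
have t0 : 0 < t by rewrite (lt_le_trans a0).
have hd := powR_distM (ltW t0) (ltW s0).
rewrite !fbm_covxx ?fbm_covE ?(ltW s0) ?(ltW t0)//.
have pa : a `^ H <= s `^ H by rewrite ge0_ler_powR ?nnegrE ?(ltW H0) ?(ltW a0) ?(ltW s0).
have a'0 : 0 < a `^ H by rewrite powR_gt0.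
have p1 : s `^ H <= 1 by rewrite powR_le1// (ltW s0).
have q1 : t `^ H <= 1 by rewrite powR_le1// (ltW t0).
have q0 : 0 <= t `^ H by exact: powR_ge0.
have D1 : `|t - s| `^ H <= 1.
  by rewrite powR_le1// normr_ge0/= ler_norml; lra.
move: hd D1 q0; have : 0 <= `|t - s| `^ H by exact: powR_ge0.
move: (`|t - s| `^ H) (a `^ H) (s `^ H) (t `^ H) pa a'0 p1 q1 => D A p q pa A0 p1 q1 D0 hd D1
  q0.
have p0 : 0 < p by exact: lt_le_trans pa.
rewrite (_ : _ - 1 = ((q - p) * (q + p) - D ^+ 2) / (2 * p ^+ 2)); last first.
  by field; rewrite gt_eqF.
rewrite normrM normfV (gtr0_norm (x := 2 * _)) ?mulr_gt0 ?exprn_gt0//.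
rewrite ler_pdivrMr ?mulr_gt0 ?exprn_gt0//.
apply: (@le_trans _ _ (4 * D)).
  apply: (le_trans (ler_normB _ _)); rewrite normrM (ger0_norm (x := q + p)) ?addr_ge0 ?(ltW
    p0)//.
  rewrite (ger0_norm (sqr_ge0 D)); nra.
have : 1 <= p ^+ 2 / A ^+ 2.
  by rewrite ler_pdivlMr ?exprn_gt0// mul1r lerXn2r ?nnegrE ?(ltW A0) ?(ltW p0).
move=> h; rewrite [leRHS](_ : _ = (4 * D) * (p ^+ 2 / A ^+ 2)); last by field; rewrite gt_eqF.
by rewrite ler_peMr ?mulr_ge0.
Qed.

End power_distance.

(** * Laws of linear combinations of the process *)

Section fbm_laws.
Context d (T : measurableType d) (R : realType) (P : probability T R).
Variables (H : R) (X : R -> {RV P >-> R}).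
Hypothesis H01 : 0 < H < 1.
Hypothesis hX : is_fbm `[0, 1]%classic H X.

Let has_law1 t : `[0, 1]%classic t -> exists s, has_law P (X t) 0 s.
Proof.
case: hX => gX mX _ _ t01.
have [mY [m [s hs]]] := gX 1%N (fun=> t) (fun=> 1) (fun=> t01).
have E : (fun w => \sum_(k < 1) 1 * X t w) = X t.
  by apply/funext => w; rewrite big_ord1 mul1r.
rewrite {}E in mY hs; have hl : has_law P (X t) m s by split.
suff m0 : m = 0 by exists s; rewrite -m0.
by rewrite -(law_mean hl) /Rintegral; have := mX _ t01; rewrite expectation.unlock => ->.
Qed.

Let measurable_X t : measurable_fun setT (X t). Proof. exact: measurable_funPT. Qed.

Let iX t : `[0, 1]%classic t -> P.-integrable setT (EFin \o X t).
Proof. by move=> /has_law1[s hs]; exact: law_integrable hs. Qed.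

Let mean_X t : `[0, 1]%classic t -> \int[P]_w X t w = 0.
Proof. by move=> /has_law1[s hs]; exact: law_mean hs. Qed.

Let iXX s t : `[0, 1]%classic s -> `[0, 1]%classic t ->
  P.-integrable setT (EFin \o (fun w => X s w * X t w)).
Proof.
move=> /has_law1[u hs] /has_law1[v ht].
have i1 := @law_integrable_quad _ _ _ _ _ _ _ hs (fun x => x ^+ 2) 1.
have i2 := @law_integrable_quad _ _ _ _ _ _ _ ht (fun x => x ^+ 2) 1.
have m2 : measurable_fun setT (fun x : R => x ^+ 2) by exact: measurable_funX.
have b2 (x : R) : `|x ^+ 2| <= 1 * (1 + (x - 0) ^+ 2).
  by rewrite ger0_norm ?sqr_ge0// mul1r subr0 lerDr.
have := integrableD measurableT (i1 m2 b2) (i2 m2 b2).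
apply: le_integrable => //.
  by apply/measurable_EFinP/measurable_funM.
move=> w _ /=; rewrite lee_fin normrM [leRHS]ger0_norm ?addr_ge0 ?sqr_ge0//.
rewrite -(real_normK (num_real (X s w))) -(real_normK (num_real (X t w))).
have := sqr_ge0 (`|X s w| - `|X t w|).
have := sqr_ge0 `|X s w|; have := sqr_ge0 `|X t w|; nra.
Qed.

Let cov_X s t : `[0, 1]%classic s -> `[0, 1]%classic t ->
  \int[P]_w (X s w * X t w) = fbm_cov H s t.
Proof.
case: hX => _ mX cX _ hs ht; have := cX s t hs ht.
rewrite covariance.unlock (mX _ hs) (mX _ ht)/= => E.
suff -> : \int[P]_w (X s w * X t w) = fine (\int[P]_w ((X s w - 0) * (X t w - 0))%:E)%E.
  by move: E; rewrite expectation.unlock => ->.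
by congr fine; apply: eq_integral => w _; rewrite !subr0.
Qed.

(** Gaussianity only provides some mean and some standard deviation; they are identified by
    integrating the combination and its square. Three times suffice, since an increment of the
    residual process involves two times and the base time. *)
Lemma fbm_law3 t1 t2 t3 c1 c2 c3 :
  `[0, 1]%classic t1 -> `[0, 1]%classic t2 -> `[0, 1]%classic t3 ->
  exists2 s, s ^+ 2 = c1 ^+ 2 * fbm_cov H t1 t1 + c2 ^+ 2 * fbm_cov H t2 t2
      + c3 ^+ 2 * fbm_cov H t3 t3 + 2 * (c1 * c2) * fbm_cov H t1 t2
      + 2 * (c1 * c3) * fbm_cov H t1 t3 + 2 * (c2 * c3) * fbm_cov H t2 t3 &
    has_law P (fun w => c1 * X t1 w + c2 * X t2 w + c3 * X t3 w) 0 s.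
Proof.
move=> h1 h2 h3; case: (hX) => gX _ _ _.
pose t (k : 'I_3) := nth 0 [:: t1; t2; t3] k.
pose c (k : 'I_3) := nth 0 [:: c1; c2; c3] k.
have ht k : `[0, 1]%classic (t k) by case: k => -[|[|[|//]]] i.
have [mY [m [s hs]]] := gX 3%N t c ht.
have E : (fun w => \sum_(k < 3) c k * X (t k) w) =
    (fun w => c1 * X t1 w + c2 * X t2 w + c3 * X t3 w).
  by apply/funext => w; rewrite !big_ord_recl big_ord0 /= addr0 addrA.
rewrite {}E in mY hs.
have hl : has_law P (fun w => c1 * X t1 w + c2 * X t2 w + c3 * X t3 w) m s by split.
have iZ (k : R) (g : T -> R) : P.-integrable setT (EFin \o g) ->
    P.-integrable setT (EFin \o (fun w => k * g w)).
  by move=> ig; apply: (eq_integrable _ _ _ _ (integrableZl measurableT k ig)).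
have iD (g h : T -> R) : P.-integrable setT (EFin \o g) -> P.-integrable setT (EFin \o h) ->
    P.-integrable setT (EFin \o (fun w => g w + h w)).
  by move=> ig ih; apply: (eq_integrable _ _ _ _ (integrableD measurableT ig ih)).
have m0 : m = 0.
  rewrite -(law_mean hl) RintegralD//; [|by apply: iD; apply: iZ; exact: iX|by apply: iZ;
    exact: iX].
  rewrite RintegralD//; [|by apply: iZ; exact: iX|by apply: iZ; exact: iX].
  rewrite !RintegralZl//; [|exact: iX|exact: iX|exact: iX].
  by rewrite !mean_X// !mulr0 !addr0.
exists s; last by rewrite -m0.
rewrite -(law_variance hl) m0.
transitivity (\int[P]_w (c1 ^+ 2 * (X t1 w * X t1 w) + c2 ^+ 2 * (X t2 w * X t2 w)
  + c3 ^+ 2 * (X t3 w * X t3 w) + 2 * (c1 * c2) * (X t1 w * X t2 w)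
  + 2 * (c1 * c3) * (X t1 w * X t3 w) + 2 * (c2 * c3) * (X t2 w * X t3 w))).
  by apply: eq_Rintegral => w _; ring.
have i1 := iZ (c1 ^+ 2) _ (iXX h1 h1).
have i2 := iZ (c2 ^+ 2) _ (iXX h2 h2).
have i3 := iZ (c3 ^+ 2) _ (iXX h3 h3).
have i4 := iZ (2 * (c1 * c2)) _ (iXX h1 h2).
have i5 := iZ (2 * (c1 * c3)) _ (iXX h1 h3).
have i6 := iZ (2 * (c2 * c3)) _ (iXX h2 h3).
have j2 := iD _ _ i1 i2.
have j3 := iD _ _ j2 i3.
have j4 := iD _ _ j3 i4.
have j5 := iD _ _ j4 i5.
rewrite (RintegralD measurableT j5 i6) (RintegralD measurableT j4 i5).
rewrite (RintegralD measurableT j3 i4) (RintegralD measurableT j2 i3).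
rewrite (RintegralD measurableT i1 i2).
by rewrite !RintegralZl ?cov_X//; exact: iXX.
Qed.

(** The linear hypothesis says that the combination is uncorrelated with [X u]; it cancels the cross
    term in the variance of [x U + y V]. *)
Lemma fbm_pair u t1 t2 c1 c2 c3 v :
  `[0, 1]%classic u -> `[0, 1]%classic t1 -> `[0, 1]%classic t2 ->
  c1 * fbm_cov H u t1 + c2 * fbm_cov H u t2 + c3 * fbm_cov H u u = 0 ->
  v ^+ 2 = c1 ^+ 2 * fbm_cov H t1 t1 + c2 ^+ 2 * fbm_cov H t2 t2
      + c3 ^+ 2 * fbm_cov H u u + 2 * (c1 * c2) * fbm_cov H t1 t2
      + 2 * (c1 * c3) * fbm_cov H t1 u + 2 * (c2 * c3) * fbm_cov H t2 u ->
  gauss_pair P (X u) (fun w => c1 * X t1 w + c2 * X t2 w + c3 * X u w) (u `^ H) v.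
Proof.
move=> hu h1 h2 c0 vE; split => //.
  by apply: measurable_funD; [apply: measurable_funD|]; exact: measurable_funM.
move=> x y; have [s sE hs] := fbm_law3 (y * c1) (y * c2) (y * c3 + x) h1 h2 hu.
exists s.
  have u0 : 0 <= u by move: hu; rewrite /= in_itv/= => /andP[].
  rewrite sE vE -fbm_covxx// (fbm_covC _ t1 u) (fbm_covC _ t2 u).
  move: (fbm_cov H u t1) (fbm_cov H u t2) (fbm_cov H u u) (fbm_cov H t1 t2) (fbm_cov H t1 t1)
    (fbm_cov H t2 t2) c0 => a1 a2 a3 a4 a5 a6 c0.
  apply/eqP; rewrite -subr_eq0 (_ : _ - _ = 2 * x * y * (c1 * a1 + c2 * a2 + c3 * a3));
    last ring.
  by rewrite c0 mulr0.
suff <- : (fun w => y * c1 * X t1 w + y * c2 * X t2 w + (y * c3 + x) * X u w) =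
   (fun w => x * X u w + y * (c1 * X t1 w + c2 * X t2 w + c3 * X u w)) by [].
by apply/funext => w; ring.
Qed.

End fbm_laws.

Lemma powRV {R : realType} (x r : R) : 0 < x -> x^-1 `^ r = (x `^ r)^-1.
Proof.
move=> x0; have xr : x `^ r != 0 by rewrite gt_eqF// powR_gt0.
apply: (mulIf xr); rewrite mulVf// -powRM ?invr_ge0 ?(ltW x0)// mulVf ?gt_eqF//.
by rewrite powR1.
Qed.

(** * Nets of regular sets *)

Section regular_nets.
Context {R : realType}.
Implicit Types (E : set R) (s : seq R).

Definition separated (E : set R) (r : R) (s : seq R) :=
  [/\ uniq s, {in s, forall u, E u} &
    {in s &, forall u v, u != v -> r <= `|u - v|}].

(** Balls of radius [r] around points at mutual distance at least [2 * r] are disjoint; the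
    induction removes the first ball from [B]. *)
Lemma separated_sum_le (mu : {measure set R -> \bar R}) E r s (B : set R) :
  0 < r -> separated E (2 * r) s -> measurable B ->
  (forall u, u \in s -> ball u r `<=` B) ->
  (\sum_(u <- s) mu (ball u r) <= mu B)%E.
Proof.
move=> r0; elim: s B => [|v s IH] B sep mB sB; first by rewrite big_nil.
case: sep => /= /andP[vs us] sE sd.
have mb : measurable (ball v r : set R) by exact: measurable_ball.
rewrite big_cons.
apply: (@le_trans _ _ (mu (ball v r) + mu (B `\` ball v r))%E).
  apply: leeD => //; apply: IH.
  - split => // [u us'|u w us' ws']; first by apply: sE; rewrite inE us' orbT.
    by apply: sd; rewrite inE ?us' ?ws' orbT.
  - exact: measurableD.
  - move=> u us' x ux; split; first by apply: sB ux; rewrite inE us' orbT.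
    move=> vx.
    have uv : u != v by apply: contraNneq vs => <-.
    have : 2 * r <= `|u - v| by apply: sd => //; rewrite inE ?us' ?orbT// eqxx.
    move: ux vx; rewrite /ball/= => ux vx.
    have := ler_distD x u v; rewrite (distrC x v); lra.
rewrite -measureU//; last 2 first.
  - exact: measurableD.
  - by rewrite setDE setICA setICr setI0.
apply: le_measure; rewrite ?inE//.
  by apply: measurableU => //; exact: measurableD.
rewrite subUset; split; last exact: subDsetl.
by apply: sB; rewrite inE eqxx.
Qed.

Lemma cover_sum_ge (mu : {measure set R -> \bar R}) r s (B : set R) :
  measurable B ->
  (forall x, B x -> exists2 u, u \in s & ball u r x) ->
  (mu B <= \sum_(u <- s) mu (ball u r))%E.
Proof.
elim: s B => [|v s IH] B mB sB.
  rewrite big_nil (_ : B = set0) ?measure0//.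
  by rewrite -subset0 => x /sB[].
have mb : measurable (ball v r : set R) by exact: measurable_ball.
rewrite big_cons.
apply: (@le_trans _ _ (mu (ball v r) + mu (B `\` ball v r))%E).
  rewrite -measureU//; last 2 first.
    - exact: measurableD.
    - by rewrite setDE setICA setICr setI0.
  apply: le_measure; rewrite ?inE//.
    by apply: measurableU => //; exact: measurableD.
  by move=> x Bx; have [vx|vx] := pselect (ball v r x); [left|right].
apply: leeD => //; apply: IH; first exact: measurableD.
move=> x [/sB[u]]; rewrite inE => /orP[/eqP ->|us] ux vx //.
by exists u.
Qed.

(** The net is a maximal [delta]-separated subset. Disjointness of the balls of radius [delta / 2]
    compares the cardinality with the total mass, and the local count with the mass of a ball of
    radius [2 * rho]; covering by the balls of radius [delta] gives the bound from below. *)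
Lemma ad_net beta E : compact E -> ad_regular beta E ->
  exists2 C, 0 < C & forall delta, 0 < delta <= 1 -> exists s : seq R,
    [/\ {in s, forall u, E u},
        (forall x, E x -> exists2 u, u \in s & `|u - x| < delta),
        (size s)%:R <= C * delta `^ (- beta),
        delta `^ (- beta) <= C * (size s)%:R &
        (forall t rho, E t -> delta <= rho ->
          (count (fun u => `|u - t| <= rho)%R s)%:R <= C * (rho / delta) `^ beta)].
Proof.
move=> cE [b0 [mu [muT0 muTy muE [c c0 hc]]]].
have mE : measurable E by apply: closed_measurable; exact: compact_closed.
pose M := fine (mu setT).
have ME : mu setT = M%:E by rewrite /M fineK// ge0_fin_numE.
have M0 : 0 < M by rewrite -lte_fin -ME.
have muEE : mu E = M%:E.
  have := measureU mu mE (measurableC mE) (setICr E).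
  rewrite setUv [X in (_ + X)%E](_ : _ = 0%E) ?adde0; last exact: muE.
  by move=> <-.
have b2 : 0 < 2 `^ beta :> R by rewrite powR_gt0.
have b4 : 0 < 4 `^ beta :> R by rewrite powR_gt0.
(* The summand [c] serves balls of radius at most 1, and the total mass [M] serves larger ones,
   about which regularity says nothing. *)
pose K := c + M.
have K0 : 0 < K by rewrite addr_gt0.
(* One summand for each of the three counts, in the order of the conclusion. *)
exists (c * M * 2 `^ beta + c / M + c * K * 4 `^ beta).
  by rewrite !addr_gt0// ?divr_gt0 ?mulr_gt0.
move=> delta /andP[d0 d1].
have d20 : 0 < delta / 2 by rewrite divr_gt0.
have sumE s : {in s, forall u, E u} -> separated E delta s -> forall B : set R, measurable B ->
    (forall u, u \in s -> ball u (delta / 2) `<=` B) ->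
    (((size s)%:R * (c^-1 * (delta / 2) `^ beta))%:E <= mu B)%E.
  move=> sE sep B mB sB.
  have sep' : separated E (2 * (delta / 2)) s by rewrite mulrC divfK.
  apply: le_trans (@separated_sum_le mu _ _ _ B d20 sep' mB sB).
  elim: s sE {sep sep' sB} => [|v s IH] sE; first by rewrite big_nil mul0r.
  rewrite big_cons /= -natr1 mulrDl mul1r EFinD addeC leeD//.
    by apply: (hc v _ _ _).1; [apply: sE; rewrite inE eqxx|rewrite d20/=; lra].
  by apply: IH => u us; apply: sE; rewrite inE us orbT.
have dpos : 0 < (delta / 2) `^ beta by rewrite powR_gt0.
have dpos1 : 0 < delta `^ beta by rewrite powR_gt0.
have d2E : (delta / 2) `^ beta = delta `^ beta / 2 `^ beta.
  by rewrite powRM ?invr_ge0 ?(ltW d0)// powRV.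
have sizeb s : separated E delta s -> (size s)%:R <= c * M * 2 `^ beta * delta `^ (- beta).
  move=> sep; have sE : {in s, forall u, E u} by case: sep.
  have := sumE s sE sep setT measurableT (fun _ _ => @subsetT _ _).
  rewrite ME lee_fin -ler_pdivlMr ?mulr_gt0 ?invr_gt0//.
  rewrite d2E powRN => /le_trans; apply; rewrite le_eqVlt; apply/orP; left; apply/eqP.
  by field; rewrite !gt_eqF.
(* By [sizeb] a separated set of largest cardinality exists. A point of [E] at distance at least
   [delta] from all its elements could be added, so it is a net. *)
pose Q n := `[< exists2 s, separated E delta s & size s = n >].
have exQ : exists n, Q n.
  by exists 0%N; apply/asboolP; exists [::].
have ubQ : forall n, Q n -> (n <= Num.truncn (c * M * 2 `^ beta * delta `^ (- beta)))%N.
  move=> n /asboolP[s sep <-]; rewrite truncn_ge_nat ?sizeb//.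
  by apply: le_trans (sizeb _ sep).
case: (ex_maxnP exQ ubQ) => n /asboolP[s sep sn] smax.
have sE : {in s, forall u, E u} by case: sep.
have scov x : E x -> exists2 u, u \in s & `|u - x| < delta.
  move=> Ex; apply: contrapT => H.
  have Hd u : u \in s -> delta <= `|u - x|.
    by move=> us; rewrite leNgt; apply/negP => ux; apply: H; exists u.
  have xs : x \notin s by apply/negP => /Hd; rewrite subrr normr0 leNgt d0.
  have : (n.+1 <= n)%N.
    apply: smax; apply/asboolP; exists (x :: s); last by rewrite /= sn.
    case: sep => us _ sd; split => /=.
    - by rewrite xs.
    - by move=> u; rewrite inE => /orP[/eqP ->|/sE].
    - move=> u v; rewrite !inE => /orP[/eqP ->|us'] /orP[/eqP ->|vs'].
      + by rewrite eqxx.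
      + by move=> _; rewrite distrC Hd.
      + by move=> _; rewrite Hd.
      + exact: sd.
  by rewrite ltnn.
exists s; split => //.
- apply: (le_trans (sizeb _ sep)); rewrite ler_wpM2r ?powR_ge0//.
  by rewrite -addrA lerDl addr_ge0 ?divr_ge0 ?mulr_ge0 ?ltW.
- have : (mu E <= \sum_(u <- s) mu (ball u delta))%E.
    apply: (@cover_sum_ge mu) => // x /scov[u us ux]; exists u => //.
  rewrite muEE => H.
  have : (M%:E <= ((size s)%:R * (c * delta `^ beta))%:E)%E.
    apply: (le_trans H); elim: s sE {sep sn scov H} => [|v s IH] sE.
      by rewrite big_nil mul0r.
    rewrite big_cons /= -natr1 mulrDl mul1r EFinD addeC leeD//.
      by apply: (hc v _ _ _).2; [apply: sE; rewrite inE eqxx|rewrite d0].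
    by apply: IH => u us; apply: sE; rewrite inE us orbT.
  rewrite lee_fin => {}H; rewrite powRN.
  apply: (@le_trans _ _ (c / M * (size s)%:R)); last first.
    rewrite ler_wpM2r// -addrA addrCA lerDl addr_ge0 ?mulr_ge0 ?ltW//.
  rewrite -[leLHS]mul1r ler_pdivrMr//.
  rewrite [leRHS](_ : _ = (size s)%:R * (c * delta `^ beta) / M); last by ring.
  by rewrite ler_pdivlMr// mul1r.
- move=> t rho Et drho.
  have rho0 : 0 < rho by rewrite (lt_le_trans d0).
  pose s' := [seq u <- s | `|u - t| <= rho].
  rewrite -size_filter -/s'.
  have sep' : separated E delta s'.
    case: sep => us _ sd; split; first exact: filter_uniq.
    - by move=> u; rewrite mem_filter => /andP[_ /sE].
    - move=> u v; rewrite !mem_filter => /andP[_ us'] /andP[_ vs']; exact: sd.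
  have s'E : {in s', forall u, E u} by case: sep'.
  have sub u : u \in s' -> ball u (delta / 2) `<=` ball t (2 * rho).
    rewrite mem_filter => /andP[ut _] x; rewrite /ball/= => ux.
    have := ler_distD u t x; rewrite (distrC t u); lra.
  have := sumE s' s'E sep' _ (measurable_ball _ _) sub.
  have hb : (mu (ball t (2 * rho)) <= (K * (2 * rho) `^ beta)%:E)%E.
    have [r1|r1] := leP (2 * rho) 1.
      apply: le_trans ((hc t (2 * rho) Et _).2) _.
        by rewrite r1 mulr_gt0.
      by rewrite lee_fin ler_wpM2r ?powR_ge0// lerDl ltW.
    apply: (@le_trans _ _ (mu setT)).
      apply: le_measure; rewrite ?inE//; exact: measurable_ball.
    rewrite ME lee_fin; apply: (@le_trans _ _ (K * 1)); first by rewrite mulr1 lerDr ltW.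
    rewrite ler_wpM2l ?(ltW K0)// -[leLHS](powRr0 (2 * rho)).
    by rewrite ler_powR ?(ltW r1)// ltW.
  move=> /le_trans/(_ hb); rewrite lee_fin -ler_pdivlMr ?mulr_gt0 ?invr_gt0// => /le_trans;
    apply.
  apply: (@le_trans _ _ (c * K * 4 `^ beta * (rho / delta) `^ beta)); last first.
    by rewrite ler_wpM2r ?powR_ge0// lerDr addr_ge0 ?divr_ge0 ?mulr_ge0 ?ltW.
  rewrite d2E (powRM _ (ltW rho0)) ?invr_ge0 ?(ltW d0)//.
  rewrite powRV//.
  rewrite (powRM beta (ler0n R 2) (ltW rho0)).
  rewrite (_ : 4 = 2 * 2 :> R); last by ring.
  rewrite (powRM beta (ler0n R 2) (ler0n R 2)).
  rewrite le_eqVlt; apply/orP; left; apply/eqP.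
  by field; rewrite !gt_eqF.
Qed.

End regular_nets.

(** * From sums over a net to the Riesz kernel *)

Section kernel_sums.
Context {R : realType}.
Implicit Types (alpha r q : R).

(* [riesz_kernel] as a real number; its value at [r = 0] is junk. *)
Definition rkernel alpha r : R :=
  if alpha < 0 then 1
  else if alpha == 0 then ln (expR 1 / Num.min r 1) else r `^ (- alpha).

Lemma riesz_kernelE alpha r : r != 0 -> riesz_kernel alpha r = (rkernel alpha r)%:E.
Proof. by move=> r0; rewrite /riesz_kernel /rkernel (negbTE r0); case: ifP => // _;
  case: ifP. Qed.

Lemma rkernel_ge_ln r : 0 < r -> 1 <= ln (expR 1 / Num.min r 1).
Proof.
move=> r0; have m0 : 0 < Num.min r 1 by rewrite lt_min r0/=.
rewrite -[leLHS]expRK ler_ln ?posrE ?expR_gt0 ?divr_gt0 ?expR_gt0//.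
by rewrite ler_pdivlMr// ler_piMr ?expR_ge0// ge_min lexx orbT.
Qed.

Lemma rkernel_gt0 alpha r : 0 < r -> 0 < rkernel alpha r.
Proof.
move=> r0; rewrite /rkernel; case: ifP => // _; case: ifP => _.
  by apply: lt_le_trans (rkernel_ge_ln r0).
exact: powR_gt0.
Qed.

Lemma rkernel_anti alpha r q : 0 < r -> r <= q -> rkernel alpha q <= rkernel alpha r.
Proof.
move=> r0 rq; have q0 := lt_le_trans r0 rq.
rewrite /rkernel; case: ltP => // a0; case: ifP => [_|an0].
  rewrite ler_ln ?posrE ?divr_gt0 ?expR_gt0 ?lt_min ?r0 ?q0 ?ltr01//.
  rewrite ler_wpM2l ?expR_ge0// lef_pV2 ?posrE ?lt_min ?r0 ?q0 ?ltr01//.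
  by rewrite le_min !ge_min rq lexx orbT.
rewrite !powRN lef_pV2 ?posrE ?powR_gt0//.
by rewrite ge0_ler_powR ?nnegrE ?(ltW r0) ?(ltW q0).
Qed.

Lemma dyadic_scale r : 0 < r <= 1 -> exists n, 2^-1 ^+ n.+1 < r <= 2^-1 ^+ n.
Proof.
move=> /andP[r0 r1].
have ex : exists n, 2^-1 ^+ n < r :> R.
  have [n rn] : exists n, r^-1 < n%:R by exists (Num.truncn r^-1).+1; rewrite truncnS_gt.
  exists n; rewrite exprVn invf_plt ?posrE ?exprn_gt0//.
  by apply: (lt_le_trans rn); rewrite -natrX ler_nat ltnW// ltn_expl.
case: (ex_minnP ex) => -[|n] hn hmin.
  by move: hn; rewrite expr0 ltNge r1.
exists n; rewrite hn/= leNgt; apply/negP => /hmin; by rewrite ltnn.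
Qed.

(** The term of the largest level [k <= n] with [tau <= 2^-k] alone dominates the left side, because
    then [Num.max r tau >= 2^-(k+1)]. The sum replaces a singular function of [tau] by indicators of
    balls, which a net can count. *)
Lemma dyadic_pointwise (d n : nat) (r tau : R) : 0 <= tau <= 1 -> 2^-1 ^+ n.+1 <= r ->
  (Num.max r tau) ^- d <= \sum_(k < n.+1) (2 ^+ (k.+1 * d)) * (tau <= 2^-1 ^+ k)%R%:R.
Proof.
move=> /andP[t0 t1] nr.
have {}nr : (Num.max r tau) ^- d <= (Num.max (2^-1 ^+ n.+1) tau) ^- d.
  have h0 : 0 < 2^-1 ^+ n.+1 :> R by rewrite exprn_gt0.
  rewrite lef_pV2 ?posrE ?exprn_gt0 ?lt_max ?h0 ?(lt_le_trans h0 nr)//.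
  have h1 x : 0 <= Num.max x tau by rewrite le_max t0 orbT.
  rewrite lerXn2r ?nnegrE ?h1//.
  by rewrite ge_max !le_max nr lexx orbT.
apply: (le_trans nr) => {nr}.
elim: n => [|n IH].
  rewrite big_ord1 expr0 t1 mulr1 mul1n.
  rewrite -[leRHS]invrK lef_pV2 ?posrE ?invr_gt0 ?exprn_gt0 ?lt_max ?expr1 ?invr_gt0 ?ltr0n//.
  rewrite -exprVn lerXn2r ?nnegrE ?invr_ge0// ?le_max ?lexx//.
  by rewrite t0 orbT.
rewrite big_ord_recr/=.
have [tn|tn] := leP tau (2^-1 ^+ n.+1).
  rewrite mulr1; apply: (@le_trans _ _ (2 ^+ (n.+2 * d))); last first.
    by rewrite lerDr sumr_ge0// => k _; rewrite mulr_ge0.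
  rewrite -[leRHS]invrK lef_pV2 ?posrE ?invr_gt0 ?exprn_gt0 ?lt_max ?exprn_gt0 ?invr_gt0
    ?ltr0n//.
  rewrite exprM -exprVn -exprVn lerXn2r ?nnegrE ?exprn_ge0 ?invr_ge0// ?le_max ?lexx//.
  by rewrite exprn_ge0.
rewrite mulr0 addr0; apply: le_trans IH.
have t'0 : 0 < tau by apply: lt_trans tn; rewrite exprn_gt0.
rewrite lef_pV2 ?posrE ?exprn_gt0 ?lt_max ?t'0 ?orbT//.
have h1 x : 0 <= Num.max x tau by rewrite le_max t0 orbT.
rewrite lerXn2r ?nnegrE ?h1//.
by rewrite ge_max !le_max (ltW tn) lexx !orbT.
Qed.

(** The three cases of the kernel are the three behaviours of a geometric sum: convergent for
    [alpha < 0], comparable to its last term for [alpha > 0], and [n + 1] equal terms, hence a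
    logarithm of [r], for [alpha = 0]. *)
Lemma geometric_kernel alpha : exists2 C, 0 < C & forall n r,
  0 < r <= 1 -> r <= 2^-1 ^+ n ->
  \sum_(k < n.+1) (2 `^ alpha) ^+ k <= C * rkernel alpha r.
Proof.
have p2 (x : R) : 0 < 2 `^ x :> R by rewrite powR_gt0.
have l2 : 0 < ln 2 :> R by rewrite ln_gt0// ltr1n.
have pE (x : R) : 2 `^ x = expR (x * ln 2) by rewrite /powR gt_eqF.
have [a0|a0|a0] := ltgtP alpha 0.
- have q1 : 2 `^ alpha < 1 :> R.
    by rewrite pE -[ltRHS]expR0 ltr_expR pmulr_llt0.
  exists ((1 - 2 `^ alpha)^-1); first by rewrite invr_gt0 subr_gt0.
  move=> n r _ _; rewrite /rkernel a0 mulr1.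
  have := subrX1 (2 `^ alpha : R) n.+1.
  have qn : 0 <= (2 `^ alpha) ^+ n.+1 :> R by rewrite exprn_ge0 ?ltW.
  move=> H; rewrite -[leRHS]mul1r ler_pdivlMr ?subr_gt0// mulrC.
  by move: H qn; set S := \sum_(_ < _) _; lra.
- have q1 : 1 < 2 `^ alpha :> R.
    by rewrite pE -[ltLHS]expR0 ltr_expR pmulr_lgt0.
  exists (2 `^ alpha / (2 `^ alpha - 1)); first by rewrite divr_gt0// subr_gt0.
  move=> n r /andP[r0 r1] rn; rewrite /rkernel ltNge (ltW a0)/= gt_eqF//.
  have qn : (2 `^ alpha) ^+ n <= r `^ (- alpha) :> R.
    rewrite powRN -powRV// -powR_mulrn ?(ltW (p2 _))// powRAC.
    rewrite ge0_ler_powR ?nnegrE ?(ltW a0) ?powR_ge0 ?invr_ge0 ?(ltW r0)//.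
    rewrite powR_mulrn// -[leLHS]invrK lef_pV2 ?posrE ?invr_gt0 ?exprn_gt0//.
    by rewrite -exprVn.
  have := subrX1 (2 `^ alpha : R) n.+1; rewrite exprS.
  have q10 : 0 < 2 `^ alpha - 1 :> R by rewrite subr_gt0.
  move=> H; rewrite mulrAC ler_pdivlMr// mulrC -H.
  apply: (@le_trans _ _ (2 `^ alpha * (2 `^ alpha) ^+ n)); first by rewrite lerBlDr lerDl.
  by rewrite ler_wpM2l// ltW.
- exists (1 + (ln 2)^-1); first by rewrite addr_gt0// invr_gt0.
  move=> n r /andP[r0 r1] rn; rewrite a0 powRr0 /rkernel ltxx eqxx.
  under eq_bigr do rewrite expr1n.
  rewrite sumr_const card_ord (min_idPl r1) ln_div ?posrE ?expR_gt0// expRK.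
  have : n%:R * ln 2 <= - ln r.
    rewrite mulr_natl -lnXn// -lnV ?posrE// ler_ln ?posrE ?exprn_gt0 ?invr_gt0//.
    by rewrite -[leLHS]invrK lef_pV2 ?posrE ?invr_gt0 ?exprn_gt0// -exprVn.
  have lr : ln r <= 0 by exact: ln_le0.
  move=> h; rewrite -natr1 mulrDl mul1r.
  have : n%:R <= (ln 2)^-1 * (1 - ln r).
    by rewrite mulrC ler_pdivlMr//; lra.
  by lra.
Qed.

Lemma count_sum (S : Type) (s : seq S) (Q : pred S) :
  (count Q s)%:R = \sum_(u <- s) (Q u)%:R :> R.
Proof.
elim: s => [|x s IH]; first by rewrite big_nil.
by rewrite big_cons /= natrD IH.
Qed.

(** The condition [|u - t|^H <= 2^-k] means [|u - t| <= 2^(-k / H)], so the share of net points that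
    satisfy it is of order [2^(- k beta / H)]. Against the weight [2^(k d)] of the level this leaves
    [2^(k alpha)] with [alpha = d - beta / H]. *)
Lemma net_kernel_sum (d : nat) (a b H beta : R) (E : set R) (R0 : R) :
  0 <= a -> b <= 1 -> 0 < H -> 0 < beta -> E `<=` `[a, b]%classic ->
  compact E -> ad_regular beta E ->
  exists2 C, 0 < C & forall delta, 0 < delta <= 1 -> exists s : seq R,
    [/\ {in s, forall u, E u}, (0 < size s)%N &
     forall t r, E t -> delta `^ H <= r <= R0 ->
       \sum_(u <- s) (Num.max r (`|u - t| `^ H)) ^- d <=
       C * (size s)%:R * rkernel (d%:R - beta / H) r].
Proof.
move=> a0 b1 H0 be0 Eab cE adE.
have [C C0 hC] := ad_net cE adE.
set alpha := d%:R - beta / H.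
have [G G0 hG] := geometric_kernel alpha.
have R1 : 0 < `|R0| + 1 by rewrite ltr_pwDr.
(* The second summand serves [1 < r <= R0], where every term of the sum is at most 1 and the kernel
   is at least its value at [|R0| + 1]. *)
exists (C * C * 2 ^+ d * G + (rkernel alpha (`|R0| + 1))^-1).
  by rewrite addr_gt0 ?mulr_gt0 ?exprn_gt0 ?invr_gt0 ?rkernel_gt0.
move=> delta /andP[d0 d1].
have [s [sE scov sle sge scount]] := hC delta (introT andP (conj d0 d1)).
have sz0 : 0 < (size s)%:R :> R.
  by rewrite -(pmulr_rgt0 _ C0) (lt_le_trans _ sge)// powR_gt0.
exists s; split => //; first by rewrite -(ltr_nat R).
move=> t r Et /andP[dr rR0].
have r0 : 0 < r by apply: lt_le_trans dr; rewrite powR_gt0.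
have tau01 u : u \in s -> 0 <= `|u - t| `^ H <= 1.
  have e1 : 1 `^ H = 1 :> R by rewrite powR1.
  move=> us; rewrite powR_ge0/= -[leRHS]e1 ge0_ler_powR ?nnegrE ?(ltW H0)//.
  have := Eab _ (sE _ us); have := Eab _ Et; rewrite /= !in_itv/= ler_norml; lra.
have [r1|r1] := leP r 1; last first.
  apply: (@le_trans _ _ (size s)%:R).
    have : \sum_(u <- s) (Num.max r (`|u - t| `^ H)) ^- d <= \sum_(u <- s) 1.
      apply: ler_sum => u _; rewrite invf_le1 ?exprn_gt0 ?lt_max ?r0//.
      by rewrite exprn_ege1// le_max (ltW r1).
    by rewrite big_const_seq count_predT iter_addr_0 -/(_%:R).
  rewrite mulrAC -[leLHS]mul1r ler_wpM2r ?(ltW sz0)//.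
  have k0 : 0 < rkernel alpha (`|R0| + 1) by exact: rkernel_gt0.
  have k1 : rkernel alpha (`|R0| + 1) <= rkernel alpha r.
    by apply: rkernel_anti => //; apply: (le_trans rR0); rewrite (le_trans (ler_norm _))//
      lerDl.
  rewrite mulrDl -[leLHS]add0r lerD//.
    by rewrite !mulr_ge0 ?exprn_ge0 ?(ltW C0) ?(ltW G0)// ltW// rkernel_gt0.
  by rewrite mulrC ler_pdivlMr// mul1r.
have [n /andP[nr rn]] := dyadic_scale (introT andP (conj r0 r1)).
apply: (@le_trans _ _ (C * C * 2 ^+ d * G * (size s)%:R * rkernel alpha r)); last first.
  by rewrite ler_wpM2r ?ler_wpM2r ?(ltW sz0) ?ltW ?rkernel_gt0// ltrDl invr_gt0 rkernel_gt0.
apply: (@le_trans _ _ (\sum_(u <- s) \sum_(k < n.+1) (2 ^+ (k.+1 * d)) * (`|u - t| `^ H <=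
  2^-1 ^+ k)%R%:R)).
  rewrite big_seq [leRHS]big_seq; apply: ler_sum => u us.
  by apply: dyadic_pointwise; [exact: tau01|exact: ltW].
rewrite exchange_big/=.
have hk (k : 'I_n.+1) : \sum_(u <- s) 2 ^+ (k.+1 * d) * (`|u - t| `^ H <= 2^-1 ^+ k)%R%:R <=
    C * C * 2 ^+ d * (size s)%:R * (2 `^ alpha) ^+ k.
  rewrite -big_distrr/= -count_sum.
  set rho := (2^-1 ^+ k) `^ H^-1.
  have rhoE u : (`|u - t| `^ H <= 2^-1 ^+ k) = (`|u - t| <= rho).
    have k0 : 0 <= 2^-1 ^+ k :> R by rewrite exprn_ge0.
    apply/idP/idP => h.
      have := @ge0_ler_powR R H^-1 _ _ _ _ _ h.
      rewrite -powRrM divff ?gt_eqF// powRr1//; apply; rewrite ?nnegrE ?powR_ge0 ?invr_ge0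
        ?(ltW H0)//.
    rewrite (_ : 2^-1 ^+ k = rho `^ H); last by rewrite /rho -powRrM mulVf ?gt_eqF// powRr1.
    by rewrite ge0_ler_powR ?nnegrE ?powR_ge0 ?(ltW H0).
  under eq_count do rewrite rhoE.
  have drho : delta <= rho.
    have := @ge0_ler_powR R H^-1 _ (delta `^ H) (2^-1 ^+ k).
    rewrite -powRrM divff ?gt_eqF// powRr1 ?(ltW d0)//; apply;
      rewrite ?nnegrE ?powR_ge0 ?exprn_ge0 ?invr_ge0 ?(ltW H0)//.
    apply: (le_trans dr); apply: (le_trans rn).
    by rewrite ler_wiXn2l ?invr_ge0// ?invf_le1// ?ler1n// -ltnS.
  apply: (@le_trans _ _ (2 ^+ (k.+1 * d) * (C * (rho / delta) `^ beta))).
    by rewrite ler_wpM2l ?exprn_ge0// scount.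
  have rho0 : 0 < rho by rewrite (lt_le_trans d0).
  have -> : (rho / delta) `^ beta = rho `^ beta * delta `^ (- beta).
    by rewrite powRM ?invr_ge0 ?(ltW d0) ?(ltW rho0)// powRV// powRN.
  have rb : rho `^ beta = (2 `^ (- (beta / H))) ^+ k.
    have e2 : 2^-1 ^+ k = 2 `^ (- k%:R) :> R by rewrite powRN powR_mulrn// exprVn.
    have e3 : (2 `^ (- (beta / H))) ^+ k = 2 `^ (- (beta / H) * k%:R) :> R.
      by rewrite powRrM powR_mulrn ?powR_ge0.
    rewrite e3 /rho e2 -!powRrM; congr (_ `^ _).
    by field; rewrite gt_eqF.
  have qa : (2 `^ alpha) ^+ k = 2 ^+ (k * d) * rho `^ beta.
    rewrite rb /alpha powRD; last by apply/implyP => _; rewrite gt_eqF.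
    by rewrite exprMn powR_mulrn// -exprM mulnC.
  rewrite qa mulSn exprD.
  apply: (@le_trans _ _ (2 ^+ d * 2 ^+ (k * d) * (C * (rho `^ beta * (C * (size s)%:R))))).
    rewrite ler_wpM2l ?mulr_ge0 ?exprn_ge0//.
    by rewrite ler_wpM2l ?(ltW C0)// ler_wpM2l ?powR_ge0.
  by rewrite le_eqVlt; apply/orP; left; apply/eqP; ring.
apply: (@le_trans _ _ (\sum_(k < n.+1) C * C * 2 ^+ d * (size s)%:R * (2 `^ alpha) ^+ k)).
  by apply: ler_sum => k _; exact: hk.
rewrite -big_distrr/=.
apply: (@le_trans _ _ (C * C * 2 ^+ d * (size s)%:R * (G * rkernel alpha r))).
  by rewrite ler_wpM2l ?mulr_ge0 ?exprn_ge0 ?(ltW C0)// hG// r0.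
by rewrite le_eqVlt; apply/orP; left; apply/eqP; ring.
Qed.

End kernel_sums.

(** If no finite net existed, the sets of points of [K] far from a finite subset would generate a
    proper filter on [K]. It clusters at some [p], although [far [:: p]] avoids a neighbourhood of
    [p]. *)
Lemma compact_net (R : realType) (M : pseudoMetricType R) (K : set M) (e : R) :
  compact K -> 0 < e ->
  exists s : seq M, {in s, forall x, K x} /\
    forall x, K x -> exists2 y, y \in s & ball y e x.
Proof.
move=> cK e0; apply: contrapT => nonet.
pose far (s : seq M) : set M := [set x | K x /\ forall y, y \in s -> ~ ball y e x].
pose G : set_system M :=
  [set A | exists s : seq M, {in s, forall x, K x} /\ far s `<=` A].
have GF : ProperFilter G.
  split.
    move=> [s [sK sfar]]; apply: nonet; exists s; split => // x Kx.
    apply: contrapT => h; apply: (sfar x); split => // y ys yx.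
    by apply: h; exists y.
  split.
  - by exists [::]; split.
  - move=> A B [s [sK sA]] [r [rK rB]]; exists (s ++ r); split.
      by move=> x; rewrite mem_cat => /orP[/sK|/rK].
    move=> x [Kx xfar]; split.
      by apply: sA; split => // y ys; apply: xfar; rewrite mem_cat ys.
    by apply: rB; split => // y yr; apply: xfar; rewrite mem_cat yr orbT.
  - by move=> A B AB [s [sK sA]]; exists s; split => //; exact: subset_trans AB.
have GK : G K by exists [::]; split => // x [].
have [p [Kp clp]] := cK G GF GK.
have Gfar : G (far [:: p]).
  by exists [:: p]; split => // x; rewrite inE => /eqP ->.
have [x [[_ xfar] px]] := clp _ _ Gfar (nbhsx_ballx p e e0).
by apply: (xfar p) => //; rewrite inE.
Qed.

Lemma mx_ballP (R : realType) (d : nat) (x y : 'rV[R]_d) e :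
  0 < e -> ball x e y <-> forall i, `|x ord0 i - y ord0 i| < e.
Proof. by move=> e0; split=> [[_ h] i|h]; [exact: h|split=> // i j; rewrite ord1;
  exact: h]. Qed.

Lemma le_enorm (R : realType) (d : nat) (x : 'rV[R]_d) i : `|x ord0 i| <= enorm x.
Proof.
rewrite -sqrtr_sqr /enorm ler_wsqrtr// (bigD1 i)//= lerDl.
by apply: sumr_ge0 => j _; exact: sqr_ge0.
Qed.

Lemma enorm_le (R : realType) (d : nat) (x : 'rV[R]_d) r : 0 <= r ->
  (forall i, `|x ord0 i| <= r) -> enorm x <= Num.sqrt d%:R * r.
Proof.
move=> r0 xr; rewrite /enorm -[X in _ * X](ger0_norm r0) -sqrtr_sqr -sqrtrM// ler_wsqrtr//.
rewrite mulr_natl -[X in _ *+ X]card_ord -sumr_const ler_sum// => i _.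
by rewrite -(real_normK (num_real (x ord0 i))) lerXn2r ?nnegrE.
Qed.

Section holder.
Context (R : realType) (d : nat) (a b H K : R) (f : R -> 'rV[R]_d).
Hypothesis ab : a < b.
Hypothesis hf : holder_norm a b H f = K%:E.

(** As [a < b], both suprema are over nonempty sets of nonnegative numbers, so each is at most their
    sum [K]. *)
Lemma holder_bounds : [/\ 0 <= K,
  (forall s i, a <= s <= b -> `|f s ord0 i| <= K) &
  (forall s t i, a <= s <= b -> a <= t <= b ->
     `|f t ord0 i - f s ord0 i| <= K * `|t - s| `^ H)].
Proof.
move: hf; rewrite /holder_norm.
set S1 := ereal_sup _; set S2 := ereal_sup _ => E.
have aI : `[a, b]%classic a by rewrite /= in_itv/= lexx ltW.
have bI : `[a, b]%classic b by rewrite /= in_itv/= lexx ltW.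
have S10 : (0 <= S1)%E.
  apply: (@le_trans _ _ (enorm (f a))%:E); first by rewrite lee_fin sqrtr_ge0.
  by apply: ereal_sup_ubound; exists a.
have S20 : (0 <= S2)%E.
  apply: (@le_trans _ _ (enorm (f b - f a) / `|b - a| `^ H)%:E).
    by rewrite lee_fin divr_ge0 ?sqrtr_ge0 ?powR_ge0.
  by apply: ereal_sup_ubound; exists (a, b) => //=; split => //; rewrite lt_eqF.
have S1K : (S1 <= K%:E)%E by rewrite -E leeDl.
have S2K : (S2 <= K%:E)%E by rewrite -E leeDr.
have K0 : 0 <= K by rewrite -lee_fin (le_trans S10).
split => // [s i sI|s t i sI tI].
  apply: (le_trans (le_enorm _ _)); rewrite -lee_fin; apply: le_trans S1K.
  by apply: ereal_sup_ubound; exists s => //=; rewrite in_itv.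
have [->|st] := eqVneq s t.
  by rewrite subrr normr0 mulr_ge0 ?powR_ge0.
have := le_enorm (f t - f s) i; rewrite !mxE => /le_trans; apply.
have p0 : 0 < `|t - s| `^ H by rewrite powR_gt0// normr_gt0 subr_eq0 eq_sym.
rewrite -ler_pdivrMr// -lee_fin; apply: le_trans S2K.
by apply: ereal_sup_ubound; exists (s, t) => //=; split => //=; rewrite in_itv.
Qed.

End holder.

(** * The hitting event *)

Section hitting_event.
Context (disp : measure_display) (T : measurableType disp) (R : realType)
  (P : probability T R) (d : nat) (a b H K : R).
Variables (B : 'I_d -> R -> {RV P >-> R}) (f : R -> 'rV[R]_d).
Hypothesis a0 : 0 < a.
Hypothesis ab : a < b.
Hypothesis b1 : b <= 1.
Hypothesis H01 : 0 < H < 1.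
Hypothesis hB : is_fbm_dim `[0, 1]%classic H B.
Hypothesis hf : holder_norm a b H f = K%:E.

Definition shifted (w : T) (t : R) : 'rV[R]_d := (\row_(i < d) B i t w) + f t.

Lemma shiftedE w t i : shifted w t ord0 i = B i t w + f t ord0 i.
Proof. by rewrite !mxE. Qed.

Lemma hitsP E F w : hits B f E F w <->
  exists t x, [/\ E t, F x & shifted w t = x].
Proof.
split=> [[x [[t Et <-] Fx]]|[t [x [Et Fx tx]]]].
  by exists t, (shifted w t); split.
by exists x; split => //; exists t.
Qed.

Lemma path_continuous w i t e : a <= t <= b -> 0 < e ->
  \forall s \near within `[a, b]%classic (nbhs t), `|B i t w - B i s w| < e.
Proof.
move=> /andP[at_ tb] e0; case: hB => /(_ i)[_ _ _ /(_ w) cw] _.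
have t01 : `[0, 1]%classic t.
  by rewrite /= in_itv/= (le_trans (ltW a0))//= (le_trans tb).
have /subspace_continuousP/(_ t t01)/cvgrPdist_lt/(_ e e0) := cw.
rewrite /within/= => h.
have {}h : nbhs t (fun s => `[0, 1]%classic s -> `|B i t w - B i s w| < e) := h.
suff : nbhs t (fun s => `[a, b]%classic s -> `|B i t w - B i s w| < e) by [].
apply: filterS h => s hs; rewrite /= in_itv/= => /andP[as_ sb]; apply: hs.
by rewrite /= in_itv/= (le_trans (ltW a0))//= (le_trans sb).
Qed.

Lemma shifted_continuous w : {within `[a, b]%classic, continuous (shifted w)}.
Proof.
have [K0 _ fH] := holder_bounds ab hf.
have /andP[H0 H1] := H01.
suff cont (t : R) : `[a, b]%classic t -> forall e, 0 < e ->
    nbhs t (fun s => `[a, b]%classic s -> ball (shifted w t) e (shifted w s)).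
  apply/subspace_continuousP => t tI; apply/cvg_ballP => e e0.
  exact: (cont t tI e e0).
move=> tI e e0.
have tab : a <= t <= b by move: tI; rewrite /= in_itv.
have h i : \forall s \near within `[a, b]%classic (nbhs t),
    `|shifted w t ord0 i - shifted w s ord0 i| < e.
  have e20 : 0 < e / 2 by rewrite divr_gt0.
  have K1 : 0 < K + 1 by rewrite ltr_wpDl.
  have q0 : 0 < (e / 2) / (K + 1) by rewrite divr_gt0.
  have del0 : 0 < ((e / 2) / (K + 1)) `^ H^-1 by rewrite powR_gt0.
  have hfs : \forall s \near within `[a, b]%classic (nbhs t), `|f t ord0 i - f s ord0 i| < e
    / 2.
    have := nbhsx_ballx t _ del0; apply: filterS => s /= ts sI.
    have sab : a <= s <= b by move: sI; rewrite /= in_itv.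
    apply: (le_lt_trans (fH _ _ _ sab tab)).
    apply: (@le_lt_trans _ _ ((K + 1) * `|t - s| `^ H)).
      by rewrite ler_wpM2r ?powR_ge0// lerDl.
    rewrite mulrC -ltr_pdivlMr//.
    rewrite [ltRHS](_ : _ = ((e / 2 / (K + 1)) `^ H^-1) `^ H); last first.
      by rewrite -powRrM mulVf ?gt_eqF// powRr1// ltW.
    by rewrite gt0_ltr_powR ?nnegrE ?powR_ge0.
  near=> s; rewrite !shiftedE opprD addrACA.
  apply: (le_lt_trans (ler_normD _ _)); rewrite (splitr e) ltrD//.
    by near: s; exact: path_continuous.
  by near: s.
have FW : Filter (within `[a, b]%classic (nbhs t)) by exact: within_filter.
have h2 : nbhs t (fun s => `[a, b]%classic s -> forall i : 'I_d,
    `|shifted w t ord0 i - shifted w s ord0 i| < e) := filter_forall FW h.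
apply: filterS h2 => s hs sI; apply/(mx_ballP _ _ e0) => i; exact: hs.
Unshelve. all: by end_near. Qed.

Variables (E : set R) (F : set 'rV[R]_d).
Hypothesis Eab : E `<=` `[a, b]%classic.
Hypothesis cE : compact E.
Hypothesis cF : compact F.

(** The hitting event is an uncountable union over times and targets. Path continuity replaces it,
    up to an error that shrinks with [n], by a countable union over nets of [E] and [F]; compactness
    recovers exact hits in the intersection. *)
Lemma hits_approx : exists C : nat -> set T,
  [/\ (forall n, measurable (C n)),
      (forall m n, (m <= n)%N -> C n `<=` C m),
      hits B f E F = \bigcap_n C n &
      (forall n w, (exists t x, [/\ E t, F x &
          ball (shifted w t) (3 * n.+1%:R)^-1 x]) -> C n w)].
Proof.
have inv0 n : 0 < n.+1%:R^-1 :> R by rewrite invr_gt0.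
have /choice[sE hE] : forall n : nat, exists s : seq R, {in s, forall x, E x} /\
    forall x, E x -> exists2 y, y \in s & ball y n.+1%:R^-1 x.
  by move=> n; exact: (@compact_net R R E n.+1%:R^-1 cE (inv0 n)).
have /choice[sF hF] : forall n : nat, exists s : seq 'rV[R]_d, {in s, forall x, F x} /\
    forall x, F x -> exists2 y, y \in s & ball y n.+1%:R^-1 x.
  by move=> n; exact: (@compact_net R 'rV[R]_d F n.+1%:R^-1 cF (inv0 n)).
pose A n t x := [set w | ball (shifted w t) n.+1%:R^-1 x].
(* The unions over [k] and [l] use nets of every mesh, so the countable sets of admissible times and
   targets are dense and do not depend on [n]. *)
pose C n := \bigcup_k \bigcup_l \big[setU/set0]_(t <- sE k) \big[setU/set0]_(x <- sF l) A n t x.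
have CP n w : C n w <-> exists k l t x, [/\ t \in sE k, x \in sF l & A n t x w].
  rewrite /C; split.
    move=> [k _ [l _]]; rewrite -bigcup_seq => -[t /= ts].
    by rewrite -bigcup_seq => -[x /= xs Aw]; exists k, l, t, x.
  move=> [k [l [t [x [ts xs Aw]]]]]; exists k => //; exists l => //.
  rewrite -bigcup_seq; exists t => //; rewrite -bigcup_seq; by exists x.
have CE n w : C n w -> exists t x, [/\ E t, F x & ball (shifted w t) n.+1%:R^-1 x].
  move=> /CP[k [l [t [x [ts xs Aw]]]]]; exists t, x; split => //.
    exact: (hE k).1 _ ts.
  exact: (hF l).1 _ xs.
have CI n w : (exists t x, [/\ E t, F x & ball (shifted w t) (3 * n.+1%:R)^-1 x]) -> C n w.
  move=> [t [x [Et Fx tx]]].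
  (* Three distances add up to [n.+1%:R^-1]: from the path at [t'] to the path at [t], then to [x],
     then to [x']. *)
  pose e : R := (3 * n.+1%:R)^-1.
  have e0 : 0 < e by rewrite invr_gt0 mulr_gt0.
  have /subspace_continuousP/(_ t (Eab Et))/cvg_ballP/(_ e e0) := @shifted_continuous w.
  rewrite /within/= => h.
  have {}h : nbhs t (fun s => `[a, b]%classic s -> ball (shifted w t) e (shifted w s)) := h.
  have [del /= del0 hdel] := (@nbhs_ballP R R t _).1 h.
  have [k hk] : exists k, k.+1%:R^-1 < del :> R.
    exists (Num.truncn del^-1); rewrite invf_plt ?posrE//; exact: truncnS_gt.
  have [t' ts tt'] := (hE k).2 t Et.
  have [l hl] : exists l, l.+1%:R^-1 < e :> R.
    exists (Num.truncn e^-1); rewrite invf_plt ?posrE//; exact: truncnS_gt.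
  have [x' xs xx'] := (hF l).2 x Fx.
  apply/CP; exists k, l, t', x'; split => //.
  have b1' : ball (shifted w t') e (shifted w t).
    apply: ball_sym; apply: hdel; last by apply: Eab; exact: (hE k).1 _ ts.
    by apply: ball_sym; apply: le_ball tt'; exact: ltW.
  have b2 : ball x e x' by apply: ball_sym; apply: le_ball xx'; exact: ltW.
  have := ball_triangle (ball_triangle b1' tx) b2.
  apply: le_ball; rewrite /e le_eqVlt; apply/orP; left; apply/eqP.
  have : n.+1%:R != 0 :> R by []. move: (n.+1%:R) => N N0; field; by rewrite N0.
exists C; split => //.
- move=> n; apply: bigcup_measurable => k _; apply: bigcup_measurable => l _.
  apply: bigsetU_measurable => t _; apply: bigsetU_measurable => x _.
  rewrite (_ : A n t x = \bigcap_(i in [set: 'I_d]) [set w | `|B i t w - (x ord0 i - f t ord0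
    i)| < n.+1%:R^-1]).
    apply: fin_bigcap_measurable => // i _.
    have m1 : measurable_fun setT (fun w => `|B i t w - (x ord0 i - f t ord0 i)|).
      by apply: measurableT_comp => //; apply: measurable_funB => //; exact: measurable_funPT.
    have := m1 measurableT _ (measurable_itv `]-oo, n.+1%:R^-1[); rewrite setTI.
    by congr measurable; apply/seteqP; split => w /=; rewrite in_itv.
  apply/seteqP; split => w; rewrite /A /=.
    move=> /(mx_ballP _ _ (inv0 n)) h i _ /=.
    by have := h i; rewrite shiftedE opprB addrA.
  move=> h; apply/(mx_ballP _ _ (inv0 n)) => i; have := h i I.
  by rewrite shiftedE /= opprB addrA.
- move=> m n mn w /CP[k [l [t [x [ts xs Aw]]]]]; apply/CP; exists k, l, t, x; split => //.
  apply: le_ball Aw; by rewrite lef_pV2 ?posrE// ler_nat ltnS.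
- apply/seteqP; split => w.
    move=> /hitsP[t [x [Et Fx tx]]] n _; apply: CI; exists t, x; split => //.
    by rewrite tx; apply: ballxx; rewrite invr_gt0 mulr_gt0.
  move=> hw.
  have /choice[u hu] : forall n : nat, exists p : R * 'rV[R]_d,
      [/\ E p.1, F p.2 & ball (shifted w p.1) n.+1%:R^-1 p.2].
    by move=> n; have [t [x h]] := CE n w (hw n I); exists (t, x).
  (* The near hits have a cluster point on the compact image of [E]; the matching targets approach
     it, and [F] is closed. *)
  have cK : compact (shifted w @` E).
    apply: continuous_compact => //.
    by apply: continuous_subspaceW (@shifted_continuous w).
  pose v n := shifted w (u n).1.
  have [|p [[t Et tp] clp]] := cK (v @ \oo).
    by exists 0%N => // n _; exists (u n).1 => //; case: (hu n).
  apply/hitsP; exists t, p; split => //.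
  have : closed F by exact: compact_closed.
  move=> /closure_id ->; move=> Q /nbhs_ballP[e /= e0 eQ].
  have e20 : 0 < e / 2 by rewrite divr_gt0.
  have [N hN] : exists N, N.+1%:R^-1 < e / 2 :> R.
    exists (Num.truncn (e / 2)^-1); rewrite invf_plt ?posrE//; exact: truncnS_gt.
  have [||_ [[n Nn <-] pn]] := clp (v @` [set n | (N <= n)%N]) (ball p (e / 2)).
  - by exists N => // n Nn; exists n.
  - exact: nbhsx_ballx.
  have [En Fn bn] := hu n.
  exists (u n).2; split => //; apply: eQ; rewrite (splitr e).
  apply: ball_triangle pn _; apply: le_ball bn.
  by apply: le_trans (ltW hN); rewrite lef_pV2 ?posrE// ler_nat ltnS.
Qed.

Lemma hits_measurable : measurable (hits B f E F).
Proof.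
by have [C [mC _ -> _]] := hits_approx; apply: bigcap_measurable => //; exists 0%N.
Qed.

(** Continuity from above along the events of [hits_approx]: a lower bound for near hits, uniform in
    [e], passes to exact hits. *)
Lemma hits_prob_ge (p : R) :
  (forall e, 0 < e -> exists2 G, measurable G &
     (p%:E <= P G)%E /\ forall w, G w -> exists t x, [/\ E t, F x & ball (shifted w t) e x]) ->
  (p%:E <= P (hits B f E F))%E.
Proof.
move=> hp; have [C [mC dC -> CI]] := hits_approx.
have pC n : (p%:E <= P (C n))%E.
  have [|G mG [pG GC]] := hp (3 * n.+1%:R)^-1; first by rewrite invr_gt0 mulr_gt0.
  by apply: (le_trans pG); apply: le_measure; rewrite ?inE// => w /GC/CI.
have niC : nonincreasing_seq C by move=> m n mn; apply/subsetPset; exact: dC.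
have mI : measurable (\bigcap_n C n) by apply: bigcap_measurable => //; exists 0%N.
have PC0 : (P (C 0%N) < +oo)%E by exact: le_lt_trans (probability_le1 P (mC 0%N)) (ltry 1).
have := nonincreasing_cvg_mu PC0 mC mI niC.
move=> cv; rewrite -(cvg_lim _ cv)//; apply: lime_ge; last exact: nearW.
by apply/cvg_ex; exists (P (\bigcap_n C n)).
Qed.

End hitting_event.

(** * Probabilities of one and two boxes *)

Section process_sigma.
Context (disp : measure_display) (T : measurableType disp) (R : realType)
  (P : probability T R) (D : set R) (X : R -> {RV P >-> R}).

(** The sample space with the sigma-algebra of the process, so that membership in [process_sigma]
    becomes measurability and the usual closure lemmas apply. *)
Definition process_type := g_sigma_algebraType
  (\bigcup_(t in D) preimage_set_system setT (X t) measurable).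

Lemma process_sigmaE (A : set process_type) : process_sigma D X A = measurable A.
Proof. by []. Qed.

Lemma process_measurable_fun t : D t ->
  measurable_fun setT (X t : process_type -> R).
Proof.
move=> Dt _ A mA; rewrite setTI; apply: sub_sigma_algebra; exists t => //.
by exists A => //; rewrite setTI.
Qed.

Lemma process_sigma_measurable (A : set T) : process_sigma D X A -> measurable A.
Proof.
apply: smallest_sub; first exact: sigma_algebra_measurable.
move=> B [t Dt [C mC <-]]; rewrite setTI.
by have := measurable_funPT (X t) measurableT C mC; rewrite setTI.
Qed.

End process_sigma.

Lemma measurable_norm_le d (T : measurableType d) (R : realType) (Y : T -> R) (y e : R) :
  measurable_fun setT Y -> measurable [set w | `|Y w - y| <= e].
Proof.
move=> mY; have m1 : measurable_fun setT (fun w => `|Y w - y|).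
  by apply: measurableT_comp => //; exact: measurable_funB.
have := m1 measurableT _ (measurable_itv `]-oo, e]); rewrite setTI.
by congr measurable; apply/seteqP; split => w /=; rewrite in_itv.
Qed.

(** The density is bounded below on an interval of length [2 * e]: its peak through [s^2 <= 1], its
    exponential through [|x| <= |y| + 1] and [A <= s^2]. *)
Lemma normal_prob_ge (R : realType) (s A y e : R) : s != 0 -> s ^+ 2 <= 1 ->
  0 < A -> A <= s ^+ 2 -> 0 < e -> e <= 1 ->
  ((2 * ((Num.sqrt (pi *+ 2))^-1 * expR (- (`|y| + 1) ^+ 2 / (2 * A))) * e)%:E <=
   normal_prob 0 s [set x | (`|x - y| <= e)%R])%E.
Proof.
move=> s0 s1 A0 As e0 e1.
rewrite (_ : [set x | (`|x - y| <= e)%R] = `[y - e, y + e]%classic); last first.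
  by apply/seteqP; split => x /=; rewrite in_itv/= ler_distlC lerBlDr => /andP[? ?];
    apply/andP; split; lra.
set k := (_^-1 * _).
rewrite /normal_prob; apply: (@le_trans _ _ (\int[lebesgue_measure]_(x in `[(y - e)%R, (y +
  e)%R]) k%:E)%E).
  rewrite integral_cst//= lebesgue_measure_itv/= lte_fin ifT; last by lra.
  by rewrite -EFinD -EFinM lee_fin le_eqVlt; apply/orP; left; apply/eqP; ring.
have k0 : 0 <= k by rewrite mulr_ge0 ?invr_ge0 ?sqrtr_ge0 ?expR_ge0.
apply: ge0_le_integral => //.
  apply/measurable_EFinP; apply: measurable_funTS; exact: measurable_normal_pdf.
move=> x; rewrite /= in_itv/= => /andP[x1 x2]; rewrite lee_fin normal_pdfE// /k.
have s20 : 0 < s ^+ 2 by rewrite (lt_le_trans A0).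
apply: ler_pM; rewrite ?invr_ge0 ?sqrtr_ge0 ?expR_ge0//.
  have p0 : 0 < (pi : R) by exact: pi_gt0.
  have p1 : 0 < s ^+ 2 * pi *+ 2 by rewrite pmulrn_lgt0// mulr_gt0.
  rewrite /normal_peak lef_pV2 ?posrE ?sqrtr_gt0//; last by rewrite pmulrn_lgt0.
  by rewrite ler_wsqrtr// lerMn2r/= ler_piMl// ltW.
rewrite /normal_fun ler_expR subr0 mulNr mulNr lerN2.
apply: ler_pM; rewrite ?sqr_ge0 ?invr_ge0 ?mulrn_wge0 ?sqr_ge0//.
  rewrite -(real_normK (num_real x)) lerXn2r ?nnegrE ?addr_ge0//.
  have -> : x = y + (x - y) by ring.
  apply: (le_trans (ler_normD _ _)); rewrite lerD2l (le_trans _ e1)//.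
  by rewrite ler_norml; lra.
rewrite -[X in X^-1 <= _]mulr_natl lef_pV2 ?posrE; [by rewrite ler_wpM2l|exact:
  mulr_gt0|exact: mulr_gt0].
Qed.

Section one_point.
Context (disp : measure_display) (T : measurableType disp) (R : realType)
  (P : probability T R) (a H : R) (X : R -> {RV P >-> R}).
Hypothesis a01 : 0 < a < 1.
Hypothesis H01 : 0 < H < 1.
Hypothesis hX : is_fbm `[0, 1]%classic H X.

Let in01 t : a <= t <= 1 -> `[0, 1]%classic t.
Proof.
by move=> /andP[at_ t1]; have /andP[a0 _] := a01; rewrite /= in_itv/= t1 andbT (le_trans (ltW
  a0)).
Qed.

Lemma fbm_hit_ge t y e : a <= t <= 1 -> 0 < e <= 1 ->
  ((2 * ((Num.sqrt (pi *+ 2))^-1 *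
      expR (- (`|y| + 1) ^+ 2 / (2 * (a `^ H) ^+ 2))) * e)%:E <=
   P [set w | (`|X t w - y| <= e)%R])%E.
Proof.
move=> tI /andP[e0 e1]; have /andP[H0 H1] := H01; have /andP[a0 a1] := a01.
have t01 := in01 tI.
have [s sE hs] := fbm_law3 hX 1 0 0 t01 t01 t01.
have t0 : 0 <= t by case/andP: tI => h _; apply: le_trans h; exact: ltW.
have {}sE : s ^+ 2 = (t `^ H) ^+ 2.
  by rewrite sE -fbm_covxx//; ring.
have E : (fun w => 1 * X t w + 0 * X t w + 0 * X t w) = X t.
  by apply/funext => w; ring.
rewrite {}E in hs.
have m1 : measurable [set x : R | `|x - y| <= e].
  exact: (@measurable_norm_le _ _ R (@id R) y e).
have at_ : a `^ H <= t `^ H.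
  by case/andP: tI => h _; rewrite ge0_ler_powR ?nnegrE ?(ltW H0) ?(ltW a0).
have ap : 0 < a `^ H by rewrite powR_gt0.
have s0 : s != 0 by rewrite -sqrf_eq0 sE expf_neq0// gt_eqF// (lt_le_trans ap).
rewrite (_ : [set w | _] = X t @^-1` [set x | (`|x - y| <= e)%R])//.
rewrite hs.2// /gaussian_law (negbTE s0); apply: normal_prob_ge => //.
- rewrite sE exprn_ile1 ?powR_ge0// powR_le1// t0; by case/andP: tI.
- by rewrite exprn_gt0.
- by rewrite sE lerXn2r ?nnegrE ?powR_ge0.
Qed.

(** The variable [X t - rho * X s] is uncorrelated with [X s], and on the event it is within
    [(1 + |rho|) * e] of [y' - rho * y]. The box bound applies to this pair; [S^2] is its
    conditional variance plus the squared width. *)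
Lemma fbm_two_point s t y y' e
    (rho := fbm_cov H s t / fbm_cov H s s)
    (S := Num.sqrt (fbm_cov H t t - fbm_cov H s t ^+ 2 / fbm_cov H s s
                     + ((1 + `|rho|) * e) ^+ 2)) :
  a <= s <= 1 -> a <= t <= 1 -> 0 < e ->
  (P [set w | `|X s w - y| <= e /\ `|X t w - y'| <= e]%R <=
   (expR 1 * (e / a `^ H * (((1 + `|rho|) * e) / S *
      expR (- (y' - rho * y) ^+ 2 / (2 * S ^+ 2)))))%:E)%E.
Proof.
move=> sI tI e0; have /andP[H0 H1] := H01; have /andP[a0 a1] := a01.
have s0 : 0 < s by case/andP: sI => h _; apply: lt_le_trans h.
have css : 0 < fbm_cov H s s by rewrite fbm_covxx ?(ltW s0)// exprn_gt0// powR_gt0.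
pose v2 := fbm_cov H t t - fbm_cov H s t ^+ 2 / fbm_cov H s s.
have v20 : 0 <= v2.
  apply: le_trans (fbm_lnd H01 a01 sI tI).
  by rewrite mulr_ge0 ?sqr_ge0// ltW// lnd_const_gt0.
have pr : gauss_pair P (X s) (fun w => 1 * X t w + 0 * X t w + (- rho) * X s w) (s `^ H)
  (Num.sqrt v2).
  apply: fbm_pair => //; [exact: in01|exact: in01|exact: in01| |].
    by rewrite /rho; field; rewrite gt_eqF.
  rewrite sqr_sqrtr// /v2 /rho (fbm_covC _ t s); field; by rewrite gt_eqF.
have e'0 : 0 < (1 + `|rho|) * e by rewrite mulr_gt0// ltr_pwDl.
have hb := gauss_pair_box pr y (y' - rho * y) e0 e'0.
have mS : measurable [set w | `|X s w - y| <= e /\ `|X t w - y'| <= e].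
  by apply: measurableI; apply: measurable_norm_le; exact: measurable_funPT.
have mZ : measurable [set w | `|X s w - y| <= e /\
    `|1 * X t w + 0 * X t w + - rho * X s w - (y' - rho * y)| <= (1 + `|rho|) * e].
  by case: (pr) => _ mV _; apply: measurableI; apply: measurable_norm_le;
    [exact: measurable_funPT|].
apply: (le_trans (le_measure P _ _ _)); rewrite ?inE; [exact: mS|exact: mZ| |].
  move=> w [h1 h2]; split => //=.
  rewrite [X in `|X|](_ : _ = (X t w - y') - rho * (X s w - y)); last by ring.
  apply: (le_trans (ler_normB _ _)); rewrite mulrDl mul1r lerD// normrM.
  by rewrite ler_wpM2l.
apply: (le_trans hb); rewrite lee_fin ler_wpM2l ?expR_ge0//.
rewrite !sqr_sqrtr//; last by rewrite addr_ge0// sqr_ge0.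
apply: ler_pM; rewrite ?mulr_ge0 ?expR_ge0 ?invr_ge0 ?sqrtr_ge0 ?(ltW e0) ?addr_ge0//.
rewrite ler_wpM2l ?(ltW e0)// lef_pV2 ?posrE ?powR_gt0// ?sqrtr_gt0; last first.
  by rewrite ltr_pwDr ?exprn_gt0// sqr_ge0.
apply: (@le_trans _ _ (s `^ H)).
  by rewrite ge0_ler_powR ?nnegrE ?(ltW H0) ?(ltW a0) ?(ltW s0)//; case/andP: sI.
rewrite -[leLHS]ger0_norm ?powR_ge0// -sqrtr_sqr ler_wsqrtr// lerDl sqr_ge0//.
Qed.

End one_point.

Section two_point.
Context (R : realType) (a H : R).
Hypothesis a01 : 0 < a < 1.
Hypothesis H01 : 0 < H < 1.

(** An upper bound for [1 + |rho|], with [rho] the regression coefficient. *)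
Definition reg_const : R := 2 + 2 / (a `^ H) ^+ 2.

(** Here [a^H] bounds the standard deviation of [X s] from below, and the square root relates [S] to
    the scale [theta] below; the minimum with 1 lets the same factor serve the part of [S] that
    comes from the width [e]. *)
Definition box_const : R :=
  expR 1 * reg_const / (a `^ H * Num.sqrt (Num.min (lnd_const H a) 1)).

(** The factor [expR (d^2 / 2)] bounds [(1 + u)^d * expR (- u^2 / 2)]; the base of the power
    converts [|z| / S] into distance over [theta]. *)
Definition far_const (d : nat) (C2 : R) : R :=
  ((1 + C2) * (2 + reg_const)) ^+ d * expR (d%:R ^+ 2 / 2).

Let A0 : 0 < a `^ H.
Proof. by rewrite powR_gt0//; case/andP: a01. Qed.

Lemma reg_const_gt0 : 0 < reg_const.
Proof. by rewrite ltr_wpDr// divr_ge0// sqr_ge0. Qed.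

Lemma min_lnd_gt0 : 0 < Num.min (lnd_const H a) 1.
Proof. by rewrite lt_min ltr01 lnd_const_gt0. Qed.

Lemma box_const_gt0 : 0 < box_const.
Proof.
by rewrite divr_gt0 ?mulr_gt0 ?expR_gt0 ?reg_const_gt0 ?sqrtr_gt0 ?min_lnd_gt0.
Qed.

Lemma far_const_gt0 d C2 : 0 <= C2 -> 0 < far_const d C2.
Proof.
move=> h; rewrite mulr_gt0 ?expR_gt0// exprn_gt0// mulr_gt0//.
  by rewrite ltr_pwDl.
by rewrite ltr_wpDr// ltW// reg_const_gt0.
Qed.

(** The left side is the squared error of the best linear prediction of [X t] from [X s], the right
    side that of the prediction by [X s] itself. *)
Lemma fbm_residual_le s t : a <= s <= 1 -> a <= t <= 1 ->
  fbm_cov H t t - fbm_cov H s t ^+ 2 / fbm_cov H s s <= (`|t - s| `^ H) ^+ 2.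
Proof.
move=> /andP[as_ s1] /andP[at_ t1]; have /andP[a0 a1] := a01.
have s0 : 0 < s by apply: lt_le_trans as_.
have t0 : 0 < t by apply: lt_le_trans at_.
have p0 : 0 < fbm_cov H s s by rewrite fbm_covxx ?(ltW s0)// exprn_gt0// powR_gt0.
have -> : (`|t - s| `^ H) ^+ 2 = fbm_cov H t t - 2 * fbm_cov H s t + fbm_cov H s s.
  by rewrite !fbm_covxx ?fbm_covE ?(ltW s0) ?(ltW t0)//; field.
rewrite -subr_ge0 (_ : _ - _ = (fbm_cov H s s - fbm_cov H s t) ^+ 2 / fbm_cov H s s).
  by rewrite divr_ge0 ?sqr_ge0// ltW.
by field; rewrite gt_eqF.
Qed.

Lemma fbm_reg_le s t : a <= s <= 1 -> a <= t <= 1 ->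
  1 + `|fbm_cov H s t / fbm_cov H s s| <= reg_const.
Proof.
move=> hs ht; have := fbm_regression_near1 H01 a01 hs ht.
set rho := fbm_cov H s t / _ => h.
have D1 : `|t - s| `^ H <= 1.
  have /andP[a0 a1] := a01; case/andP: hs => h1 h2; case/andP: ht => h3 h4.
  by rewrite powR_le1// normr_ge0/= ler_norml; lra.
have : `|rho - 1| <= 2 / (a `^ H) ^+ 2.
  by apply: (le_trans h); rewrite ler_piMr// divr_ge0// sqr_ge0.
rewrite /reg_const => h2.
have : `|rho| <= `|rho - 1| + 1.
  by rewrite -[X in _ <= _ + X](@normr1 R) -[X in `|X| <= _](subrK 1) ler_normD.
lra.
Qed.

(** [1 + u <= expR u], and then the square is completed in [d u - u^2 / 2]. *)
Lemma expR_sq_ge (d : nat) (u : R) : 0 <= u ->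
  (1 + u) ^+ d * expR (- u ^+ 2 / 2) <= expR (d%:R ^+ 2 / 2).
Proof.
move=> u0; apply: (@le_trans _ _ (expR u ^+ d * expR (- u ^+ 2 / 2))).
  by rewrite ler_wpM2r ?expR_ge0// lerXn2r ?nnegrE ?expR_ge0 ?addr_ge0 ?expR_ge1Dx.
rewrite -expRM_natl -expRD ler_expR -subr_ge0.
rewrite (_ : _ - _ = (d%:R - u) ^+ 2 / 2); last by rewrite mulr_natl; field.
by rewrite divr_ge0 ?sqr_ge0.
Qed.

Context (disp : measure_display) (T : measurableType disp)
  (P : probability T R) (X : R -> {RV P >-> R}).
Hypothesis hX : is_fbm `[0, 1]%classic H X.

Section bounds.
Variables (s t y y' e : R).
Hypotheses (sI : a <= s <= 1) (tI : a <= t <= 1) (e0 : 0 < e).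
Let theta := Num.max (`|t - s| `^ H) e.
Let z := y' - fbm_cov H s t / fbm_cov H s s * y.

Let theta0 : 0 < theta. Proof. by rewrite lt_max e0 orbT. Qed.

(** [S] is comparable to [theta]. Its lower bound, from local nondeterminism, goes into the
    prefactor; its upper bound is kept for the Gaussian factor, which is needed when the targets are
    far apart. *)
Let two_point_scale : exists2 S : R,
  0 < S <= (1 + reg_const) * theta &
  (P [set w | `|X s w - y| <= e /\ `|X t w - y'| <= e]%R <=
   (box_const * (e ^+ 2 / theta) * expR (- (z / S) ^+ 2 / 2))%:E)%E.
Proof.
have := fbm_two_point a01 H01 hX y y' sI tI e0.
have hv := fbm_lnd H01 a01 sI tI; have hv' := fbm_residual_le sI tI.
have hr := fbm_reg_le sI tI; have rc0 := reg_const_gt0; have m0 := min_lnd_gt0.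
rewrite -/z; set v := fbm_cov H t t - _; set rho := (1 + `|_|) in hr *;
  set S := Num.sqrt _ => hP.
have rho1 : 1 <= rho by rewrite lerDl.
have th2 : theta ^+ 2 <= (`|t - s| `^ H) ^+ 2 + e ^+ 2.
  by rewrite /theta maxEle; case: ifP => _; rewrite ?lerDl ?lerDr sqr_ge0.
have te : e <= theta by rewrite le_max lexx orbT.
have tt : `|t - s| `^ H <= theta by rewrite le_max lexx.
have D0 : 0 <= `|t - s| `^ H by exact: powR_ge0.
have v0 : 0 <= v.
  by apply: le_trans hv; rewrite mulr_ge0 ?sqr_ge0// ltW// lnd_const_gt0.
have lo : Num.min (lnd_const H a) 1 * theta ^+ 2 <= v + (rho * e) ^+ 2.
  apply: le_trans (lerD hv (lexx _)).
  apply: (@le_trans _ _ (Num.min (lnd_const H a) 1 * (`|t - s| `^ H) ^+ 2 + Num.min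
    (lnd_const H a) 1 * e ^+ 2)).
    by rewrite -mulrDr ler_wpM2l// ltW.
  rewrite lerD ?ler_wpM2r ?sqr_ge0 ?ge_min ?lexx//.
  apply: (@le_trans _ _ (1 * e ^+ 2)); first by rewrite ler_wpM2r ?sqr_ge0// ge_min lexx orbT.
  by rewrite mul1r exprMn ler_peMl ?sqr_ge0// expr_ge1// (le_trans ler01).
have hi : v + (rho * e) ^+ 2 <= ((1 + reg_const) * theta) ^+ 2.
  have h1 : v <= theta ^+ 2 by apply: (le_trans hv'); rewrite lerXn2r ?nnegrE// ltW.
  have h2 : (rho * e) ^+ 2 <= (reg_const * theta) ^+ 2.
    have r0 : 0 <= rho by apply: le_trans rho1.
    rewrite lerXn2r ?nnegrE ?mulr_ge0 ?(ltW rc0) ?(ltW e0) ?(ltW theta0)//.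
    by rewrite ler_pM// ltW.
  have : 0 <= reg_const * theta ^+ 2 by rewrite mulr_ge0 ?sqr_ge0// ltW.
  by move: h1 h2; rewrite !exprMn; lra.
have S0 : 0 < S.
  by rewrite sqrtr_gt0 (lt_le_trans _ lo)// mulr_gt0 ?exprn_gt0.
have Slo : Num.sqrt (Num.min (lnd_const H a) 1) * theta <= S.
  rewrite -[X in _ * X](ger0_norm (ltW theta0)) -sqrtr_sqr -sqrtrM ?(ltW m0)//.
  exact: ler_wsqrtr.
exists S.
  rewrite S0/= -[leRHS](@ger0_norm R); last by rewrite mulr_ge0 ?(ltW theta0)// addr_ge0// ltW.
  by rewrite -sqrtr_sqr ler_wsqrtr.
apply: (le_trans hP); rewrite lee_fin.
rewrite (_ : - z ^+ 2 / (2 * S ^+ 2) = - (z / S) ^+ 2 / 2); last by field; rewrite gt_eqF.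
rewrite !mulrA ler_wpM2r ?expR_ge0//.
have sm0 : 0 < Num.sqrt (Num.min (lnd_const H a) 1) by rewrite sqrtr_gt0.
rewrite (_ : box_const * e * e / theta = expR 1 * e / a `^ H * (reg_const * e) / (Num.sqrt
  (Num.min (lnd_const H a) 1) * theta)); last first.
  by rewrite /box_const; field; rewrite !gt_eqF.
have g0 : 0 <= expR 1 * e / a `^ H by rewrite divr_ge0 ?mulr_ge0 ?expR_ge0// ltW.
rewrite -[_ * rho * e]mulrA.
have re0 : 0 <= rho * e by rewrite mulr_ge0 ?(ltW e0)// (le_trans ler01).
apply: ler_pM; rewrite ?invr_ge0 ?(ltW S0)//; first exact: mulr_ge0.
  by rewrite ler_wpM2l// ler_wpM2r// ltW.
by rewrite lef_pV2 ?posrE// mulr_gt0.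
Qed.

Lemma two_point_le :
  (P [set w | `|X s w - y| <= e /\ `|X t w - y'| <= e]%R <=
   (box_const * (e ^+ 2 / theta))%:E)%E.
Proof.
have [S _ h] := two_point_scale; apply: (le_trans h); rewrite lee_fin ler_piMr//.
  by rewrite mulr_ge0 ?(ltW box_const_gt0)// divr_ge0 ?sqr_ge0// ltW.
by rewrite -[leRHS]expR0 ler_expR mulNr oppr_le0 divr_ge0 ?sqr_ge0.
Qed.

(** The Gaussian factor of this one coordinate decays faster than any power of [|z| / theta], so it
    can pay a full [d]-th power. The constant [C2] absorbs errors of order [theta] between [|z|] and
    the distance of the targets. *)
Lemma two_point_far (d : nat) (r C2 : R) : 0 <= C2 -> r <= `|z| + C2 * theta ->
  (P [set w | `|X s w - y| <= e /\ `|X t w - y'| <= e]%R <=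
   (box_const * (e ^+ 2 / theta) * (far_const d C2 * (theta / Num.max theta r) ^+ d))%:E)%E.
Proof.
move=> C20 hr; have [S /andP[S0 Sth] h] := two_point_scale; apply: (le_trans h).
have rc0 := reg_const_gt0.
rewrite lee_fin ler_wpM2l//.
  by rewrite mulr_ge0 ?(ltW box_const_gt0)// divr_ge0 ?sqr_ge0// ltW.
set m := Num.max theta r.
have m0 : 0 < m by rewrite lt_max theta0.
rewrite [(theta / m) ^+ d]expr_div_n mulrA ler_pdivlMr ?exprn_gt0//.
set u := `|z| / S; have u0 : 0 <= u by rewrite divr_ge0// ltW.
have -> : (z / S) ^+ 2 = u ^+ 2 by rewrite /u !exprMn real_normK// num_real.
have zu : `|z| <= (1 + reg_const) * theta * u.
  by rewrite /u mulrCA ler_peMr// ler_pdivlMr// mul1r.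
clearbody u.
have rc := ltW rc0; have tp := ltW theta0.
have mle : m <= (1 + C2) * (2 + reg_const) * theta * (1 + u).
  have q1 : 0 <= reg_const * theta * u by rewrite !mulr_ge0.
  have q2 : 0 <= theta * u by rewrite !mulr_ge0.
  have q3 : 0 <= reg_const * theta by rewrite !mulr_ge0.
  have q4 : 0 <= C2 * theta by rewrite !mulr_ge0.
  have q5 : 0 <= C2 * (theta * u) by rewrite !mulr_ge0.
  have q6 : 0 <= C2 * (reg_const * theta) by rewrite !mulr_ge0.
  have q7 : 0 <= C2 * (reg_const * theta * u) by rewrite !mulr_ge0.
  have t0 := theta0.
  by rewrite /m ge_max; apply/andP; split; lra.
apply: (@le_trans _ _ (expR (- u ^+ 2 / 2) * ((1 + C2) * (2 + reg_const) * theta * (1 + u))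
  ^+ d)).
  by rewrite ler_wpM2l ?expR_ge0// lerXn2r ?nnegrE ?(ltW m0)// (le_trans (ltW m0)).
rewrite /far_const (exprMn _ _ (1 + u)) [(_ * theta) ^+ d]exprMn.
have := expR_sq_ge d u0.
set k := (_ * _) ^+ d; set th := theta ^+ d => hu.
have k0 : 0 <= k * th.
  by rewrite /k /th mulr_ge0// exprn_ge0// mulr_ge0// addr_ge0.
have := ler_wpM2l k0 hu; congr (_ <= _); ring.
Qed.

End bounds.
End two_point.

(** * Boxes in dimension [d] *)

Section boxes.
Context (disp : measure_display) (T : measurableType disp) (R : realType)
  (P : probability T R) (d : nat) (a b H K : R).
Variables (B : 'I_d -> R -> {RV P >-> R}) (f : R -> 'rV[R]_d).
Hypothesis a01 : 0 < a < 1.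
Hypothesis ab : a < b.
Hypothesis b1 : b <= 1.
Hypothesis H01 : 0 < H < 1.
Hypothesis hB : is_fbm_dim `[0, 1]%classic H B.
Hypothesis hf : holder_norm a b H f = K%:E.

Let t01 t : a <= t <= b -> a <= t <= 1.
Proof. by move=> /andP[-> h]; exact: le_trans b1. Qed.

Let tI t : a <= t <= b -> `[0, 1]%classic t.
Proof.
move=> /t01/andP[h1 h2]; have /andP[a0 _] := a01.
by rewrite /= in_itv/= h2 andbT (le_trans (ltW a0)).
Qed.

Definition boxed e t (x : 'rV[R]_d) : set T :=
  [set w | forall i, `|shifted B f w t ord0 i - x ord0 i| <= e].

Lemma process_sigma_norm_le i t y e : a <= t <= b ->
  process_sigma `[0, 1]%classic (B i) [set w | `|B i t w - y| <= e].
Proof.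
move=> tab; rewrite process_sigmaE.
by apply: measurable_norm_le; apply: process_measurable_fun; exact: tI.
Qed.

Lemma boxedE e t x : boxed e t x =
  \bigcap_(i in [set: 'I_d]) [set w | `|B i t w - (x ord0 i - f t ord0 i)| <= e].
Proof.
apply/seteqP; split => w /= h i; last first.
  by have := h i I; rewrite shiftedE /= opprB addrA.
by move=> _; have := h i; rewrite shiftedE /= opprB addrA.
Qed.

Lemma boxed_measurable e t x : measurable (boxed e t x).
Proof.
rewrite boxedE; apply: fin_bigcap_measurable => // i _.
by apply: measurable_norm_le; exact: measurable_funPT.
Qed.

Lemma fbm_dim_prod (A : 'I_d -> set T) :
  (forall i, process_sigma `[0, 1]%classic (B i) (A i)) ->
  exists p : 'I_d -> R, (forall i, P (A i) = (p i)%:E) /\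
    P (\bigcap_(i in [set: 'I_d]) A i) = (\prod_(i < d) p i)%:E.
Proof.
move=> pA; exists (fun i => fine (P (A i))).
have fP i : P (A i) = (fine (P (A i)))%:E.
  by rewrite fineK// fin_num_measure//; apply: process_sigma_measurable (pA i).
split => //; case: hB => _ ind; rewrite ind// -prodEFin.
by apply: eq_bigr => i _; rewrite -fP.
Qed.

Definition hit_const M : R := 2 * ((Num.sqrt (pi *+ 2))^-1 *
      expR (- (M + K + 1) ^+ 2 / (2 * (a `^ H) ^+ 2))).

Lemma hit_const_gt0 M : 0 < hit_const M.
Proof.
rewrite mulr_gt0// mulr_gt0 ?expR_gt0// invr_gt0 sqrtr_gt0 pmulrn_lgt0//; exact: pi_gt0.
Qed.

Lemma boxed_prob_ge M e t (x : 'rV[R]_d) : a <= t <= b -> 0 < e <= 1 ->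
  (forall i, `|x ord0 i| <= M) ->
  (((hit_const M * e) ^+ d)%:E <= P (boxed e t x))%E.
Proof.
move=> tab /andP[e0 e1] xM; rewrite boxedE.
have [|p [pE ->]] := fbm_dim_prod (A := fun i => [set w | `|B i t w - (x ord0 i - f t ord0
  i)| <= e]).
  by move=> i; exact: process_sigma_norm_le.
rewrite lee_fin -[X in _ ^+ X]card_ord -prodr_const ler_prod// => i _.
rewrite mulr_ge0 ?(ltW e0) ?(ltW (hit_const_gt0 _))//= -lee_fin -pE.
have e01 : 0 < e <= 1 by rewrite e0.
have [K0 fK _] := holder_bounds ab hf.
apply: le_trans (fbm_hit_ge a01 H01 (proj1 hB i) (x ord0 i - f t ord0 i) (t01 tab) e01).
rewrite lee_fin ler_wpM2r ?(ltW e0)// ler_wpM2l// ler_wpM2l ?invr_ge0 ?sqrtr_ge0//.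
rewrite ler_expR ler_wpM2r//.
  by rewrite invr_ge0 mulr_ge0// sqr_ge0.
have h : `|x ord0 i - f t ord0 i| <= M + K.
  by apply: (le_trans (ler_normB _ _)); rewrite lerD// fK.
rewrite lerN2 lerXn2r ?nnegrE ?lerD2r// addr_ge0//.
exact: le_trans h.
Qed.

(** Replacing [x' - x] by [y' - rho * y] costs the increment of the drift, at most [K * theta], and
    [(rho - 1) * y] with [|y| <= M + K]. *)
Definition drift_const M : R := K + 2 / (a `^ H) ^+ 2 * (M + K).

Definition pair_const M : R := box_const a H ^+ d * (1 + far_const a H d (drift_const M)).

Lemma drift_const_ge0 M : 0 <= K -> 0 <= M -> 0 <= drift_const M.
Proof. by move=> K0 M0; rewrite addr_ge0// mulr_ge0 ?addr_ge0// divr_ge0 ?sqr_ge0. Qed.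

Lemma pair_const_gt0 M : 0 <= K -> 0 <= M -> 0 < pair_const M.
Proof.
move=> K0 M0; rewrite mulr_gt0 ?exprn_gt0 ?box_const_gt0// ltr_pwDl//.
by rewrite ltW// far_const_gt0// drift_const_ge0.
Qed.

(** If [r = e], each coordinate contributes [q], and [q^d] is of the required form. Otherwise the
    coordinate [i0] that realises [r] supplies the whole factor [(th / m)^d], which turns the
    [th^-d] inside [q^d] into [m^-d]; the other coordinates still contribute [q]. *)
Lemma boxed_pair_le M e s t (x x' : 'rV[R]_d) r : 0 <= M -> a <= s <= b -> a <= t <= b -> 0 <
  e ->
  (forall i, `|x ord0 i| <= M) -> e <= r ->
  (r = e \/ exists i, r <= `|x' ord0 i - x ord0 i|) ->
  (P (boxed e s x `&` boxed e t x') <=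
   (pair_const M * e ^+ (2 * d) * (Num.max r (`|t - s| `^ H)) ^- d)%:E)%E.
Proof.
move=> M0 sab tab e0 xM er hr; have e0' := ltW e0.
have [K0 fK fL] := holder_bounds ab hf.
pose y i := x ord0 i - f s ord0 i; pose y' i := x' ord0 i - f t ord0 i.
pose A i := [set w | `|B i s w - y i| <= e /\ `|B i t w - y' i| <= e].
have -> : boxed e s x `&` boxed e t x' = \bigcap_(i in [set: 'I_d]) A i.
  rewrite !boxedE; apply/seteqP; split => w /=.
    by move=> [h1 h2] i _; split; [exact: h1|exact: h2].
  by move=> h; split => i _; have [h1 h2] := h i I.
have [|p [pE ->]] := fbm_dim_prod (A := A).
  by move=> i; rewrite process_sigmaE; apply: measurableI; rewrite -process_sigmaE;
    exact: process_sigma_norm_le.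
pose th := Num.max (`|t - s| `^ H) e.
have th0 : 0 < th by rewrite lt_max e0 orbT.
have b0 := box_const_gt0 a01 H01.
pose q := box_const a H * (e ^+ 2 / th).
have q0 : 0 <= q by rewrite mulr_ge0 ?(ltW b0)// divr_ge0 ?sqr_ge0 ?ltW.
have p0 i : 0 <= p i by rewrite -lee_fin -pE.
have pq i : p i <= q.
  by rewrite -lee_fin -pE; apply: (two_point_le a01 H01 (proj1 hB i)) => //; exact: t01.
have qd : q ^+ d = box_const a H ^+ d * e ^+ (2 * d) * th ^- d.
  by rewrite /q exprMn [(_ / th) ^+ d]expr_div_n -[(e ^+ 2) ^+ d]exprM mulrA.
rewrite lee_fin; case: hr => [re|[i0 hi0]].
  rewrite re maxC -/th.
  apply: (@le_trans _ _ (q ^+ d)).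
    rewrite -[X in _ ^+ X]card_ord -prodr_const ler_prod// => i _.
    by rewrite p0 pq.
  rewrite qd /pair_const ler_wpM2r ?invr_ge0 ?exprn_ge0 ?(ltW th0)//.
  rewrite ler_wpM2r ?exprn_ge0 ?(ltW e0)// ler_peMr ?exprn_ge0 ?(ltW b0)//.
  rewrite lerDl ltW// far_const_gt0// drift_const_ge0//.
set C2 := drift_const M; have C20 : 0 <= C2 by exact: drift_const_ge0.
have mE : Num.max r (`|t - s| `^ H) = Num.max th r.
  by rewrite /th maxC -maxA (max_r er).
rewrite mE; set m := Num.max th r; have m0 : 0 < m by rewrite lt_max th0.
have far : p i0 <= q * (far_const a H d C2 * (th / m) ^+ d).
  rewrite -lee_fin -pE; apply: (two_point_far a01 H01 (proj1 hB i0)) => //;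
    [exact: t01|exact: t01|].
  rewrite -/th; apply: (le_trans hi0).
  have h1 := fbm_regression_near1 H01 a01 (t01 sab) (t01 tab).
  set rho := fbm_cov H s t / _ in h1 *.
  have h2 := fL s t i0 sab tab; have h3 := fK s i0 sab.
  have yM : `|y i0| <= M + K by apply: (le_trans (ler_normB _ _)); rewrite lerD.
  (* The distance of the centred targets, up to the two errors that [drift_const] collects. *)
  rewrite (_ : x' ord0 i0 - x ord0 i0 = (y' i0 - rho * y i0) + ((f t ord0 i0 - f s ord0 i0) +
    (rho - 1) * y i0)); last by rewrite /y /y'; ring.
  apply: (le_trans (ler_normD _ _)); rewrite lerD2l.
  apply: (le_trans (ler_normD _ _)); rewrite normrM /C2 /drift_const.
  have tt : `|t - s| `^ H <= th by rewrite le_max lexx.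
  rewrite mulrDl lerD//.
    by apply: (le_trans h2); rewrite ler_wpM2l.
  rewrite mulrAC ler_pM//; apply: (le_trans h1).
  by rewrite ler_wpM2l// divr_ge0// sqr_ge0.
rewrite (bigD1 i0)//=.
apply: (@le_trans _ _ (q * (far_const a H d C2 * (th / m) ^+ d) * q ^+ d.-1)).
  apply: ler_pM => //; first by apply: prodr_ge0.
  apply: (@le_trans _ _ (\prod_(i < d | i != i0) q)).
    by apply: ler_prod => i _; rewrite p0 pq.
  by rewrite prodr_const cardC1 card_ord.
have -> : q * (far_const a H d C2 * (th / m) ^+ d) * q ^+ d.-1 =
   far_const a H d C2 * (q ^+ d * (th / m) ^+ d).
  rewrite [in RHS](_ : q ^+ d = q * q ^+ d.-1); first ring.
  by rewrite -exprS prednK// (leq_ltn_trans _ (ltn_ord i0)).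
have -> : q ^+ d * (th / m) ^+ d = box_const a H ^+ d * e ^+ (2 * d) * m ^- d.
  rewrite qd [(th / m) ^+ d]expr_div_n; field; by rewrite !gt_eqF ?exprn_gt0.
rewrite !mulrA ler_wpM2r ?invr_ge0 ?exprn_ge0 ?(ltW m0)// ler_wpM2r ?exprn_ge0//.
rewrite mulrC /pair_const ler_wpM2l ?exprn_ge0 ?(ltW b0)//.
by rewrite -/C2 lerDr.
Qed.

End boxes.

(** * Second moments and energy *)

Section simple_integrals.
Context (d : measure_display) (T : measurableType d) (R : realType)
  (mu : {measure set T -> \bar R}).

(* No measurability is needed, which spares a proof that the inner integral of
   the energy is a measurable function. *)
Lemma le_integral_nomeas (f g : T -> \bar R) : (forall x, (0 <= f x)%E) ->
  (forall x, (f x <= g x)%E) -> (\int[mu]_x f x <= \int[mu]_x g x)%E.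
Proof.
move=> f0 fg; have g0 x : (0 <= g x)%E by exact: le_trans (fg x).
rewrite !ge0_integralTE//; apply: le_ereal_sup => _ [h hf <-].
by exists h => // x; exact: le_trans (fg x).
Qed.

Lemma integral_sum_indic (I : Type) (r : seq I) (c : I -> R) (A : I -> set T) :
  (forall i, 0 <= c i) -> (forall i, measurable (A i)) ->
  (\int[mu]_x (\sum_(i <- r) c i * \1_(A i) x)%R%:E = \sum_(i <- r) (c i)%:E * mu (A i))%E.
Proof.
move=> c0 mA.
under eq_integral do rewrite -sumEFin.
rewrite ge0_integral_sum//.
- apply: eq_bigr => i _; under eq_integral do rewrite EFinM.
  rewrite ge0_integralZl ?lee_fin//; first by rewrite integral_indic// setIT.
    by apply/measurable_EFinP; exact: measurable_indic.
- move=> i; apply/measurable_EFinP; apply: measurable_funM => //.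
- by move=> i x _; rewrite lee_fin mulr_ge0.
Qed.

Lemma integral_ge_simple n (f : T -> \bar R) (c : 'I_n -> R) (A : 'I_n -> set T) :
  (forall x, (0 <= f x)%E) -> (forall i, 0 <= c i) ->
  (forall i, measurable (A i)) -> trivIset setT A ->
  (forall i x, A i x -> ((c i)%:E <= f x)%E) ->
  (\sum_(i < n) (c i)%:E * mu (A i) <= \int[mu]_x f x)%E.
Proof.
move=> f0 c0 mA tA cf; rewrite -(integral_sum_indic (index_enum _) c0 mA).
apply: le_integral_nomeas => x.
  by rewrite lee_fin sumr_ge0// => i _; rewrite mulr_ge0.
have [[i Ai]|noA] := pselect (exists i, A i x).
  rewrite (bigD1 i)//= big1 ?addr0; last first.
    move=> j ji; rewrite indicE memNset ?mulr0// => Aj.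
    have := tA j i I I (ex_intro _ x (conj Aj Ai)) => /eqP; by rewrite (negbTE ji).
  by rewrite indicE mem_set// mulr1; exact: cf.
rewrite big1// => i _; rewrite indicE memNset ?mulr0// => Ai; apply: noA; by exists i.
Qed.

End simple_integrals.

(* Integrating [J <= l J^2 + 1_U / (4 l)], where [J] is the weighted number of
   the events that occur, and optimising over [l]. *)
Lemma second_moment (d : measure_display) (T : measurableType d) (R : realType)
    (P : probability T R) (I : choiceType) (r : seq I) (w : I -> R) (A : I -> set T)
    (m V : R) :
  (forall i, 0 <= w i) -> (forall i, measurable (A i)) -> 0 < m -> 0 < V ->
  (m%:E <= \sum_(i <- r) (w i)%:E * P (A i))%E ->
  (\sum_(i <- r) \sum_(j <- r) (w i * w j)%:E * P (A i `&` A j) <= V%:E)%E ->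
  ((m ^+ 2 / V)%:E <= P (\big[setU/set0]_(i <- r) A i))%E.
Proof.
move=> w0 mA m0 V0 hm hV; set U := \big[_/_]_(_ <- _) _.
have mU : measurable U by exact: bigsetU_measurable.
pose J x := \sum_(i <- r) w i * \1_(A i) x.
have mJ : measurable_fun setT J.
  by apply: measurable_sum => i; apply: measurable_funM.
have [l [l0 e1 e2]] : exists l, [/\ 0 < l, l * V = m / 2 & (4 * l)^-1 = V / (2 * m)].
  exists (m / (2 * V)); split; first by rewrite divr_gt0// mulr_gt0.
    by field; rewrite gt_eqF.
  by field; rewrite !gt_eqF.
have J2 x : J x ^+ 2 = \sum_(p <- allpairs pair r r) w p.1 * w p.2 * \1_(A p.1 `&` A p.2) x.
  rewrite expr2 /J big_distrlr/= big_allpairs_dep/=.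
  apply: eq_bigr => i _; apply: eq_bigr => j _.
  by rewrite indicI/=; ring.
have key x : J x <= l * J x ^+ 2 + (4 * l)^-1 * \1_U x.
  have [Ux|nUx] := pselect (U x).
    rewrite indicE mem_set// mulr1 -subr_ge0.
    rewrite (_ : _ - _ = l * (J x - (2 * l)^-1) ^+ 2); first by rewrite mulr_ge0 ?sqr_ge0 ?ltW.
    by field; rewrite gt_eqF.
  have -> : J x = 0.
    rewrite /J big_seq big1// => i ir; rewrite indicE memNset ?mulr0// => Ai.
    by apply: nUx; rewrite /U -bigcup_seq; exists i.
  by rewrite expr0n/= mulr0 add0r mulr_ge0// invr_ge0 mulr_ge0// ltW.
have mJ2 : measurable_fun setT (fun x => J x ^+ 2) by apply: measurable_funX.
have EJ : (m%:E <= \int[P]_x (J x)%:E)%E by rewrite integral_sum_indic.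
have EJ2 : (\int[P]_x (J x ^+ 2)%:E <= V%:E)%E.
  under eq_integral do rewrite J2.
  rewrite integral_sum_indic; [|by move=> p; rewrite mulr_ge0|by move=> p; exact: measurableI].
  by rewrite big_allpairs_dep.
have J0 x : 0 <= J x by apply: sumr_ge0 => i _; rewrite mulr_ge0.
have fin : (m%:E <= l%:E * V%:E + ((4 * l)^-1)%:E * P U)%E.
  apply: (le_trans EJ); apply: (@le_trans _ _ (\int[P]_x (l * J x ^+ 2 + (4 * l)^-1 * \1_U
    x)%:E)%E).
    by apply: le_integral_nomeas => x; rewrite lee_fin.
  have l4 : 0 <= (4 * l)^-1 by rewrite invr_ge0 mulr_ge0// ltW.
  under eq_integral do rewrite EFinD.
  rewrite ge0_integralD//=.
  - apply: leeD.
      under eq_integral do rewrite EFinM.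
      rewrite ge0_integralZl ?lee_fin ?(ltW l0)//; first by rewrite lee_pmul2l.
      + exact/measurable_EFinP/mJ2.
      + by move=> x _; rewrite lee_fin sqr_ge0.
    under eq_integral do rewrite EFinM.
    rewrite ge0_integralZl ?lee_fin//; first by rewrite integral_indic// setIT.
    by apply/measurable_EFinP; exact: measurable_indic.
  - by move=> x _; rewrite lee_fin mulr_ge0 ?sqr_ge0// ltW.
  - by apply/measurable_EFinP; exact: measurable_funM.
  - by move=> x _; rewrite lee_fin mulr_ge0.
  - by apply/measurable_EFinP; apply: measurable_funM => //; exact: measurable_indic.
have PU : P U = (fine (P U))%:E by rewrite fineK// fin_num_measure.
move: fin; rewrite PU -!EFinM -EFinD !lee_fin; set p := fine _ => fin.
move: fin; rewrite e1 e2 => fin.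
rewrite ler_pdivrMr//.
have h : m / 2 <= V / (2 * m) * p by lra.
have := ler_wpM2l (ltW (mulr_gt0 (ltr0n R 2) m0)) h.
rewrite (_ : 2 * m * (m / 2) = m ^+ 2); last by field.
rewrite (_ : 2 * m * (V / (2 * m) * p) = p * V)//; by field; rewrite gt_eqF.
Qed.

Lemma compact_closed_rV (R : realType) d (F : set 'rV[R]_d) : (0 < d)%N -> compact F ->
  closed F.
Proof. by case: d F => // d F _; apply: compact_closed; exact: norm_hausdorff. Qed.

Lemma compact_bounded_rV (R : realType) d (F : set 'rV[R]_d) : compact F ->
  exists2 M : R, 0 <= M & forall x i, F x -> `|x ord0 i| <= M.
Proof.
move=> cF; have [s [sF hs]] := compact_net cF (@ltr01 R).
exists (1 + \sum_(y <- s) enorm y).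
  by rewrite addr_ge0// sumr_ge0// => y _; exact: sqrtr_ge0.
move=> x i /hs [y ys] /mx_ballP - /(_ ltr01 i) h.
rewrite -[x ord0 i](subrK (y ord0 i)); apply: (le_trans (ler_normD _ _)).
rewrite lerD//; first by rewrite distrC ltW.
apply: (le_trans (le_enorm y i)); rewrite (big_rem y)//= lerDl.
by rewrite sumr_ge0// => z _; exact: sqrtr_ge0.
Qed.

Section riesz_energy.
Context (R : realType) (d : nat).
Implicit Types (mu : probability (borelRV R d) R) (F : set 'rV[R]_d).

Lemma open_borelRV (A : set 'rV[R]_d) : open A -> measurable (A : set (borelRV R d)).
Proof. by move=> oA; apply: sub_sigma_algebra. Qed.

Lemma closed_borelRV (A : set 'rV[R]_d) : closed A -> measurable (A : set (borelRV R d)).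
Proof. by move=> cA; rewrite -(setCK A); apply: measurableC; apply: open_borelRV;
  exact: closed_openC. Qed.

(** Disjointified interiors of the balls of radius [e] around an [e / 2]-net: interiors are open,
    hence Borel, and the spare half of the radius ensures that they still cover [F]. *)
Lemma borel_cells mu F e : (0 < d)%N -> compact F -> mu F = 1%E -> 0 < e ->
  exists n (y : 'I_n -> 'rV[R]_d) (G : 'I_n -> set (borelRV R d)),
  [/\ forall k, F (y k), forall k, measurable (G k), trivIset setT G,
     (forall k (x : 'rV[R]_d), G k x -> forall i, `|x ord0 i - y k ord0 i| < e) &
     (\sum_(k < n) mu (G k) = 1)%E].
Proof.
move=> d0 cF muF e0; have e2 : 0 < e / 2 by rewrite divr_gt0.
have [s [sF hs]] := compact_net cF e2.
pose Q k : set 'rV[R]_d := interior (ball (nth 0 s k) e).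
pose G k : set (borelRV R d) := seqDU Q k.
have mQ k : measurable (Q k : set (borelRV R d)) by apply: open_borelRV; exact: open_interior.
have mG k : measurable (G k).
  by rewrite /G /seqDU; apply: measurableD => //; exact: bigsetU_measurable.
exists (size s), (fun k => nth 0 s k), (fun k => G k); split => //.
- by move=> k; apply: sF; exact: mem_nth.
- apply/trivIsetP => i j _ _ ij; have /trivIsetP := trivIset_seqDU Q.
  by apply => //; apply: contraNneq ij => /val_inj ->.
- move=> k x [/interior_subset Qx _] i; have /mx_ballP - /(_ e0 i) := Qx.
  by rewrite distrC.
rewrite -measure_bigsetU//.
rewrite /G -bigsetU_seqDU; apply/eqP; rewrite eq_le probability_le1/=;
  last exact: bigsetU_measurable.
rewrite -muF; apply: le_measure; rewrite ?inE.
- by apply: closed_borelRV; exact: compact_closed_rV.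
- exact: bigsetU_measurable.
move=> x /hs[y ys xy].
rewrite -bigcup_mkord; exists (index y s); first by rewrite /= index_mem.
  rewrite /Q nth_index//.
  have h : nbhs (x : 'rV[R]_d) (ball (x : 'rV[R]_d) (e / 2)) by exact: nbhsx_ballx.
  apply: (@filterS _ (nbhs (x : 'rV[R]_d)) _ _ _ _ h) => z xz.
  by rewrite (splitr e); apply: ball_triangle xz.
exact: trivIset_seqDU.
Qed.

Lemma riesz_kernel_ge0 (al r : R) : 0 <= r -> (0 <= riesz_kernel al r)%E.
Proof.
rewrite le_eqVlt => /predU1P[<-|r0].
  by rewrite /riesz_kernel eqxx; case: ifP.
by rewrite riesz_kernelE ?gt_eqF// lee_fin ltW// rkernel_gt0.
Qed.

Lemma rkernel_le_riesz (al r q : R) : 0 <= r -> r <= q -> 0 < q ->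
  ((rkernel al q)%:E <= riesz_kernel al r)%E.
Proof.
rewrite le_eqVlt => /predU1P[<-|r0] rq q0.
  rewrite /riesz_kernel /rkernel eqxx; case: ltP => // _.
  exact: leey.
by rewrite riesz_kernelE ?gt_eqF// lee_fin rkernel_anti.
Qed.

(** Points of the cells [k] and [l] differ by less than [2 e + r k l <= 3 r k l] in each coordinate,
    and [Num.sqrt d] passes to the Euclidean norm. As the kernel decreases, its value at that
    distance bounds it below on the product of the cells. *)
Lemma energy_ge (al : R) mu n (y : 'I_n -> 'rV[R]_d) (G : 'I_n -> set (borelRV R d))
    (e : R) (r : 'I_n -> 'I_n -> R) : (0 < d)%N -> 0 < e ->
  (forall k, measurable (G k)) -> trivIset setT G ->
  (forall k (x : 'rV[R]_d), G k x -> forall i, `|x ord0 i - y k ord0 i| < e) ->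
  (forall k l, e <= r k l) -> (forall k l i, `|y l ord0 i - y k ord0 i| <= r k l) ->
  (\sum_(k < n) \sum_(l < n)
    (fine (mu (G k)) * fine (mu (G l)) * rkernel al (Num.sqrt d%:R * 3 * r k l))%:E <=
   energy al mu)%E.
Proof.
move=> d0 e0 mG tG Gy er yr.
have fG k : mu (G k) = (fine (mu (G k)))%:E by rewrite fineK// fin_num_measure.
have r0 k l : 0 < r k l by exact: lt_le_trans (er k l).
have D0 : 0 < Num.sqrt d%:R * 3 :> R by rewrite mulr_gt0// sqrtr_gt0 ltr0n.
pose c k l := rkernel al (Num.sqrt d%:R * 3 * r k l).
have c0 k l : 0 <= c k l by rewrite ltW// rkernel_gt0// mulr_gt0.
have ker0 (u v : 'rV[R]_d) : (0 <= riesz_kernel al (enorm (u - v)))%E.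
  by rewrite riesz_kernel_ge0// sqrtr_ge0.
have ker k l (u v : 'rV[R]_d) : G k u -> G l v ->
    ((c k l)%:E <= riesz_kernel al (enorm (u - v)))%E.
  move=> /Gy Gu /Gy Gv; apply: rkernel_le_riesz; rewrite ?sqrtr_ge0 ?(mulr_gt0 D0)//.
  rewrite -mulrA enorm_le ?mulr_ge0 ?(ltW (r0 _ _))// => i.
  have h1 := Gu i; have h2 := Gv i; have h3 := yr k l i; have h4 := er k l.
  rewrite !mxE (_ : u ord0 i - v ord0 i = (u ord0 i - y k ord0 i) - (v ord0 i - y l ord0 i) -
    (y l ord0 i - y k ord0 i)); last by ring.
  apply: (le_trans (ler_normB _ _)); apply: le_trans (lerD (ler_normB _ _) (lexx _)) _; lra.
apply: (@le_trans _ _ (\sum_(k < n) (\sum_(l < n) c k l * fine (mu (G l)))%R%:E * mu (G k))%E).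
  apply: lee_sum => k _; rewrite fG -EFinM sumEFin lee_fin mulr_suml.
  by rewrite ler_sum// => l _; rewrite /c le_eqVlt; apply/orP; left; apply/eqP; ring.
rewrite /energy; apply: (@integral_ge_simple _ _ _ mu _ _ (fun k => \sum_(l < n) c k l * fine
  (mu (G l))) G) => //.
- by move=> u; apply: integral_ge0.
- by move=> k; apply: sumr_ge0 => l _; rewrite mulr_ge0// fine_ge0.
move=> k u Gu; rewrite -sumEFin.
apply: le_trans (@integral_ge_simple _ _ _ mu _ _ (c k) G _ _ _ tG _) => //.
  by apply: lee_sum => l _; rewrite EFinM -fG.
by move=> l v Gv; apply: ker.
Qed.

End riesz_energy.

Lemma sumr_const_seq (R : realType) (I : Type) (s : seq I) (c : R) :
  \sum_(i <- s) c = (size s)%:R * c.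
Proof. by rewrite big_const_seq count_predT iter_addr_0 mulr_natl. Qed.

Lemma bigmax_attained (R : realType) (I : Type) (s : seq I) (F : I -> R) e :
  \big[Num.max/e]_(i <- s) F i = e \/ exists i, \big[Num.max/e]_(i <- s) F i = F i.
Proof.
elim/big_rec: _ => [|i x _ h]; first by left.
by rewrite maxEle; case: ifP => _ //; right; exists i.
Qed.

(** * From energy and capacity to the hitting probability *)

Section lower_bound.
Context (disp : measure_display) (T : measurableType disp) (R : realType)
  (P : probability T R) (d : nat) (a b H beta K M C : R).
Variables (B : 'I_d -> R -> {RV P >-> R}) (f : R -> 'rV[R]_d)
  (E : set R) (F : set 'rV[R]_d).
Hypothesis d0 : (0 < d)%N.
Hypothesis a0 : 0 < a.
Hypothesis ab : a < b.
Hypothesis b1 : b <= 1.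
Hypothesis H01 : 0 < H < 1.
Hypothesis hB : is_fbm_dim `[0, 1]%classic H B.
Hypothesis hf : holder_norm a b H f = K%:E.
Hypothesis Eab : E `<=` `[a, b]%classic.
Hypothesis cE : compact E.
Hypothesis cF : compact F.
Hypothesis M0 : 0 <= M.
Hypothesis FM : forall x i, F x -> `|x ord0 i| <= M.
Hypothesis C0 : 0 < C.
Let D : R := Num.sqrt d%:R * 3.
Hypothesis net : forall delta : R, 0 < delta <= 1 -> exists s : seq R,
    [/\ {in s, forall u, E u}, (0 < size s)%N &
     forall t r : R, E t -> delta `^ H <= r <= D * (1 + 2 * M) ->
       \sum_(u <- s) (Num.max r (`|u - t| `^ H)) ^- d <=
       C * (size s)%:R * rkernel (d%:R - beta / H) r].

(** What remains of the second moment ratio [m^2 / V], apart from [W], once the powers of [e] and of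
    the net size have cancelled. *)
Definition energy_const : R :=
  hit_const a H K M ^+ (2 * d) / (pair_const d a H K M * (D ^+ d * C)).

Let a01 : 0 < a < 1. Proof. by rewrite a0 (lt_le_trans ab). Qed.
Let K0 : 0 <= K. Proof. by case: (holder_bounds ab hf). Qed.
Let D1 : 1 <= D.
Proof.
have : 1 <= Num.sqrt d%:R :> R by rewrite -[leLHS]sqrtr1 ler_wsqrtr// ler1n.
rewrite /D; lra.
Qed.
Let pc0 : 0 < pair_const d a H K M. Proof. exact: pair_const_gt0. Qed.

(** Positivity of [W] is proved along the way, because the passage to the capacity divides by it. *)
Lemma hits_prob_ge_energy (mu : probability (borelRV R d) R) (W : R) :
  mu F = 1%E -> energy (d%:R - beta / H) mu = W%:E ->
  0 < W /\ ((energy_const / W)%:E <= P (hits B f E F))%E.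
Proof.
move=> muF eW; set al := d%:R - beta / H in eW *.
have /andP[H0 H1] := H01; have D0 : 0 < D by exact: lt_le_trans D1.
have sE u : E u -> a <= u <= b by move/Eab; rewrite /= in_itv.
suff main : forall e : R, 0 < e <= 1 -> 0 < W /\ exists2 G, measurable G &
     ((energy_const / W)%:E <= P G)%E /\
     forall w, G w -> exists t x, [/\ E t, F x & forall i, `|shifted B f w t ord0 i - x ord0
       i| <= e].
  split; first by case: (main 1) => //; rewrite ltr01 lexx.
  apply: (hits_prob_ge a0 ab b1 H01 hB hf Eab cE cF) => eta eta0.
  pose e := Num.min 1 (eta / 2).
  have e2 : 0 < eta / 2 by rewrite divr_gt0.
  have e0 : 0 < e by rewrite lt_min ltr01 e2.
  have [|_ [G mG [pG hG]]] := main e; first by rewrite e0 ge_min lexx.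
  exists G => //; split => // w /hG [t [x [Et Fx hx]]]; exists t, x; split => //.
  apply/mx_ballP => // i; apply: (le_lt_trans (hx i)).
  rewrite /e gt_min; apply/orP; right.
  by rewrite ltr_pdivrMr// mulr_natr mulr2n ltrDl.
move=> e /andP[e0 e1].
(* With time mesh [e^(1 / H)] the net sums are controlled down to the distance [e], the size of the
   boxes. *)
have [|s [sE' s0 hs]] := @net (e `^ (H^-1)).
  by rewrite powR_gt0//= -[leRHS](powR_one H^-1) ge0_ler_powR ?nnegrE ?invr_ge0 ?(ltW H0)
    ?(ltW e0).
rewrite -powRrM mulVf ?gt_eqF// powRr1 ?(ltW e0)// in hs.
have [n [y [G [Fy mG tG Gy muG]]]] := borel_cells d0 cF muF e0.
pose m k := fine (mu (G k)); have m0 k : 0 <= m k by exact: fine_ge0.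
have fG k : mu (G k) = (m k)%:E by rewrite fineK// fin_num_measure.
have sm : \sum_(k < n) m k = 1.
  apply: EFin_inj; rewrite -muG -sumEFin; by apply: eq_bigr => k _; rewrite fG.
(* Distances below the resolution [e] are rounded up to it, both in the energy and in the two-point
   bound. *)
pose r k l := \big[Num.max/e]_(i < d) `|y l ord0 i - y k ord0 i|.
have er k l : e <= r k l by exact: bigmax_ge_id.
have yr k l i : `|y l ord0 i - y k ord0 i| <= r k l by exact: le_bigmax.
have rM k l : r k l <= 1 + 2 * M.
  apply: bigmax_le => [|i _]; first by rewrite (le_trans e1)// lerDl mulr_ge0.
  apply: (le_trans (ler_normB _ _)); have := FM i (Fy k); have := FM i (Fy l); lra.
have := @energy_ge _ _ al mu _ y G e r d0 e0 mG tG Gy er yr; rewrite eW.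
under eq_bigr do rewrite sumEFin; rewrite sumEFin lee_fin -/D.
set EE := \sum_(k < n) _ => EW.
have r0 k l : 0 < r k l by exact: lt_le_trans (er k l).
(* The weights have total mass 1 and all distances are at most [1 + 2 * M], so the discrete energy
   is at least one positive value of the kernel. *)
have EE0 : 0 < EE.
  have q0 : 0 < rkernel al (D * (1 + 2 * M)) by rewrite rkernel_gt0// mulr_gt0// ltr_pwDl//
    mulr_ge0.
  apply: (lt_le_trans q0).
  rewrite (_ : rkernel al _ = \sum_(k < n) \sum_(l < n) m k * m l * rkernel al (D * (1 + 2 *
    M))).
    rewrite ler_sum// => k _; rewrite ler_sum// => l _.
    apply: ler_wpM2l; first exact: mulr_ge0.
    by apply: rkernel_anti; [exact: mulr_gt0|rewrite ler_pM2l].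
  under eq_bigr do rewrite -mulr_suml -mulr_sumr sm mulr1.
  by rewrite -mulr_suml sm mul1r.
have W0 : 0 < W by exact: lt_le_trans EW.
split => //.
pose N : R := (size s)%:R; have N0 : 0 < N by rewrite ltr0n.
pose q := (hit_const a H K M * e) ^+ d.
have q0 : 0 < q by rewrite exprn_gt0// mulr_gt0// hit_const_gt0.
pose pp := allpairs (@pair 'I_n R) (index_enum 'I_n) s.
pose A (p : 'I_n * R) := boxed B f e p.2 (y p.1).
have mA p : measurable (A p) by exact: boxed_measurable.
pose pc := pair_const d a H K M * e ^+ (2 * d).
have pcp : 0 < pc by rewrite mulr_gt0// exprn_gt0.
pose V := pc * (D ^+ d * C) * N ^+ 2 * W.
have Dd : 0 < D ^+ d by rewrite exprn_gt0.
have DC : 0 < D ^+ d * C by exact: mulr_gt0.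
have N2 : 0 < N ^+ 2 by exact: exprn_gt0.
have pN : 0 < pc * (D ^+ d * C) * N ^+ 2 by apply: mulr_gt0 => //; exact: mulr_gt0.
have V0 : 0 < V by exact: mulr_gt0.
exists (\big[setU/set0]_(p <- pp) A p); first exact: bigsetU_measurable.
split; last first.
  move=> w; rewrite -bigcup_seq => -[p /= /allpairsP[[k u] /= [_ us ->]]] Aw.
  by exists u, (y k); split => //; exact: sE'.
have -> : energy_const / W = (N * q) ^+ 2 / V.
  have q2 : q ^+ 2 = hit_const a H K M ^+ (2 * d) * e ^+ (2 * d).
    by rewrite /q -exprM (mulnC d 2) exprMn.
  have aux (h p g c x z w : R) : 0 < p -> 0 < g -> 0 < c -> 0 < x -> 0 < z -> 0 < w ->
      h / (p * (g * c)) / w = z * (h * x) / (p * x * (g * c) * z * w).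
    by move=> *; field; rewrite !gt_eqF.
  by rewrite exprMn q2 /V /energy_const /pc; apply: aux => //; rewrite exprn_gt0.
have mE t : t \in s -> a <= t <= b by move/sE'/sE.
apply: (second_moment (w := fun p => m p.1)) => //; first exact: mulr_gt0.
  rewrite big_allpairs_dep /=.
  have -> : N * q = \sum_(k < n) \sum_(u <- s) m k * q.
    under eq_bigr do rewrite sumr_const_seq.
    by rewrite -mulr_sumr -mulr_suml sm mul1r.
  rewrite -sumEFin; apply: lee_sum => k _; rewrite -sumEFin big_seq [leRHS]big_seq.
  apply: lee_sum => u us; rewrite EFinM lee_wpmul2l ?lee_fin//.
  apply: (boxed_prob_ge a01 ab b1 H01 hB hf (mE _ us)); first by rewrite e0.
  by move=> i; exact: FM.
pose g (p p' : 'I_n * R) := pc * (Num.max (r p.1 p'.1) (`|p'.2 - p.2| `^ H)) ^- d.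
apply: (@le_trans _ _ (\sum_(p <- pp) \sum_(p' <- pp) (m p.1 * m p'.1 * g p p'))%R%:E).
  rewrite -sumEFin big_seq [leRHS]big_seq; apply: lee_sum => p /allpairsP[[k u] /= [_ us ->]].
  rewrite -sumEFin big_seq [leRHS]big_seq; apply: lee_sum => p' /allpairsP[[l v] /= [_ vs ->]].
  rewrite [leRHS]EFinM lee_wpmul2l ?lee_fin ?mulr_ge0//.
  apply: (boxed_pair_le a01 ab b1 H01 hB hf M0 (mE _ us) (mE _ vs) e0) => //.
    by move=> i; exact: FM.
  have [hi|[i hi]] := bigmax_attained (index_enum 'I_d) (fun i => `|y l ord0 i - y k ord0 i|)
    e; [by left|].
  by right; exists i; rewrite /r hi.
rewrite lee_fin big_allpairs_dep/=.
pose X k l := m k * m l * rkernel al (D * r k l).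
apply: (@le_trans _ _ (\sum_(k < n) \sum_(u <- s) \sum_(l < n) pc * (D ^+ d * C) * N * X k l)).
  apply: ler_sum => k _; rewrite big_seq [leRHS]big_seq; apply: ler_sum => u us.
  rewrite big_allpairs_dep/=; apply: ler_sum => l _.
  rewrite /g /= -mulr_sumr -mulr_sumr.
  (* The net sum is taken at [D * r k l], the distance at which the energy evaluates the kernel. As
     [D >= 1], the maximum with [D * r k l] is at most [D] times the maximum with [r k l], which
     costs [D^d]. *)
  have h : D ^- d * \sum_(v <- s) (Num.max (r k l) (`|v - u| `^ H)) ^- d <= C * N * rkernel
    al (D * r k l).
    apply: le_trans (hs u (D * r k l) (sE' _ us) _).
      rewrite mulr_sumr; apply: ler_sum => v _.
      have Dr : 0 < D * r k l by exact: mulr_gt0.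
      have ma : 0 < Num.max (r k l) (`|v - u| `^ H) by rewrite lt_max r0.
      have mb : 0 < Num.max (D * r k l) (`|v - u| `^ H) by rewrite lt_max Dr.
      rewrite -invfM -exprMn lef_pV2 ?posrE ?exprn_gt0//; last exact: mulr_gt0.
      rewrite lerXn2r ?nnegrE ?(ltW mb) ?(mulr_ge0 (ltW D0) (ltW ma))//.
      rewrite maxr_pMr ?(ltW D0)// ge_max le_max lexx/= le_max.
      by apply/orP; right; rewrite ler_peMl// powR_ge0.
    rewrite ler_pM2l// rM andbT (le_trans (er k l))// ler_peMl// ltW//.
  rewrite ler_pdivrMl// in h.
  have := ler_wpM2l (mulr_ge0 (mulr_ge0 (m0 k) (m0 l)) (ltW pcp)) h.
  rewrite -mulrA => /le_trans; apply; rewrite le_eqVlt; apply/orP; left; apply/eqP.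
  rewrite /X; ring.
under eq_bigr do rewrite sumr_const_seq -mulr_sumr mulrCA.
rewrite -2!mulr_sumr -/N (_ : \sum_i \sum_i0 X i i0 = EE)// /V.
have -> : pc * (D ^+ d * C) * N * (N * EE) = pc * (D ^+ d * C) * N ^+ 2 * EE by ring.
by rewrite ler_pM2l.
Qed.

End lower_bound.

Lemma energy_const_gt0 (R : realType) d (a H K M C : R) :
  (0 < d)%N -> 0 < a < 1 -> 0 < H < 1 -> 0 <= K -> 0 <= M -> 0 < C ->
  0 < energy_const d a H K M C.
Proof.
move=> d0 a01 H01 K0 M0 C0.
have D0 : 0 < Num.sqrt d%:R * 3 :> R by rewrite mulr_gt0// sqrtr_gt0 ltr0n.
rewrite /energy_const; apply: divr_gt0; first by rewrite exprn_gt0// hit_const_gt0.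
apply: mulr_gt0; first exact: pair_const_gt0.
by apply: mulr_gt0 => //; rewrite exprn_gt0.
Qed.

(** Every energy is infinite or at least [c / p], hence so is the infimum. If [p = 0], no measure
    has finite energy and the capacity vanishes. *)
Lemma capacity_le (R : realType) d (al c : R) (p : \bar R) (F : set 'rV[R]_d) :
  0 < c -> (0 <= p <= 1)%E ->
  (forall (mu : probability (borelRV R d) R) W, mu F = 1%E -> energy al mu = W%:E ->
    0 < W /\ ((c / W)%:E <= p)%E) ->
  (c%:E * capacity al F <= p)%E.
Proof.
move=> c0 /andP[p0 p1] hW; rewrite /capacity; set S := [set _ | _ in _].
have SW x : S x -> x != +oo%E -> exists2 W, x = W%:E & 0 < W /\ ((c / W)%:E <= p)%E.
  move=> [mu muF <-]; case eE: (energy al mu) => [W| |] // _; first by exists W => //;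
    exact: hW muF eE.
  have : (0 <= energy al mu)%E.
    apply: integral_ge0 => u _; apply: integral_ge0 => v _.
    by apply: riesz_kernel_ge0; exact: sqrtr_ge0.
  by rewrite eE.
have [q pq] : exists q, p = q%:E.
  by exists (fine p); rewrite fineK// ge0_fin_numE// (le_lt_trans p1)// ltry.
rewrite pq !lee_fin in SW p0 p1 *.
have [q0|q0] := ltP 0 q; last first.
  have {}q0 : q = 0 by apply/le_anti; rewrite q0.
  have -> : ereal_inf S = +oo%E.
    apply/eqP; rewrite eq_le leey andTb; apply: le_ereal_inf_tmp => x Sx.
    rewrite leNgt; apply/negP => xoo.
    have [|W _ [W0]] := SW x Sx; first by rewrite lt_eqF.
    by rewrite lee_fin q0 leNgt divr_gt0.
  by rewrite invey mule0 q0.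
have lb : ((c / q)%:E <= ereal_inf S)%E.
  apply: le_ereal_inf_tmp => x Sx; have [->|xoo] := eqVneq x +oo%E; first by rewrite leey.
  have [W -> [W0]] := SW x Sx xoo; rewrite !lee_fin.
  by rewrite !ler_pdivrMr// mulrC.
case: (ereal_inf S) lb => [r|_|]; [|by rewrite invey mule0 lee_fin ltW|by rewrite leeNy_eq].
rewrite lee_fin => h; have r0 : 0 < r by apply: lt_le_trans h; rewrite divr_gt0.
rewrite inver gt_eqF// -EFinM lee_fin ler_pdivrMr//.
by move: h; rewrite ler_pdivrMr// mulrC.
Qed.

Lemma hits_ge_capacity (R : realType) (d : nat) (a b H beta K : R)
    (E : set R) (F : set 'rV[R]_d) :
  (0 < d)%N -> 0 < a -> a < b -> b <= 1 -> 0 < H < 1 ->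
  E `<=` `[a, b]%classic -> compact E -> compact F -> ad_regular beta E ->
  exists2 c : R, 0 < c &
    forall (disp : measure_display) (T : measurableType disp)
      (P : probability T R) (B : 'I_d -> R -> {RV P >-> R}) (f : R -> 'rV[R]_d),
    is_fbm_dim `[0, 1]%classic H B -> holder_norm a b H f = K%:E ->
    (c%:E * capacity (d%:R - beta / H) F <= P (hits B f E F))%E.
Proof.
move=> d0 a0 ab b1 H01 Eab cE cF adE.
have a01 : 0 < a < 1 by rewrite a0 (lt_le_trans ab).
(* The constant is chosen before [f], so negative [K] has to be treated; no drift has such a
   norm. *)
have [K0|K0] := leP 0 K; last first.
  exists 1 => // disp T P B f hB hf; have [K1 _ _] := holder_bounds ab hf.
  by move: K0; rewrite ltNge K1.
have [M M0 FM] := compact_bounded_rV cF.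
have H0 : 0 < H by case/andP: H01.
have [C C0 hC] := net_kernel_sum d (Num.sqrt d%:R * 3 * (1 + 2 * M)) (ltW a0) b1 H0 adE.1 Eab
  cE adE.
exists (energy_const d a H K M C); first exact: energy_const_gt0.
move=> disp T P B f hB hf.
have mh := hits_measurable a0 ab b1 H01 hB hf Eab cE cF.
apply: capacity_le; first exact: energy_const_gt0.
  by rewrite measure_ge0 probability_le1.
move=> mu W muF eW.
exact: (hits_prob_ge_energy d0 a0 ab b1 H01 hB hf Eab cE cF M0 (fun x i => @FM x i) C0 hC muF
  eW).
Qed.

Lemma measure_bigcup_geometric (d : measure_display) (T : measurableType d) (R : realType)
    (mu : {measure set T -> \bar R}) (A : nat -> set T) (c : R) :
  0 <= c -> (forall n, measurable (A n)) ->
  (forall n, (mu (A n) <= (c * 2^-1 ^+ n)%:E)%E) ->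
  (mu (\bigcup_n A n) <= (2 * c)%:E)%E.
Proof.
move=> c0 mA hA.
have mU : measurable (\bigcup_n A n) by exact: bigcupT_measurable.
apply: (le_trans (measure_sigma_subadditive mu mA mU (@subset_refl _ _))).
apply: le_trans (@epsilon_trick0 R (2 * c) xpredT _); last by rewrite mulr_ge0.
apply: lee_nneseries => [n _ _|n _]; first exact: measure_ge0.
apply: (le_trans (hA n)); rewrite lee_fin natrX exprVn exprS invfM le_eqVlt.
by apply/orP; left; apply/eqP; field; rewrite expf_neq0.
Qed.

(** * Chaining on a short interval *)

Section dyadic_chaining.
Context (R : realType).
Implicit Types (g : R -> R) (u h a q : R).

Definition dyadic_point u h k m : R := u + h * (m%:R / 2 ^+ k).

Lemma dyadic_point_half u h k m : dyadic_point u h k.+1 m.*2 = dyadic_point u h k m.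
Proof. by rewrite /dyadic_point -muln2 natrM exprS; congr (_ + _ * _); field;
  rewrite expf_neq0. Qed.

(** A point of level [k + 1] is a point of level [k] or the right neighbour of one, so the path back
    to [u] uses at most one increment of each level. *)
Lemma dyadic_chain g u h a q : 0 <= a -> 0 <= q ->
  (forall k m, (m < 2 ^ k)%N ->
    `|g (dyadic_point u h k m.+1) - g (dyadic_point u h k m)| <= a * q ^+ k) ->
  forall k m, (m <= 2 ^ k)%N ->
    `|g (dyadic_point u h k m) - g u| <= a * \sum_(j < k.+1) q ^+ j.
Proof.
move=> a0 q0 hg; have z k : dyadic_point u h k 0 = u by rewrite /dyadic_point mul0r mulr0 addr0.
elim=> [|k IH] m.
  rewrite big_ord_recl big_ord0 addr0.
  case: m => [|[|m]] // _; first by rewrite z subrr normr0 mulr_ge0 ?exprn_ge0.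
  by have := hg 0%N 0%N isT; rewrite z.
rewrite big_ord_recr/= mulrDr; set S := a * \sum_(_ < _) _ in IH *.
have aq : 0 <= a * q ^+ k.+1 by rewrite mulr_ge0 ?exprn_ge0.
rewrite -(odd_double_half m); case: (odd m); rewrite ?add0n ?add1n => hm; last first.
  rewrite dyadic_point_half; apply: le_trans (IH _ _) _; last by rewrite lerDl.
  by move: hm; rewrite expnS mul2n leq_double.
have hm2 : (m./2.*2 < 2 ^ k.+1)%N by [].
have h1 := hg k.+1 _ hm2; rewrite dyadic_point_half in h1.
have hm' : (m./2 <= 2 ^ k)%N.
  by move: hm2; rewrite expnS mul2n ltn_double => /ltnW.
rewrite (_ : _ - _ = (g (dyadic_point u h k.+1 m./2.*2.+1) - g (dyadic_point u h k m./2)) +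
  (g (dyadic_point u h k m./2) - g u)); last by ring.
by apply: (le_trans (ler_normD _ _)); rewrite addrC lerD// IH.
Qed.

Lemma geometric_sum_le q k : 0 <= q < 1 -> \sum_(j < k) q ^+ j <= (1 - q)^-1.
Proof.
move=> /andP[q0 q1]; have q1' : 0 < 1 - q by rewrite subr_gt0.
rewrite -[leRHS]mul1r ler_pdivlMr// mulrC -opprB mulNr -subrX1 opprB.
by rewrite gerBl exprn_ge0.
Qed.

Lemma dyadic_dense u h t e : 0 < h -> u <= t <= u + h -> 0 < e ->
  exists k m, (m <= 2 ^ k)%N /\ `|t - dyadic_point u h k m| < e.
Proof.
move=> h0 /andP[ut tv] e0.
have [k hk] : exists k, h / e < k%:R by exists (Num.truncn (h / e)).+1; rewrite truncnS_gt.
have k0 : 0 < 2 ^+ k :> R by rewrite exprn_gt0.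
have hk2 : h / 2 ^+ k < e.
  rewrite ltr_pdivrMr// -ltr_pdivrMl// mulrC (lt_le_trans hk)// -natrX ler_nat.
  by rewrite ltnW// ltn_expl.
set y := (t - u) / h * 2 ^+ k.
have y0 : 0 <= y by rewrite mulr_ge0 ?(ltW k0)// divr_ge0 ?subr_ge0// ltW.
have y1 : y <= 2 ^+ k.
  by rewrite /y ler_piMl ?(ltW k0)// ler_pdivrMr// mul1r lerBlDl.
have /andP[m1 m2] := truncn_itv y0.
exists k, (Num.truncn y); split.
  by rewrite -(ler_nat R) natrX (le_trans m1).
rewrite /dyadic_point (_ : t - _ = h / 2 ^+ k * (y - (Num.truncn y)%:R)); last first.
  by rewrite /y; field; rewrite !gt_eqF.
have hp : 0 < h / 2 ^+ k by rewrite divr_gt0.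
rewrite ger0_norm ?(mulr_ge0 (ltW hp)) ?subr_ge0//.
apply: le_lt_trans hk2; rewrite ler_piMr ?(ltW hp)//.
by move: m2; rewrite -natr1; lra.
Qed.

End dyadic_chaining.

Section residual.
Context (disp : measure_display) (T : measurableType disp) (R : realType)
  (P : probability T R) (a H : R) (X : R -> {RV P >-> R}).
Hypothesis a01 : 0 < a < 1.
Hypothesis H01 : 0 < H < 1.
Hypothesis hX : is_fbm `[0, 1]%classic H X.

Let in01 t : a <= t <= 1 -> `[0, 1]%classic t.
Proof.
by move=> /andP[at_ t1]; have /andP[a0 _] := a01; rewrite /= in_itv/= t1 andbT (le_trans (ltW
  a0)).
Qed.

Let covuu u : a <= u <= 1 -> 0 < fbm_cov H u u.
Proof.
case/andP: a01 => a0 _ /andP[au _]; have u0 := lt_le_trans a0 au.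
by rewrite fbm_covxx ?(ltW u0)// exprn_gt0// powR_gt0.
Qed.

(* The part of [X t] that is independent of [X u]. *)
Definition residual u t (w : T) : R := X t w - fbm_cov H u t / fbm_cov H u u * X u w.

(** Subtracting the projection on [X u] leaves a variable uncorrelated with [X u] and lowers the
    variance of the increment, by the square of the difference of the covariances with [X u] over
    the variance of [X u]. *)
Lemma residual_increment u t1 t2 : a <= u <= 1 -> a <= t1 <= 1 -> a <= t2 <= 1 ->
  exists2 v, v ^+ 2 <= (`|t2 - t1| `^ H) ^+ 2 &
    gauss_pair P (X u) (fun w => residual u t2 w - residual u t1 w) (u `^ H) v.
Proof.
move=> hu h1 h2; have c0 := covuu hu.
have ge0 t : a <= t <= 1 -> 0 <= t by case/andP => h _; apply: le_trans h;
  case/andP: a01 => /ltW.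
pose dr := fbm_cov H u t2 / fbm_cov H u u - fbm_cov H u t1 / fbm_cov H u u.
have [v vE _] := fbm_law3 hX 1 (-1) (- dr) (in01 h2) (in01 h1) (in01 hu).
exists v.
  have -> : (`|t2 - t1| `^ H) ^+ 2 = fbm_cov H t2 t2 + fbm_cov H t1 t1 - 2 * fbm_cov H t2 t1.
    by rewrite !fbm_covxx ?fbm_covE ?ge0// distrC; field.
  rewrite vE -subr_ge0 (fbm_covC _ t2 u) (fbm_covC _ t1 u) /dr.
  rewrite [X in 0 <= X](_ : _ = (fbm_cov H u t2 - fbm_cov H u t1) ^+ 2 / fbm_cov H u u);
    last first.
    by field; rewrite gt_eqF.
  by rewrite divr_ge0 ?sqr_ge0 ?(ltW c0).
have -> : (fun w => residual u t2 w - residual u t1 w) =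
    (fun w => 1 * X t2 w + -1 * X t1 w + - dr * X u w).
  by apply/funext => w; rewrite /residual /dr; ring.
apply: fbm_pair => //; [exact: in01|exact: in01|exact: in01|].
by rewrite /dr; field; rewrite gt_eqF.
Qed.

Let normX_tail (N : nat) (v D lam : R) : 0 < lam -> v ^+ 2 <= D ^+ 2 ->
  (v ^+ 2 / lam ^+ 2) ^+ N <= (D ^+ 2 / lam ^+ 2) ^+ N.
Proof.
move=> l0 vD; rewrite lerXn2r ?nnegrE ?divr_ge0 ?sqr_ge0//.
by rewrite ler_wpM2r// invr_ge0 sqr_ge0.
Qed.

(** The windowed tail bound with the constant 0 in place of [X u]: the window is then no restriction
    and its factor is 1. *)
Lemma residual_tail N u t1 t2 lam : (0 < N)%N -> 0 < lam ->
  a <= u <= 1 -> a <= t1 <= 1 -> a <= t2 <= 1 ->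
  (P [set w | (lam < `|residual u t2 w - residual u t1 w|)%R] <=
   (tail_const R N * (((`|t2 - t1| `^ H) ^+ 2 / lam ^+ 2) ^+ N))%:E)%E.
Proof.
move=> N0 l0 hu h1 h2; have [v vD [mU mV hUV]] := residual_increment hu h1 h2.
have pr0 : gauss_pair P (fun=> 0) (fun w => residual u t2 w - residual u t1 w) 0 v.
  split => // x y; have [s sE hs] := hUV 0 y; exists s.
    by rewrite sE; ring.
  suff <- : (fun w => 0 * X u w + y * (residual u t2 w - residual u t1 w)) =
     (fun w => x * 0 + y * (residual u t2 w - residual u t1 w)) by [].
  by apply/funext => w; ring.
have := gauss_pair_tail pr0 0 N0 ltr01 l0.
rewrite (_ : [set w | _ /\ _] = [set w | (lam < `|residual u t2 w - residual u t1 w|)%R]);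
  last first.
  by apply/seteqP; split => w /= => [[]|]//; split => //; rewrite subrr normr0.
move/le_trans; apply; rewrite lee_fin expr0n/= add0r expr1n sqrtr1 divr1 mul1r.
by rewrite ler_wpM2l ?tail_const_ge0// normX_tail.
Qed.

Lemma residual_window_tail N u t1 t2 c e lam : (0 < N)%N -> 0 < e -> 0 < lam ->
  a <= u <= 1 -> a <= t1 <= 1 -> a <= t2 <= 1 ->
  (P [set w | (`|X u w - c| <= e)%R /\ (lam < `|residual u t2 w - residual u t1 w|)%R] <=
   (tail_const R N * (e / a `^ H) * (((`|t2 - t1| `^ H) ^+ 2 / lam ^+ 2) ^+ N))%:E)%E.
Proof.
move=> N0 e0 l0 hu h1 h2; have [v vD pr] := residual_increment hu h1 h2.
apply: (le_trans (gauss_pair_tail pr c N0 e0 l0)); rewrite lee_fin -[leRHS]mulrA.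
have /andP[a0 _] := a01; have /andP[H0 _] := H01; have /andP[au _] := hu.
have A0 : 0 < a `^ H by rewrite powR_gt0.
have aU : a `^ H <= u `^ H.
  by rewrite ge0_ler_powR ?nnegrE ?(ltW H0) ?(ltW a0)// (le_trans (ltW a0)).
have A2 : a `^ H <= Num.sqrt ((u `^ H) ^+ 2 + e ^+ 2).
  apply: (le_trans aU); rewrite -[leLHS]ger0_norm ?powR_ge0// -sqrtr_sqr ler_wsqrtr// lerDl
    sqr_ge0//.
rewrite ler_wpM2l ?tail_const_ge0// ler_pM ?normX_tail ?divr_ge0 ?(ltW e0) ?sqrtr_ge0//.
  by rewrite exprn_ge0// divr_ge0// sqr_ge0.
by rewrite ler_wpM2l ?(ltW e0)// lef_pV2 ?posrE// (lt_le_trans A0).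
Qed.

(** The two-point bound at equal times and equal targets, where [theta = e]. *)
Lemma window_prob_le u c e : 0 < e -> a <= u <= 1 ->
  (P [set w | (`|X u w - c| <= e)%R] <= (box_const a H * e)%:E)%E.
Proof.
move=> e0 hu; have /andP[H0 _] := H01.
have := two_point_le a01 H01 hX c c hu hu e0.
rewrite subrr normr0 powR0 ?gt_eqF// max_r ?(ltW e0)//.
rewrite (_ : e ^+ 2 / e = e); last by field; rewrite gt_eqF.
rewrite (_ : [set w | _ /\ _] = [set w | (`|X u w - c| <= e)%R])//.
by apply/seteqP; split => w /= => [[]|].
Qed.

Lemma fbm_path_continuous w t e : `[0, 1]%classic t -> 0 < e ->
  exists2 del, 0 < del & forall s, `[0, 1]%classic s -> `|t - s| < del -> `|X t w - X s w| < e.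
Proof.
move=> t01 e0; case: hX => _ _ _ /(_ w) cw.
have /subspace_continuousP/(_ t t01)/cvgrPdist_lt/(_ e e0) := cw.
rewrite /within/= => h.
have {}h : nbhs t (fun s => `[0, 1]%classic s -> `|X t w - X s w| < e) := h.
have /nbhs_ballP[del /= d0 hd] := h; exists del => // s s01 ts; exact: hd.
Qed.

End residual.

Section chaining.
Context (disp : measure_display) (T : measurableType disp) (R : realType)
  (P : probability T R) (a H : R) (X : R -> {RV P >-> R}).
Hypothesis a01 : 0 < a < 1.
Hypothesis H01 : 0 < H < 1.
Hypothesis hX : is_fbm `[0, 1]%classic H X.
Variable N : nat.
Hypothesis HN : 2 <= H * N%:R.
Variables (u h tau : R).
Hypothesis h0 : 0 < h.
Hypothesis au : a <= u.
Hypothesis uh1 : u + h <= 1.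
Hypothesis htau : h `^ H <= tau.
Hypothesis tau0 : 0 < tau.

(* The increments of the residual between neighbours of level [k] have standard
   deviation at most [tau * chain_ratio ^+ (2 * k)]. The threshold
   [2 ^+ j * (tau * chain_ratio ^+ k)] is summable in [k] and is exceeded with
   a probability that decreases geometrically in [j] and [k]. *)
Definition chain_ratio : R := 2^-1 `^ (H / 2).

Lemma chain_ratio_lt1 : 0 < chain_ratio < 1.
Proof.
have /andP[H0 _] := H01.
by rewrite powR_gt0//= -[ltRHS](powR_one (H / 2)) gt0_ltr_powR ?nnegrE ?divr_gt0// invf_lt1//
  ltr1n.
Qed.

Let q := chain_ratio.
Let q0 : 0 < q. Proof. by case/andP: chain_ratio_lt1. Qed.

Let q2 : q ^+ 2 = 2^-1 `^ H.
Proof. by rewrite -powR_mulrn ?powR_ge0// -powRrM divfK. Qed.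

Let q2k0 k : 0 <= (q ^+ 2) ^+ k. Proof. exact/exprn_ge0/sqr_ge0. Qed.

(** Here [2 <= H * N] enters. It makes an increment of level [k] fail with probability of order
    [4^-k], so that the [2^k] increments of that level contribute [2^-k]. *)
Let q2N : (q ^+ 2) ^+ N <= 4^-1.
Proof.
rewrite q2 -powR_mulrn ?powR_ge0// -powRrM.
apply: (@le_trans _ _ (2^-1 `^ 2)).
  by apply: (ger_powR _ HN); rewrite invr_gt0 ltr0n/= invf_le1// ler1n.
by rewrite powR_mulrn// exprVn -natrX.
Qed.

Let N0 : (0 < N)%N.
Proof. by case: N HN => //; rewrite mulr0 => /le_lt_trans/(_ (ltr0n R 2)); rewrite ltxx. Qed.

Let point := dyadic_point u h.

Let pointI k m : (m <= 2 ^ k)%N -> a <= point k m <= 1.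
Proof.
move=> mk; have r0 : 0 <= (m%:R / 2 ^+ k : R) by rewrite divr_ge0.
have r1 : (m%:R / 2 ^+ k : R) <= 1.
  by rewrite ler_pdivrMr ?exprn_gt0// mul1r -natrX ler_nat.
rewrite /point /dyadic_point; apply/andP; split.
  by rewrite (le_trans au)// lerDl mulr_ge0// ltW.
by apply: le_trans uh1; rewrite lerD2l ler_piMr// ltW.
Qed.

Let uI : a <= u <= 1.
Proof. by rewrite au (le_trans _ uh1)// lerDl ltW. Qed.

Let point_step k m : `|point k m.+1 - point k m| `^ H <= tau * (q ^+ 2) ^+ k.
Proof.
have /andP[H0 _] := H01.
rewrite (_ : point k m.+1 - point k m = h * 2^-1 ^+ k); last first.
  by rewrite /point /dyadic_point -natr1 exprVn; ring.
rewrite ger0_norm; last by rewrite mulr_ge0 ?(ltW h0)// exprn_ge0.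
rewrite powRM ?(ltW h0) ?exprn_ge0// q2.
rewrite (_ : (2^-1 ^+ k) `^ H = (2^-1 `^ H) ^+ k); last first.
  have h2 : 0 <= 2^-1 :> R by rewrite invr_ge0.
  by rewrite -(powR_mulrn k h2) -(powR_mulrn k (powR_ge0 2^-1 H)) -[LHS]powRrM -[RHS]powRrM
    mulrC.
by rewrite ler_wpM2r// exprn_ge0// powR_ge0.
Qed.

Definition chain_fail j : set T :=
  \bigcup_k \bigcup_(m in `I_(2 ^ k)) [set w |
    2 ^+ j * (tau * chain_ratio ^+ k) <
    `|residual H X u (dyadic_point u h k m.+1) w - residual H X u (dyadic_point u h k m) w|].

Let lam0 j k : 0 < 2 ^+ j * (tau * q ^+ k).
Proof. by rewrite mulr_gt0 ?exprn_gt0// mulr_gt0 ?exprn_gt0. Qed.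

(** Stated for an event [Q] with a factor [kap], to cover both the whole space and a window of
    [X u]. At level [k] the ratio of variance to squared threshold is at most [4^-j (q^2)^k]; its
    [N]-th power is at most [4^-j 4^-k]. *)
Lemma chain_fail_prob (Q : set T) kap j : measurable Q -> 0 <= kap ->
  (forall t1 t2 lam, a <= t1 <= 1 -> a <= t2 <= 1 -> 0 < lam ->
    measurable [set w | lam < `|residual H X u t2 w - residual H X u t1 w|] /\
    (P (Q `&` [set w | (lam < `|residual H X u t2 w - residual H X u t1 w|)%R]) <=
     (kap * ((`|t2 - t1| `^ H) ^+ 2 / lam ^+ 2) ^+ N)%:E)%E) ->
  (P (Q `&` chain_fail j) <= (2 * (kap * 4^-1 ^+ j))%:E)%E.
Proof.
move=> mQ k0 hQ.
have f0 i : 0 <= 4^-1 ^+ i :> R by rewrite exprn_ge0.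
have inc k m : (m < 2 ^ k)%N ->
    measurable [set w | 2 ^+ j * (tau * q ^+ k) < `|residual H X u (point k m.+1) w -
      residual H X u (point k m) w|] /\
    (P (Q `&` [set w | (2 ^+ j * (tau * q ^+ k) < `|residual H X u (point k m.+1) w -
      residual H X u (point k m) w|)%R]) <=
    (kap * (4^-1 ^+ j * 4^-1 ^+ k))%:E)%E.
  move=> mk; have [m1 m2] := hQ _ _ _ (pointI (ltnW mk)) (pointI mk) (lam0 j k).
  split => //; apply: (le_trans m2); rewrite lee_fin ler_wpM2l//.
  apply: (@le_trans _ _ ((4^-1 ^+ j * (q ^+ 2) ^+ k) ^+ N)).
    have l0 : 0 <= (`|point k m.+1 - point k m| `^ H) ^+ 2 / (2 ^+ j * (tau * q ^+ k)) ^+ 2.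
      by apply: divr_ge0; exact: sqr_ge0.
    have r0 := mulr_ge0 (f0 j) (q2k0 k).
    rewrite lerXn2r ?nnegrE// ler_pdivrMr; last by rewrite exprn_gt0 ?lam0.
    apply: (@le_trans _ _ ((tau * (q ^+ 2) ^+ k) ^+ 2)).
      rewrite lerXn2r ?nnegrE ?powR_ge0 ?(mulr_ge0 (ltW tau0))//.
    have e1 : (q ^+ k) ^+ 2 = (q ^+ 2) ^+ k by rewrite -!exprM mulnC.
    have e2 : (2 ^+ j) ^+ 2 = 4 ^+ j :> R by rewrite -exprM mulnC exprM -natrX.
    have e4 : 4^-1 ^+ j * 4 ^+ j = 1 :> R by rewrite -exprMn mulVf// expr1n.
    rewrite (exprMn _ (2 ^+ j)) (exprMn _ tau (q ^+ k)) e1 e2.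
    rewrite [leRHS](_ : _ = (4^-1 ^+ j * 4 ^+ j) * (tau * (q ^+ 2) ^+ k) ^+ 2); last by ring.
    by rewrite e4 mul1r.
  rewrite exprMn; apply: ler_pM; [exact: exprn_ge0|exact: exprn_ge0| |].
    have e1 : 4^-1 ^+ j <= 1 :> R by rewrite exprn_ile1// invf_le1// ler1n.
    by case: N N0 => // n _; rewrite exprS ler_piMr// exprn_ile1.
  by rewrite -[leLHS]exprM mulnC exprM lerXn2r ?nnegrE.
rewrite /chain_fail setI_bigcupr.
apply: measure_bigcup_geometric.
- by rewrite mulr_ge0// exprn_ge0.
- move=> k; rewrite setI_bigcupr; apply: bigcup_measurable => m mk.
  by apply: measurableI => //; case: (inc k m mk).
move=> k; rewrite setI_bigcupr bigcup_mkord.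
apply: (@le_trans _ _ (\sum_(m < 2 ^ k) (kap * (4^-1 ^+ j * 4^-1 ^+ k))%:E)%E).
  set G := fun i : nat => Q `&` [set w | (2 ^+ j * (tau * chain_ratio ^+ k) <
    `|residual H X u (dyadic_point u h k i.+1) w - residual H X u (dyadic_point u h k i) w|)%R].
  have mG i : (i < 2 ^ k)%N -> measurable (G i).
    by move=> ik; apply: measurableI => //; case: (inc k i ik).
  apply: le_trans (Boole_inequality P mG) _.
  by apply: lee_sum => m _; case: (inc k m (ltn_ord m)).
rewrite sumEFin lee_fin sumr_const card_ord -[leLHS]mulr_natl natrX.
rewrite le_eqVlt; apply/orP; left; apply/eqP.
have e4 : 4^-1 ^+ k = 2^-1 ^+ k * 2^-1 ^+ k :> R.
  by rewrite -exprMn; congr (_ ^+ _); field.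
have e2 : 2 ^+ k * 2^-1 ^+ k = 1 :> R by rewrite -exprMn mulfV// expr1n.
rewrite e4 [LHS](_ : _ = (2 ^+ k * 2^-1 ^+ k) * (kap * 4^-1 ^+ j * 2^-1 ^+ k)); last by ring.
by rewrite e2 mul1r.
Qed.

(** The residual vanishes at time [u], so without failures it is bounded by the geometric sum of the
    thresholds at all dyadic points. Returning to [X] adds [(rho - 1) * X u], the second term;
    continuity of the path reaches the other times. *)
Lemma chain_fail_bound j w t : ~ chain_fail j w -> u <= t <= u + h ->
  `|X t w - X u w| <= 2 ^+ j * tau / (1 - chain_ratio) + 2 / (a `^ H) ^+ 2 * tau * `|X u w|.
Proof.
move=> nf tI; have /andP[H0 _] := H01; have /andP[_ q1] := chain_ratio_lt1.
set Bd := leRHS.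
have main k m : (m <= 2 ^ k)%N -> `|X (point k m) w - X u w| <= Bd.
  move=> mk.
  have hres : `|residual H X u (point k m) w - residual H X u u w| <= 2 ^+ j * tau / (1 - q).
    have hs : forall k' m', (m' < 2 ^ k')%N ->
      `|residual H X u (point k' m'.+1) w - residual H X u (point k' m') w| <= (2 ^+ j * tau)
        * q ^+ k'.
      move=> k' m' mk'; rewrite leNgt; apply/negP => hlt; apply: nf.
      by exists k' => //; exists m' => //=; rewrite mulrA.
    have lt0 : 0 <= 2 ^+ j * tau by rewrite mulr_ge0 ?exprn_ge0// ltW.
    have := dyadic_chain (g := fun t => residual H X u t w) lt0 (ltW q0) hs mk.
    move/le_trans; apply; rewrite ler_wpM2l// geometric_sum_le//.
    by rewrite (ltW q0).
  have c0 : 0 < fbm_cov H u u.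
    have /andP[a0 _] := a01; have u0 := lt_le_trans a0 au.
    by rewrite fbm_covxx ?(ltW u0)// exprn_gt0// powR_gt0.
  have r0 : residual H X u u w = 0 by rewrite /residual divff ?mul1r ?subrr ?gt_eqF.
  rewrite r0 subr0 /residual in hres.
  have hr := fbm_regression_near1 H01 a01 uI (pointI mk).
  have hp : `|point k m - u| `^ H <= tau.
    apply: le_trans htau; rewrite ge0_ler_powR ?nnegrE ?(ltW H0) ?(ltW h0)//.
    rewrite /point /dyadic_point addrAC subrr add0r ger0_norm;
      last by rewrite mulr_ge0 ?(ltW h0)// divr_ge0.
    by rewrite ler_piMr ?(ltW h0)// ler_pdivrMr ?exprn_gt0// mul1r -natrX ler_nat.
  set rho := fbm_cov H u _ / _ in hres hr.
  rewrite (_ : X (point k m) w - X u w = (X (point k m) w - rho * X u w) + (rho - 1) * X u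
    w); last by ring.
  apply: (le_trans (ler_normD _ _)); rewrite /Bd lerD// normrM ler_wpM2r//.
  by apply: (le_trans hr); rewrite ler_wpM2l// divr_ge0// sqr_ge0.
apply/ler_addgt0Pr => e e0.
have in01 s : a <= s <= 1 -> `[0, 1]%classic s.
  move=> /andP[h1 h2]; have /andP[a0 _] := a01.
  by rewrite /= in_itv/= h2 andbT (le_trans (ltW a0)).
have t01 : `[0, 1]%classic t.
  by case/andP: tI => h1 h2; apply: in01; rewrite (le_trans au h1) (le_trans h2).
have [del d0 hd] := fbm_path_continuous hX w t01 e0.
have [k [m [mk hm]]] := dyadic_dense h0 tI d0.
have hc := hd _ (in01 _ (pointI mk)) hm.
rewrite (_ : X t w - X u w = (X (point k m) w - X u w) + (X t w - X (point k m) w));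
  last by ring.
by apply: (le_trans (ler_normD _ _)); rewrite lerD ?main// ltW.
Qed.

End chaining.

Lemma measurable_norm_gt d (T : measurableType d) (R : realType) (Y : T -> R) (lam : R) :
  measurable_fun setT Y -> measurable [set w | lam < `|Y w|].
Proof.
move=> mY; rewrite (_ : [set w | _] = ~` [set w | `|Y w - 0| <= lam]).
  by apply: measurableC; exact: measurable_norm_le.
by apply/seteqP; split => w /=; rewrite subr0 ltNge => /negP.
Qed.

(** * Reaching a level during a short interval *)

Section interval_hit.
Context (disp : measure_display) (T : measurableType disp) (R : realType)
  (P : probability T R) (a H : R) (X : R -> {RV P >-> R}).
Hypothesis a01 : 0 < a < 1.
Hypothesis H01 : 0 < H < 1.
Hypothesis hX : is_fbm `[0, 1]%classic H X.
Variable N : nat.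
Hypothesis HN : 2 <= H * N%:R.

(** The chaining bound contains a multiple of [tau * |X u|], hence of [tau * |X u - w0|], with
    factor at most 1/2 for small [tau]. Absorbing it on the left doubles the remaining terms. *)
Definition window_const A M : R :=
  2 * (A + (1 - chain_ratio H)^-1 + 2 / (a `^ H) ^+ 2 * M).

(** The summands bound, in this order, the window around the target, the failures at intermediate
    indices together with a wider window, the failure at the last index, and the case of [tau] not
    small. *)
Definition interval_const A M : R :=
  box_const a H * window_const A M + 8 * (tail_const R N * (window_const A M / a `^ H))
  + 2 * tail_const R N + 2 * (2 / (a `^ H) ^+ 2).

Let A0 : 0 < a `^ H. Proof. by rewrite powR_gt0//; case/andP: a01. Qed.

Let c0 : 0 <= 2 / (a `^ H) ^+ 2. Proof. by rewrite divr_ge0// sqr_ge0. Qed.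

Lemma window_const_gt0 A M : 0 <= A -> 0 <= M -> 0 < window_const A M.
Proof.
move=> hA hM; have /andP[q0 q1] := chain_ratio_lt1 H01.
rewrite mulr_gt0// ltr_pwDl ?(mulr_ge0 c0)// ltr_wpDl// invr_gt0 subr_gt0//.
Qed.

Lemma interval_const_gt0 A M : 0 <= A -> 0 <= M -> 0 < interval_const A M.
Proof.
move=> hA hM; have W0 := window_const_gt0 hA hM; have t0 := tail_const_ge0 R N.
have b0 := box_const_gt0 a01 H01.
have h1 : 0 < box_const a H * window_const A M by exact: mulr_gt0.
have h2 : 0 <= tail_const R N * (window_const A M / a `^ H).
  by apply: mulr_ge0 => //; apply: divr_ge0; exact: ltW.
rewrite /interval_const; move: c0 t0 h1 h2; lra.
Qed.

(* If [j] is the first index at which [chain_fail j] does not occur, then [X u]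
   is within [C3 2^j tau] of the target, and [chain_fail (j - 1)], which has
   probability of order [4^-j], occurs independently of [X u]. *)
Lemma interval_hit u h tau A M w0 : 0 < h -> a <= u -> u + h <= 1 ->
  h `^ H <= tau -> 0 < tau -> tau <= 1 -> 0 <= A -> 0 <= M -> `|w0| <= M ->
  exists Om : set T, [/\ process_sigma `[0, 1]%classic X Om,
    (forall w t, u <= t <= u + h -> `|X t w - w0| <= A * tau -> Om w) &
    (P Om <= (interval_const A M * tau)%:E)%E].
Proof.
move=> h0 au uh1 htau tau0 tau1 hA hM w0M.
have W0 := window_const_gt0 hA hM; have t0 := tail_const_ge0 R N.
have b0 := box_const_gt0 a01 H01; have /andP[q0 q1] := chain_ratio_lt1 H01.
have /andP[a0 _] := a01.
have uI : a <= u <= 1 by rewrite au (le_trans _ uh1)// lerDl ltW.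
have in01 t : a <= t <= 1 -> `[0, 1]%classic t.
  by move=> /andP[h1 h2]; rewrite /= in_itv/= h2 andbT (le_trans (ltW a0)).
have N0 : (0 < N)%N.
  by case: (N) HN => //; rewrite mulr0 => /le_lt_trans/(_ (ltr0n R 2)); rewrite ltxx.
set C3 := window_const A M in W0 *.
have h1 : 0 <= box_const a H * C3 by apply: mulr_ge0; exact: ltW.
have h2 : 0 <= tail_const R N * (C3 / a `^ H).
  by apply: mulr_ge0 => //; apply: divr_ge0; exact: ltW.
have c0' := c0; set c := 2 / (a `^ H) ^+ 2 in c0'.
have [ctau|ctau] := leP (c * tau) (1 / 2); last first.
  (* Here the last summand of [interval_const] alone makes the bound exceed 1. *)
  exists setT; split => //; first by rewrite process_sigmaE.
  apply: (@le_trans _ _ 1%E); first exact: probability_le1.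
  rewrite lee_fin /interval_const -/c -/C3.
  have := mulr_ge0 h1 (ltW tau0); have := mulr_ge0 h2 (ltW tau0).
  have := mulr_ge0 t0 (ltW tau0); lra.
(* At this index the failure probability, of order [4^-J], is already below order [tau], so no
   window is required for it. *)
have [J Jtau] : exists J, 2^-1 ^+ J < tau.
  have [|J /andP[Jtau _]] := @dyadic_scale R tau; first by rewrite tau0.
  by exists J.+1.
pose win e := [set w | `|X u w - w0| <= e].
pose fail := chain_fail H X u h tau.
pose mid j := win (C3 * 2 ^+ j.+1 * tau) `&` fail j.
(* Plain measurability of [Om] would not do: the independence of the coordinates is later applied to
   such events, so they must lie in the sigma-algebra of the process. *)
have pX t : a <= t <= 1 -> measurable_fun setT (X t : process_type `[0, 1]%classic X -> R).
  by move=> /in01 ht; exact: process_measurable_fun.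
have pres t : a <= t <= 1 ->
    measurable_fun setT (residual H X u t : process_type `[0, 1]%classic X -> R).
  by move=> ht; apply: measurable_funB; [exact: pX|apply: measurable_funM => //; exact: pX].
have pinc t1 t2 lam : a <= t1 <= 1 -> a <= t2 <= 1 -> process_sigma `[0, 1]%classic X
    [set w | lam < `|residual H X u t2 w - residual H X u t1 w|].
  by move=> ht1 ht2; rewrite process_sigmaE; apply: measurable_norm_gt;
    apply: measurable_funB; exact: pres.
have pwin e : process_sigma `[0, 1]%classic X (win e).
  by rewrite process_sigmaE; apply: measurable_norm_le; exact: pX.
have pointI k m : (m <= 2 ^ k)%N -> a <= dyadic_point u h k m <= 1.
  move=> mk; have r0 : 0 <= (m%:R / 2 ^+ k : R) by rewrite divr_ge0.
  have r1 : (m%:R / 2 ^+ k : R) <= 1.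
    by rewrite ler_pdivrMr ?exprn_gt0// mul1r -natrX ler_nat.
  rewrite /dyadic_point; apply/andP; split.
    by rewrite (le_trans au)// lerDl mulr_ge0// ltW.
  by apply: le_trans uh1; rewrite lerD2l ler_piMr// ltW.
have pfail j : process_sigma `[0, 1]%classic X (fail j).
  rewrite process_sigmaE; apply: bigcupT_measurable => k; apply: bigcup_measurable => m mk.
  by rewrite -process_sigmaE; apply: pinc; apply: pointI => //; exact: ltnW.
have pmid j : process_sigma `[0, 1]%classic X (mid j).
  by rewrite process_sigmaE; apply: measurableI; rewrite -process_sigmaE.
have mwin e : measurable (win e) by exact: process_sigma_measurable (pwin e).
have mfail j : measurable (fail j) by exact: process_sigma_measurable (pfail j).
have mmid j : measurable (mid j) by exact: process_sigma_measurable (pmid j).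
have mU : measurable (\bigcup_j mid j) by exact: bigcupT_measurable.
exists (win (C3 * tau) `|` (\bigcup_j mid j) `|` fail J); split.
- rewrite process_sigmaE; apply: measurableU; [apply: measurableU|]; rewrite -process_sigmaE//.
  by rewrite process_sigmaE; apply: bigcupT_measurable => j; rewrite -process_sigmaE.
- move=> w t tI Xt.
  have key j : ~ fail j w -> `|X u w - w0| <= C3 * 2 ^+ j * tau.
    move=> nf; have := chain_fail_bound a01 H01 hX h0 au uh1 htau tau0 nf tI.
    rewrite -/c => hb.
    have j1 : 1 <= 2 ^+ j :> R by rewrite exprn_ege1// ler1n.
    have hX1 : `|X u w| <= M + `|X u w - w0|.
      rewrite [X in `|X| <= _](_ : _ = w0 + (X u w - w0)); last by ring.
      by apply: (le_trans (ler_normD _ _)); rewrite lerD2r.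
    have hX2 : `|X u w - w0| <= `|X t w - X u w| + `|X t w - w0|.
      rewrite distrC (_ : w0 - X u w = (X t w - X u w) - (X t w - w0)); last by ring.
      exact: ler_normB.
    have hc := ler_wpM2l (mulr_ge0 c0' (ltW tau0)) hX1.
    have hcc := ler_wpM2r (normr_ge0 (X u w - w0)) ctau.
    rewrite mulrDr in hc.
    have hAj : A * tau <= A * (2 ^+ j * tau) by rewrite ler_wpM2l// ler_peMl// ltW.
    have hMj : c * tau * M <= c * M * (2 ^+ j * tau).
      by rewrite mulrAC ler_wpM2l ?(mulr_ge0 c0')// ler_peMl// ltW.
    rewrite /C3 /window_const -/c.
    rewrite [leRHS](_ : _ = 2 * (A * (2 ^+ j * tau) + 2 ^+ j * tau / (1 - chain_ratio H) + c
      * M * (2 ^+ j * tau))); last by ring.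
    by move: hb hX2 Xt hc hcc hAj hMj; lra.
  have [fJ|nfJ] := pselect (fail J w); first by right.
  left; have ex : exists j, `[< ~ fail j w >] by exists J; apply/asboolP.
  case: (ex_minnP ex) => -[|j] /asboolP nf hmin.
    by left; have := key 0%N nf; rewrite expr0 mulr1.
  right; exists j => //; split; first exact: key nf.
  apply: contrapT => nfj; have := hmin j; rewrite ltnn => /(_ _)/notF; apply; exact/asboolP.
have e4 j : 4^-1 ^+ j = 2^-1 ^+ j * 2^-1 ^+ j :> R.
  by rewrite -exprMn; congr (_ ^+ _); field.
have half1 : 0 <= 2^-1 :> R by rewrite invr_ge0.
(* The window has width of order [2^j tau] and the failure probability is of order [4^-j], which
   leaves a summable [2^-j tau]. *)
have Pmid j : (P (mid j) <= (4 * (tail_const R N * (C3 / a `^ H)) * tau * 2^-1 ^+ j)%:E)%E.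
  have ej : 0 < C3 * 2 ^+ j.+1 * tau by rewrite mulr_gt0// mulr_gt0// exprn_gt0.
  have kap0 : 0 <= tail_const R N * (C3 * 2 ^+ j.+1 * tau / a `^ H).
    by apply: mulr_ge0 => //; apply: divr_ge0; exact: ltW.
  apply: le_trans (chain_fail_prob H01 HN h0 au uh1 htau tau0 j (mwin _) kap0 _) _.
    move=> t1 t2 lam ht1 ht2 l0; split; first exact: process_sigma_measurable (pinc _ _ _ ht1
      ht2).
    by have := residual_window_tail a01 H01 hX w0 N0 ej l0 uI ht1 ht2.
  rewrite lee_fin e4 exprS.
  have e2 : 2 ^+ j * 2^-1 ^+ j = 1 :> R by rewrite -exprMn mulfV// expr1n.
  rewrite [leLHS](_ : _ = (2 ^+ j * 2^-1 ^+ j) * (4 * (tail_const R N * (C3 / a `^ H)) * tau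
    * 2^-1 ^+ j)); last by ring.
  by rewrite e2 mul1r.
have PU : (P (\bigcup_j mid j) <= (2 * (4 * (tail_const R N * (C3 / a `^ H)) * tau))%:E)%E.
  apply: measure_bigcup_geometric => //.
  by rewrite mulr_ge0 ?(ltW tau0)// mulr_ge0.
have PJ : (P (fail J) <= (2 * tail_const R N * tau)%:E)%E.
  have -> : fail J = setT `&` fail J by rewrite setTI.
  apply: le_trans (chain_fail_prob H01 HN h0 au uh1 htau tau0 J measurableT t0 _) _.
    move=> t1 t2 lam ht1 ht2 l0; split; first exact: process_sigma_measurable (pinc _ _ _ ht1
      ht2).
    rewrite setTI; exact: (residual_tail a01 H01 hX N0 l0 uI ht1 ht2).
  rewrite lee_fin -mulrA ler_wpM2l// ler_wpM2l//.
  rewrite e4 (le_trans _ (ltW Jtau))// ler_piMl ?exprn_ge0//.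
  by rewrite exprn_ile1// invf_le1// ler1n.
have Pw : (P (win (C3 * tau)%R) <= (box_const a H * C3 * tau)%:E)%E.
  by rewrite -mulrA; apply: window_prob_le => //; exact: mulr_gt0.
apply: le_trans (measureU2 _ _ _) _ => //; first exact: measurableU.
apply: le_trans (leeD (le_trans (measureU2 _ _ _) (leeD Pw PU)) PJ) _ => //.
rewrite -!EFinD lee_fin /interval_const -/c -/C3.
have := mulr_ge0 c0' (ltW tau0); lra.
Qed.

End interval_hit.

Lemma hausdorff_delta_ge0 (R : realType) d (al : R) (G : set 'rV[R]_d) del :
  (0 <= hausdorff_delta al G del)%E.
Proof.
apply: le_ereal_inf_tmp => _ [p _ <-]; apply: nneseries_ge0 => n _ _.
by rewrite lee_fin powR_ge0.
Qed.

Lemma hausdorff_delta_cvg (R : realType) d (al : R) (G : set 'rV[R]_d) :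
  cvg (hausdorff_delta al G delta @[delta --> 0^'+]).
Proof.
apply: nonincreasing_at_right_is_cvge; apply: nearW => z x y _ _ xy.
apply: ereal_inf_le_tmp => _ [p [pI pG] <-]; exists p => //; split => // n.
by have /andP[-> h] := pI n; rewrite (le_trans h).
Qed.

(** A hit up to [r] and a variation of the drift by at most [K * (2 * r)] give the tolerance
    [(1 + K) * (2 * r)]; target coordinates up to [M + 1] and a drift up to [K] give the level
    [M + 1 + K]. *)
Definition tube_const (R : realType) (a H K M : R) N : R :=
  interval_const a H N (1 + K) (M + 1 + K).

Definition ball_const (R : realType) (d : nat) (a H beta K M C : R) N : R :=
  C * 2 `^ (beta / H) * tube_const a H K M N ^+ d.

Lemma tube_const_gt0 (R : realType) (a H K M : R) N : 0 < a < 1 -> 0 < H < 1 ->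
  0 <= K -> 0 <= M -> 0 < tube_const a H K M N.
Proof. by move=> *; apply: interval_const_gt0 => //; rewrite !addr_ge0. Qed.

Lemma ball_const_gt0 (R : realType) (d : nat) (a H beta K M C : R) N :
  0 < a < 1 -> 0 < H < 1 -> 0 <= K -> 0 <= M -> 0 < C -> 0 < ball_const d a H beta K M C N.
Proof.
by move=> *; rewrite mulr_gt0 ?exprn_gt0 ?tube_const_gt0// mulr_gt0// powR_gt0.
Qed.

(** * Covering the target *)

Section upper_bound.
Context (disp : measure_display) (T : measurableType disp) (R : realType)
  (P : probability T R) (d : nat) (a b H beta K M C : R).
Variables (B : 'I_d -> R -> {RV P >-> R}) (f : R -> 'rV[R]_d)
  (E : set R) (F : set 'rV[R]_d) (N : nat).
Hypothesis a0 : 0 < a.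
Hypothesis ab : a < b.
Hypothesis b1 : b <= 1.
Hypothesis H01 : 0 < H < 1.
Hypothesis HN : 2 <= H * N%:R.
Hypothesis hB : is_fbm_dim `[0, 1]%classic H B.
Hypothesis hf : holder_norm a b H f = K%:E.
Hypothesis Eab : E `<=` `[a, b]%classic.
Hypothesis cE : compact E.
Hypothesis cF : compact F.
Hypothesis M0 : 0 <= M.
Hypothesis FM : forall x i, F x -> `|x ord0 i| <= M.
Hypothesis C0 : 0 < C.
Hypothesis net : forall delta : R, 0 < delta <= 1 -> exists s : seq R,
    [/\ {in s, forall u, E u},
        (forall x, E x -> exists2 u, u \in s & `|u - x| < delta) &
        (size s)%:R <= C * delta `^ (- beta)].

Let a01 : 0 < a < 1. Proof. by rewrite a0 (lt_le_trans ab). Qed.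
Let K0 : 0 <= K. Proof. by case: (holder_bounds ab hf). Qed.
Let H0 : 0 < H. Proof. by case/andP: H01. Qed.

Let tc := tube_const a H K M N.
Let bc := ball_const d a H beta K M C N.

Let tube0 : 0 < tc. Proof. exact: tube_const_gt0. Qed.

Let bc0 : 0 < bc. Proof. exact: ball_const_gt0. Qed.

(** While the drift varies by at most [K * (2 * r)], hitting the box around [x] forces each
    coordinate of the process to approach one fixed level. The events of the coordinates lie in
    their own sigma-algebras, so their probabilities multiply. *)
Lemma tube_hit u0 (x : 'rV[R]_d) r : a <= u0 <= b -> 0 < r <= 2^-1 ->
  (forall i, `|x ord0 i| <= M + 1) ->
  exists Om : set T, [/\ measurable Om,
    (forall w t, a <= t <= b -> `|u0 - t| < r `^ H^-1 ->
      (forall i, `|shifted B f w t ord0 i - x ord0 i| <= r) -> Om w) &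
    (P Om <= ((tc * (2 * r)) ^+ d)%:E)%E].
Proof.
move=> /andP[au0 u0b] /andP[r0 r1] xM.
have r2 : 0 < 2 * r by rewrite mulr_gt0.
have r21 : 2 * r <= 1 by rewrite -ler_pdivlMl// mulr1.
set del := r `^ H^-1; have del0 : 0 < del by rewrite powR_gt0.
(* The interval around [u0] is clipped to [[a, b]], where the drift is controlled; the drift is
   frozen at the left end [u]. *)
pose u := Num.max a (u0 - del); pose v := Num.min b (u0 + del).
have au : a <= u by rewrite le_max lexx.
have vb : v <= b by rewrite ge_min lexx.
have uv : u < v.
  rewrite gt_max !lt_min ab/=; apply/andP; split; first by rewrite (le_lt_trans au0)// ltrDl.
  by rewrite (lt_le_trans _ u0b) ?ltrBlDr ?ltrDl//=; move: del0; lra.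
have uu0 : u0 - del <= u by rewrite le_max lexx orbT.
have vu0 : v <= u0 + del by rewrite ge_min lexx orbT.
have h0 : 0 < v - u by rewrite subr_gt0.
(* The length is at most [2 * del] with [del^H = r], and [2^H <= 2]; so [2 * r] is the scale [tau]
   of the interval. *)
have htau : (v - u) `^ H <= 2 * r.
  apply: (@le_trans _ _ ((2 * del) `^ H)).
    rewrite ge0_ler_powR ?nnegrE ?(ltW H0) ?(ltW h0) ?mulr_ge0 ?(ltW del0)//; lra.
  rewrite powRM ?(ltW del0)// /del -powRrM mulVf ?gt_eqF// powRr1 ?(ltW r0)//.
  rewrite ler_wpM2r ?(ltW r0)// -[leRHS]powRr1// ler_powR ?ler1n//.
  by case/andP: H01 => _ /ltW.
have [_ fK fL] := holder_bounds ab hf.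
pose w0 i := x ord0 i - f u ord0 i.
have uab : a <= u <= b by rewrite au (le_trans (ltW uv)).
have w0M i : `|w0 i| <= M + 1 + K.
  by apply: (le_trans (ler_normB _ _)); rewrite lerD// fK.
have hOm i : exists Om : set T, [/\ process_sigma `[0, 1]%classic (B i) Om,
    (forall w t, u <= t <= u + (v - u) -> `|B i t w - w0 i| <= (1 + K) * (2 * r) -> Om w) &
    (P Om <= (tc * (2 * r))%:E)%E].
  apply: (interval_hit a01 H01 (proj1 hB i) HN) => //; rewrite ?addr_ge0//.
  by rewrite addrC subrK (le_trans vb).
have [Om {}hOm] := choice hOm.
have [|p [pE PE]] := fbm_dim_prod hB (A := Om); first by move=> i; case: (hOm i).
exists (\bigcap_(i in [set: 'I_d]) Om i); split.
- by apply: fin_bigcap_measurable => // i _; case: (hOm i) => /process_sigma_measurable.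
- move=> w t tab ut hw i _; case: (hOm i) => _ h _; apply: (h w t).
    move: ut; rewrite ltr_norml => /andP[ut1 ut2]; case/andP: tab => at_ tb.
    rewrite addrC subrK /u /v ge_max le_min at_ tb /=; apply/andP; split; move: ut1 ut2; lra.
  have tu : `|t - u| `^ H <= 2 * r.
    apply: le_trans htau; rewrite ge0_ler_powR ?nnegrE ?(ltW H0) ?(ltW h0)//.
    move: ut; rewrite ltr_norml => /andP[ut1 ut2]; case/andP: tab => at_ tb.
    have ut : u <= t by rewrite /u ge_max at_/=; move: ut2; lra.
    have tv : t <= v by rewrite /v le_min tb/=; move: ut1; lra.
    by rewrite ger0_norm ?subr_ge0// lerB.
  have := hw i; rewrite shiftedE => hi.
  rewrite (_ : B i t w - w0 i = (B i t w + f t ord0 i - x ord0 i) - (f t ord0 i - f u ord0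
    i)); last first.
    by rewrite /w0; ring.
  apply: (le_trans (ler_normB _ _)); rewrite mulrDl mul1r lerD//.
    by apply: (le_trans hi); move: r0; lra.
  by apply: (le_trans (fL _ _ _ uab tab)); rewrite ler_wpM2l.
rewrite PE lee_fin -[X in _ ^+ X]card_ord -prodr_const ler_prod// => i _.
by case: (hOm i) => _ _; rewrite pE lee_fin => ->; rewrite -lee_fin -pE measure_ge0.
Qed.

Lemma ball_hit (x : 'rV[R]_d) r : 0 < r <= 2^-1 ->
  (forall i, `|x ord0 i| <= M + 1) ->
  exists G : set T, [/\ measurable G,
    (forall w t, E t -> (forall i, `|shifted B f w t ord0 i - x ord0 i| <= r) -> G w) &
    (P G <= (bc * (2 * r) `^ (d%:R - beta / H))%:E)%E].
Proof.
move=> rI xM; have /andP[r0 r1] := rI.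
have r2 : 0 < 2 * r by rewrite mulr_gt0.
have [|s [sE hs sz]] := @net (r `^ H^-1).
  rewrite powR_gt0//= -[leRHS](powR_one H^-1) ge0_ler_powR ?nnegrE ?invr_ge0 ?(ltW H0) ?(ltW
    r0)//.
  by rewrite (le_trans r1)// invf_le1// ler1n.
have hOm u0 : exists Om : set T, a <= u0 <= b -> [/\ measurable Om,
    (forall w t, a <= t <= b -> `|u0 - t| < r `^ H^-1 ->
      (forall i, `|shifted B f w t ord0 i - x ord0 i| <= r) -> Om w) &
    (P Om <= ((tc * (2 * r)) ^+ d)%:E)%E].
  have [u0I|] := boolP (a <= u0 <= b); last by exists set0.
  by have [Om h] := tube_hit u0I rI xM; exists Om.
have [Om {}hOm] := choice hOm.
have EI t : E t -> a <= t <= b by move/Eab; rewrite /= in_itv.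
pose G i := Om (nth 0 s i).
have GP i : (i < size s)%N -> [/\ measurable (G i),
    (forall w t, a <= t <= b -> `|nth 0 s i - t| < r `^ H^-1 ->
      (forall i, `|shifted B f w t ord0 i - x ord0 i| <= r) -> G i w) &
    (P (G i) <= ((tc * (2 * r)) ^+ d)%:E)%E].
  by move=> si; apply: hOm; apply: EI; apply: sE; exact: mem_nth.
exists (\big[setU/set0]_(i < size s) G i); split.
- by apply: bigsetU_measurable => i _; case: (GP i (ltn_ord i)).
- move=> w t Et hw; have [u us ut] := hs t Et.
  rewrite -bigcup_mkord; exists (index u s); first by rewrite /= index_mem.
  have [|_ h _] := GP (index u s); first by rewrite index_mem.
  by apply: (h w t) => //; [exact: EI|rewrite nth_index].
have mG i : (i < size s)%N -> measurable (G i) by move=> /GP[].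
apply: (le_trans (Boole_inequality P mG)).
apply: (@le_trans _ _ (\sum_(i < size s) ((tc * (2 * r)) ^+ d)%:E)%E).
  by apply: lee_sum => i _; case: (GP i (ltn_ord i)).
rewrite sumEFin lee_fin sumr_const card_ord -[leLHS]mulr_natl.
apply: (@le_trans _ _ (C * (r `^ H^-1) `^ (- beta) * (tc * (2 * r)) ^+ d)).
  by rewrite ler_wpM2r// exprn_ge0// mulr_ge0 ?(ltW r2)// ltW.
(* Powers of [r] become powers of [2 * r], the quantity that the Hausdorff measure sums; this is the
   origin of [2^(beta / H)] in [ball_const]. *)
have e1 : (r `^ H^-1) `^ (- beta) = 2 `^ (beta / H) * (2 * r) `^ (- (beta / H)).
  rewrite -powRrM powRM ?(ltW r0)// mulrA -powRD; last by apply/implyP => _; rewrite pnatr_eq0.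
  by rewrite subrr powRr0 mul1r mulrN mulrC.
have e2 : (2 * r) `^ (d%:R - beta / H) = (2 * r) ^+ d * (2 * r) `^ (- (beta / H)).
  by rewrite powRD ?powR_mulrn ?(ltW r2)//; apply/implyP => _; rewrite gt_eqF.
rewrite e1 e2 /bc /ball_const -/tc exprMn le_eqVlt; apply/orP; left; apply/eqP; ring.
Qed.

Let alpha := d%:R - beta / H.

Lemma hits_le_hausdorff_delta del : 0 < del <= 2^-1 ->
  (P (hits B f E F) <= bc%:E * hausdorff_delta alpha F del)%E.
Proof.
move=> /andP[del0 del1].
have mh := hits_measurable a0 ab b1 H01 hB hf Eab cE cF.
rewrite -lee_pdivrMl//; apply: le_ereal_inf_tmp => _ [[x r] /= [rI Fcov] <-].
rewrite lee_pdivrMl//.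
have hG n : exists G : set T, [/\ measurable G,
    (forall w t, E t -> F (shifted B f w t) -> eball (x n) (r n) (shifted B f w t) -> G w) &
    (P G <= (bc * (2 * r n) `^ alpha)%:E)%E].
  (* A covering ball that misses [F], possibly empty or far from the origin, is given the empty
     event. A ball that meets [F] has centre coordinates of absolute value at most [M + 1], so one
     constant serves all of them. *)
  have [[y [Fy yb]]|none] := pselect (exists y, F y /\ eball (x n) (r n) y); last first.
    exists set0; split => //.
      by move=> w t Et Fw wb; apply: none; exists (shifted B f w t).
    by rewrite measure0 lee_fin mulr_ge0 ?powR_ge0// ltW.
  have /andP[r0 r1] := rI n.
  have rn0 : 0 < r n by apply: le_lt_trans yb; exact: sqrtr_ge0.
  have rn1 : 0 < r n <= 2^-1 by rewrite rn0 (le_trans r1).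
  have coord (z : 'rV[R]_d) i : eball (x n) (r n) z -> `|z ord0 i - x n ord0 i| <= r n.
    move=> zb; apply: (le_trans _ (ltW zb)); have := le_enorm (z - x n) i.
    by rewrite !mxE.
  have [|G [mG hw PG]] := ball_hit (x := x n) rn1.
    move=> i; rewrite -[x n ord0 i](subrK (y ord0 i)).
    apply: (le_trans (ler_normD _ _)); rewrite addrC lerD ?FM// distrC.
    apply: (le_trans (coord _ i yb)); have /andP[_] := rn1; move=> /le_trans; apply.
    by rewrite invf_le1// ler1n.
  exists G; split => // w t Et _ wb; apply: (hw w t) => // i; exact: coord.
have [G {}hG] := choice hG.
apply: (@le_trans _ _ (\sum_(0 <= n <oo) P (G n))%E).
  apply: measure_sigma_subadditive => //; first by move=> n; case: (hG n).
  move=> w /hitsP[t [y [Et Fy ty]]]; have Ft : F (shifted B f w t) by rewrite ty.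
  have [n _ hn] := Fcov _ Ft.
  by exists n => //; case: (hG n) => _ h _; exact: (h w t).
rewrite -nneseriesZl; last by move=> n _; rewrite lee_fin powR_ge0.
apply: lee_nneseries => [n _ _|n _]; first exact: measure_ge0.
by case: (hG n) => _ _; rewrite EFinM.
Qed.

Lemma hits_le_hausdorff : 0 < alpha ->
  (P (hits B f E F) <= bc%:E * hausdorff_measure alpha F)%E.
Proof.
move=> al0.
have aln : (alpha <= 0) = false by apply/negbTE; rewrite -ltNge.
rewrite /hausdorff_measure aln -lee_pdivrMl//.
apply: lime_ge; first exact: hausdorff_delta_cvg.
near=> del; rewrite lee_pdivrMl//; apply: hits_le_hausdorff_delta.
apply/andP; split; first by near: del; exact: nbhs_right_gt.
by near: del; apply: nbhs_right_le; rewrite invr_gt0.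
Unshelve. all: by end_near. Qed.

End upper_bound.

(** * Both bounds with uniform constants *)

Lemma capacity_ge0 (R : realType) d (al : R) (F : set 'rV[R]_d) : (0 <= capacity al F)%E.
Proof.
rewrite inve_ge0; apply: le_ereal_inf_tmp => _ [mu _ <-].
apply: integral_ge0 => u _; apply: integral_ge0 => v _.
by apply: riesz_kernel_ge0; exact: sqrtr_ge0.
Qed.

Lemma hausdorff_measure_ge0 (R : realType) d (al : R) (F : set 'rV[R]_d) :
  (0 <= hausdorff_measure al F)%E.
Proof.
rewrite /hausdorff_measure; case: ifP => // _.
apply: lime_ge; first exact: hausdorff_delta_cvg.
by apply: nearW => del; exact: hausdorff_delta_ge0.
Qed.

Lemma hits_le_hausdorff_ex (R : realType) (d : nat) (a b H beta K : R)
    (E : set R) (F : set 'rV[R]_d) :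
  0 < a -> a < b -> b <= 1 -> 0 < H < 1 ->
  E `<=` `[a, b]%classic -> compact E -> compact F -> ad_regular beta E ->
  exists2 c : R, 0 < c &
    forall (disp : measure_display) (T : measurableType disp)
      (P : probability T R) (B : 'I_d -> R -> {RV P >-> R}) (f : R -> 'rV[R]_d),
    is_fbm_dim `[0, 1]%classic H B -> holder_norm a b H f = K%:E ->
    (P (hits B f E F) <= c%:E * hausdorff_measure (d%:R - beta / H) F)%E.
Proof.
move=> a0 ab b1 H01 Eab cE cF adE.
have a01 : 0 < a < 1 by rewrite a0 (lt_le_trans ab).
have [K0|K0] := leP 0 K; last first.
  exists 1 => // disp T P B f hB hf; have [K1 _ _] := holder_bounds ab hf.
  by move: K0; rewrite ltNge K1.
(* By convention the Hausdorff measure is 1 here, and the claim is that a probability is at most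
   1. *)
have [al0|al0] := leP (d%:R - beta / H) 0.
  exists 1 => // disp T P B f hB hf; rewrite mul1e /hausdorff_measure al0.
  exact: probability_le1 (hits_measurable a0 ab b1 H01 hB hf Eab cE cF).
have [M M0 FM] := compact_bounded_rV cF.
have H0 : 0 < H by case/andP: H01.
have [C C0 hC] := ad_net cE adE.
have [N HN] : exists N, 2 <= H * N%:R.
  exists (Num.truncn (2 / H)).+1; rewrite -ler_pdivrMl// mulrC ltW//.
  by rewrite truncnS_gt.
have net (delta : R) : 0 < delta <= 1 -> exists s : seq R,
    [/\ {in s, forall u, E u},
        (forall x, E x -> exists2 u, u \in s & `|u - x| < delta) &
        (size s)%:R <= C * delta `^ (- beta)].
  by move=> /hC[s [h1 h2 h3 _ _]]; exists s.
exists (ball_const d a H beta K M C N); first exact: ball_const_gt0 a01 H01 K0 M0 C0.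
move=> disp T P B f hB hf.
exact: (hits_le_hausdorff a0 ab b1 H01 HN hB hf Eab cE cF M0 (fun x i => @FM x i) C0 net al0).
Qed.
Theorem proposition3p3 (R : realType) (d : nat) (a b H beta K : R)
    (E : set R) (F : set 'rV[R]_d) :
  (0 < d)%N ->
  0 < a -> a < b -> b <= 1 ->
  0 < H < 1 ->
  0 < beta <= 1 ->
  E `<=` `[a, b]%classic -> compact E -> compact F ->
  ad_regular beta E ->
  exists2 c : R, 0 < c &
    forall (disp : measure_display) (T : measurableType disp)
      (P : probability T R) (B : 'I_d -> R -> {RV P >-> R})
      (f : R -> 'rV[R]_d),
    measure_is_complete P ->
    is_fbm_dim `[0, 1]%classic H B ->
    holder_space a b H f -> holder_norm a b H f = K%:E ->
    ((c^-1)%:E * capacity (d%:R - beta / H) F <= P (hits B f E F))%E /\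
    (P (hits B f E F) <= c%:E * hausdorff_measure (d%:R - beta / H) F)%E.
Proof.
move=> d0 a0 ab b1 H01 _ Eab cE cF adE.
have [c1 c10 hc1] := hits_ge_capacity K d0 a0 ab b1 H01 Eab cE cF adE.
have [c2 c20 hc2] := hits_le_hausdorff_ex K a0 ab b1 H01 Eab cE cF adE.
(* One constant for both sides: [c^-1 <= c1] and [c2 <= c]. *)
pose c := Num.max c1^-1 c2.
have c0 : 0 < c by rewrite lt_max c20 orbT.
exists c => // disp T P B f _ hB _ hf; split.
  apply: le_trans (hc1 disp T P B f hB hf); rewrite lee_wpmul2r ?capacity_ge0// lee_fin.
  by rewrite -[leRHS]invrK lef_pV2 ?posrE ?invr_gt0// le_max lexx.
apply: (le_trans (hc2 disp T P B f hB hf)).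
by rewrite lee_wpmul2r ?hausdorff_measure_ge0// lee_fin le_max lexx orbT.
Qed.
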